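(* Let $(\Gamma,G,\Lambda)$ be a splitting crystal triple in $\mathbb{R}^d$, $r=|G|$, let $a$ be a $\Gamma$-admissible matrix, and assume that $\phi\in L^2(\mathbb{R}^d,\mathbb{C})$ is compactly supported and has orthonormal translates on $\Gamma$, i.e. for all $\gamma,\sigma\in\Gamma$, $$\langle D_\gamma\phi,D_\sigma\phi\rangle=\int D_\gamma\phi(x)\overline{D_\sigma\phi(x)}\,dx=\delta_{\gamma,\sigma}.$$ Let $\mathcal{V}_0=\overline{\mathrm{span}}\{D_\gamma\phi\}_{\gamma\in\Gamma}\subset L^2(\mathbb{R}^d)$ and $\mathcal{V}_j=\{f(a^j\,\cdot\,):f\in\mathcal{V}_0\}$ for $j\in\mathbb{Z}$. Then the following hold. (1) $\mathcal{V}_{j+1}=D_a^{-1}\mathcal{V}_j$ for all $j\in\mathbb{Z}$; $\{D_\gamma\phi:\gamma\in\Gamma\}$ is an orthonormal basis of $\mathcal{V}_0$; and $\bigcap_{j\in\mathbb{Z}}\mathcal{V}_j=\{0\}$. (2) $\mathcal{V}_j\subset\mathcal{V}_{j+1}$ for all $j\in\mathbb{Z}$ if and only if $\phi$ satisfies a refinement equation of the form $$\phi(x)=\sum_{\gamma\in\Gamma'}d_\gamma\,D_\gamma\phi(ax)$$ for some scalars $d_\gamma$ and some finite set $\Gamma'\subset\Gamma$. (3) If $$|\widehat\phi(0)|^2=\frac{|L|}{r},\qquad(\ast)$$ where $|L|$ is the measure of a fundamental domain $L$ of the lattice $\Lambda$, then $\bigcup_{j\in\mathbb{Z}}\mathcal{V}_j$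 is dense in $L^2(\mathbb{R}^d)$. Moreover, if $\phi$ is refinable (satisfies an equation as in (2)), then $\bigcup_{j\in\mathbb{Z}}\mathcal{V}_j$ is dense in $L^2(\mathbb{R}^d)$ if and only if $(\ast)$ holds.
   Context: A crystal group is a discrete subgroup $\Gamma$ of the isometry group of $\mathbb{R}^d$ admitting a compact fundamental domain. Then $\Lambda=\Gamma\cap\{\text{translations}\}$ consists of the translations by the vectors of a full rank lattice, also denoted $\Lambda$, and the point group $G\cong\Gamma/\Lambda$ (the linear parts of elements of $\Gamma$) is a finite subgroup of $O(d)$ with $g(\Lambda)=\Lambda$ for $g\in G$; $(\Gamma,G,\Lambda)$ is a crystal triple. It is splitting if $\Gamma=G\ltimes\Lambda$; then elements are $\gamma=(g,k)$, $g\in G$, $k\in\Lambda$, acting by $\gamma(x)=g(x+k)$. A matrix $a$ is $\Gamma$-admissible if all its eigenvalues have modulus larger than $1$ and $a\Gamma a^{-1}\subset\Gamma$. Standing assumption: $a$ admits a set of digits $\{d_0,\dots,d_{m-1}\}$ (representatives of $\Lambda/a\Lambda$, $m=|\det a|$) such that the unique compact set $\mathcal{Q}$ with $a(\mathcal{Q})=\bigcup_s(\mathcal{Q}+d_s)$ is a tiling of $\mathbb{R}^d$, i.e. $\{\mathcal{Q}+\lambda\}_{\lambda\in\Lambda}$ covers $\mathbb{R}^d$. For an invertible affine map $\gamma$ with linear part $\mathrm{lin}(\gamma)$, $D_\gamma f(x)=|\det\mathrm{lin}(\gamma)|^{-1/2}f(\gamma^{-1}x)$; $D_\gamma\phi(ax)$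 means $(D_\gamma\phi)(ax)$. The Fourier transform is $\widehat f(\omega)=\int_{\mathbb{R}^d}f(x)e^{-2\pi ix\cdot\omega}\,dx$. *)

(* Defs.v *)
From HB Require Import structures.
From mathcomp Require Import all_boot all_order all_algebra.
From mathcomp Require Import finmap.
From mathcomp Require Import all_classical all_reals all_analysis.
From mathcomp Require Import complex.

Set Implicit Arguments.
Unset Strict Implicit.
Unset Printing Implicit Defensive.

Import Order.TTheory GRing.Theory Num.Theory.
Import numFieldNormedType.Exports.

Local Open Scope classical_set_scope.
Local Open Scope ring_scope.

(* The product sigma-algebra on column vectors, generated by the coordinate
   functions; over the reals it is the Borel sigma-algebra. *)
Definition measure_cV_display : measure_display -> measure_display.
Proof. exact. Qed.

Section measurable_cV.
Context {d} {T : sigmaRingType d}.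
Variable n : nat.

Let coors : 'I_n -> 'cV[T]_n -> T := fun i x => x i ord0.

Let cV_set0 : g_sigma_preimage coors set0.
Proof. exact: sigma_algebra0. Qed.

Let cV_setC A : g_sigma_preimage coors A -> g_sigma_preimage coors (~` A).
Proof. exact: sigma_algebraC. Qed.

Let cV_bigcup (F : _^nat) : (forall i, g_sigma_preimage coors (F i)) ->
  g_sigma_preimage coors (\bigcup_i (F i)).
Proof. exact: sigma_algebra_bigcup. Qed.

HB.instance Definition _ := @isMeasurable.Build (measure_cV_display d)
  'cV[T]_n (g_sigma_preimage coors) cV_set0 cV_setC cV_bigcup.

End measurable_cV.

Lemma measurable_coord d (T : measurableType d) n (i : 'I_n) :
  measurable_fun [set: 'cV[T]_n] (fun v => v i ord0).
Proof.
move=> _ Y mY; rewrite setTI; apply: sub_sigma_algebra => /=.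
rewrite -bigcup_seq/=; exists i => /=; first by rewrite mem_index_enum.
by exists Y => //; rewrite setTI.
Qed.

Lemma measurable_fun_coord d1 d2 (T1 : measurableType d1)
    (T2 : measurableType d2) n (f : T1 -> 'cV[T2]_n) :
  (forall i, measurable_fun [set: T1] (fun x => f x i ord0)) ->
  measurable_fun [set: T1] f.
Proof.
move=> mf; apply: measurability => //.
move=> _ [E + <-]; rewrite -bigcup_seq/= => -[i _ [B mB <-]].
by rewrite [X in f @^-1` X]setTI; exact: mf.
Qed.

Lemma measurable_cV_cons (R : realType) n :
  measurable_fun [set: R * 'cV[R]_n]
    (fun p => col_mx (p.1)%:M p.2 : 'cV[R]_n.+1).
Proof.
apply: measurable_fun_coord => i.
case: (splitP (i : 'I_(1 + n))) => [j|j] ij.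
- rewrite (_ : (fun _ => _) = fst); first exact: measurable_fst.
  apply/funext => -[x v] /=.
  rewrite (_ : i = lshift n j); last exact: val_inj.
  by rewrite (@col_mxEu _ 1) ord1 mxE eqxx mulr1n.
- rewrite (_ : (fun _ => _) = (fun v : 'cV[R]_n => v j ord0) \o snd).
    exact: (measurableT_comp (measurable_coord j) measurable_snd).
  apply/funext => -[x v] /=.
  rewrite (_ : i = rshift 1 j); last exact: val_inj.
  by rewrite (@col_mxEd _ 1).
Qed.

Section lebesgue_step.
Local Open Scope ereal_scope.
Variables (R : realType) (n : nat).
Variable m : {sigma_finite_measure set 'cV[R]_n -> \bar R}.

Definition lebesgue_step : set 'cV[R]_n.+1 -> \bar R :=
  pushforward (@lebesgue_measure R \x m)
    (fun p : R * 'cV[R]_n => col_mx (p.1)%:M p.2).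

Let mcons := @measurable_cV_cons R n.

Let lebesgue_step0 : lebesgue_step set0 = 0.
Proof. exact: measure0. Qed.

Let lebesgue_step_ge0 A : 0 <= lebesgue_step A.
Proof. exact: measure_ge0. Qed.

Let lebesgue_step_sigma_additive : semi_sigma_additive lebesgue_step.
Proof. exact: measure_semi_sigma_additive. Qed.

HB.instance Definition _ := isMeasure.Build _ _ _ lebesgue_step
  lebesgue_step0 lebesgue_step_ge0 lebesgue_step_sigma_additive.

Let lebesgue_step_sigma_finite : sigma_finite setT lebesgue_step.
Proof.
have [F FT Ffin] : sigma_finite setT (@lebesgue_measure R \x m).
  have /sigma_finiteP[F [TF ndF Foo]] := sigma_finiteT (@lebesgue_measure R).
  have /sigma_finiteP[G [TG ndG Goo]] := sigma_finiteT m.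
  exists (fun k => F k `*` G k).
    rewrite -setXTT TF TG predeqE => -[x y]; split.
      move=> [/= [i _ Fix] [j _ Gjy]]; exists (maxn i j) => //; split.
      - by move: x Fix; exact/subsetPset/ndF/leq_maxl.
      - by move: y Gjy; exact/subsetPset/ndG/leq_maxr.
    by move=> [i _ []/= ? ?]; split; exists i.
  move=> k; have [? ?] := Foo k; have [? ?] := Goo k.
  split; first exact: measurableX.
  by rewrite product_measure1E// lte_mul_pinfty// ge0_fin_numE.
pose un (v : 'cV[R]_n.+1) : R * 'cV[R]_n :=
  (v ord0 ord0, dsubmx (v : 'cV[R]_(1 + n))).
have mun : measurable_fun [set: 'cV[R]_n.+1] un.
  apply: measurable_fun_pair; first exact: measurable_coord.
  apply: measurable_fun_coord => i.
  rewrite (_ : (fun _ => _) =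
      fun v : 'cV[R]_n.+1 => v (rshift 1 i : 'I_n.+1) ord0).
    exact: measurable_coord.
  by apply/funext => v; rewrite mxE.
exists (fun k => un @^-1` F k).
  by rewrite -preimage_bigcup -FT preimage_setT.
move=> k; have [mF Fk] := Ffin k; split.
  by rewrite -[X in measurable X]setTI; exact: mun.
have unK (p : (R * 'cV[R]_n)%type) : un (col_mx (p.1)%:M p.2) = p.
  case: p => x v; rewrite /un /= (@col_mxKd _ 1).
  rewrite (_ : ord0 = lshift n (ord0 : 'I_1)); last exact: val_inj.
  by rewrite (@col_mxEu _ 1) mxE eqxx mulr1n.
rewrite /lebesgue_step /pushforward (_ : _ @^-1` _ = F k)//.
by apply/seteqP; split => p /=; rewrite unK.
Qed.

HB.instance Definition _ := @Measure_isSigmaFinite.Build _ _ _ lebesgue_step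
  lebesgue_step_sigma_finite.

End lebesgue_step.

Fixpoint lebesgue_cV (R : realType) (n : nat) :
    {sigma_finite_measure set 'cV[R]_n -> \bar R} :=
  match n with
  | 0%N => dirac (0 : 'cV[R]_0)
  | n'.+1 => lebesgue_step (lebesgue_cV R n')
  end.

Lemma lebesgue_cV_box (R : realType) n (A : 'I_n -> set R) :
  (forall i, measurable (A i)) ->
  lebesgue_cV R n [set v | forall i, A i (v i ord0)] =
  (\prod_(i < n) @lebesgue_measure R (A i))%E.
Proof.
elim: n A => [|n IH] A mA.
  rewrite big_ord0 /= diracE (_ : _ \in _ = true)//.
  by apply/mem_set => -[].
rewrite big_ord_recl -IH//= /lebesgue_step /pushforward -product_measure1E//.
- congr product_measure1; apply/seteqP; split => -[x v] /= H.
  + split => [|i].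
      move: (H ord0); rewrite (_ : ord0 = lshift n (ord0 : 'I_1)).
        by rewrite (@col_mxEu _ 1) mxE eqxx mulr1n.
      exact: val_inj.
    move: (H (lift ord0 i)); rewrite (_ : lift ord0 i = rshift 1 i).
      by rewrite (@col_mxEd _ 1).
    exact: val_inj.
  + case: H => Hx Hv i; case: (splitP (i : 'I_(1 + n))) => j ij.
      rewrite (_ : i = lshift n j); last exact: val_inj.
      rewrite (@col_mxEu _ 1) ord1 mxE eqxx mulr1n.
      by rewrite (_ : lshift n ord0 = ord0) //; exact: val_inj.
    rewrite (_ : i = rshift 1 j); last exact: val_inj.
    rewrite (@col_mxEd _ 1) (_ : rshift 1 j = lift ord0 j)//.
    exact: val_inj.
- exact: mA.
- suff -> : (fun v : 'cV[R]_n => forall i, A (lift ord0 i) (v i ord0)) =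
      \bigcap_(i in [set: 'I_n])
        ((fun v : 'cV[R]_n => v i ord0) @^-1` A (lift ord0 i)).
    apply: fin_bigcap_measurable; first exact: finite_finset.
    move=> i _; rewrite -[X in measurable X]setTI.
    by apply: measurable_coord => //; exact: mA.
  by apply/seteqP; split => v /= H i; [move=> _|]; exact: H.
Qed.

(* The norm that the library puts on 'cV[R]_n is the sup norm; the Euclidean
   one is needed for isometries. *)
Section euclidean.
Variables (R : realType) (n : nat).
Implicit Types x y : 'cV[R]_n.

Definition dotv x y : R := \sum_(i < n) x i ord0 * y i ord0.

Definition enorm x : R := Num.sqrt (dotv x x).

End euclidean.

Section affine_maps.
Variables (R : realType) (n : nat).

(* (A, b) stands for the map x |-> A x + b; every isometry of R^n is of this
   form. *)
Definition affine : Type := ('M[R]_n * 'cV[R]_n)%type.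

Implicit Types (s t : affine) (S : set affine) (v : 'cV[R]_n) (A : 'M[R]_n).

Definition aff_apply s v : 'cV[R]_n := s.1 *m v + s.2.

Definition aff_id : affine := (1%:M, 0).

Definition aff_comp s t : affine := (s.1 *m t.1, s.1 *m t.2 + s.2).

Definition aff_inv s : affine := (invmx s.1, - (invmx s.1 *m s.2)).

Definition aff_lin A : affine := (A, 0).

Definition aff_trans v : affine := (1%:M, v).

Definition isometry s : Prop :=
  forall x y, enorm (aff_apply s x - aff_apply s y) = enorm (x - y).

Definition isometry_subgroup S : Prop :=
  [/\ S `<=` isometry, S aff_id,
      forall s t, S s -> S t -> S (aff_comp s t) &
      forall s, S s -> S (aff_inv s)].

Definition fundamental_domain S (P : set 'cV[R]_n) : Prop :=
  [/\ measurable P,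
      \bigcup_(s in S) (aff_apply s @` P) = setT &
      forall s t, S s -> S t -> s <> t ->
        lebesgue_cV R n (aff_apply s @` P `&` aff_apply t @` P) = 0%E].

(* [S `<=` isolated S] is discreteness, for the topology of pairs (matrix,
   vector). *)
Definition crystal_group S : Prop :=
  [/\ isometry_subgroup S, S `<=` isolated S &
      exists2 P : set 'cV[R]_n, compact P & fundamental_domain S P].

Definition crystal_triple (Gamma : set affine) (G : set 'M[R]_n)
    (Lambda : set 'cV[R]_n) : Prop :=
  [/\ crystal_group Gamma,
      G = [set s.1 | s in Gamma] &
      Lambda = [set v | Gamma (aff_trans v)]].

(* The pair (g, k) acts by x |-> g (x + k). *)
Definition splitting (Gamma : set affine) (G : set 'M[R]_n)
    (Lambda : set 'cV[R]_n) : Prop :=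
  Gamma = [set ((g, g *m k) : affine) | g in G & k in Lambda].

Definition admissible (Gamma : set affine) (a : 'M[R]_n) : Prop :=
  (forall z : R[i],
     eigenvalue (map_mx (real_complex R) a) z -> 1 < `|z|) /\
  [set aff_comp (aff_comp (aff_lin a) s) (aff_inv (aff_lin a)) | s in Gamma]
    `<=` Gamma.

Definition digit_set (Lambda : set 'cV[R]_n) (a : 'M[R]_n) (m : nat)
    (d : 'I_m -> 'cV[R]_n) : Prop :=
  [/\ m%:R = `|\det a|, forall i, Lambda (d i) &
      forall l, Lambda l ->
        exists! i : 'I_m, exists2 k, Lambda k & l = d i + a *m k].

(* The last condition forces Q to be nonempty, hence to be the attractor of
   the digit set. *)
Definition has_tiling_digits (Lambda : set 'cV[R]_n) (a : 'M[R]_n) : Prop :=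
  exists m, exists d : 'I_m -> 'cV[R]_n, exists Q : set 'cV[R]_n,
  [/\ digit_set Lambda a d, compact Q,
      [set a *m x | x in Q] = \bigcup_i [set x + d i | x in Q] &
      \bigcup_(l in Lambda) [set x + l | x in Q] = setT].

End affine_maps.

(* Elements of L^2 are represented by square integrable functions; all the
   subspaces below are closed under almost everywhere equality. *)
Section L2.
Variables (R : realType) (n : nat).
Let mu := lebesgue_cV R n.
Implicit Types (f g : 'cV[R]_n -> R[i]) (E : set ('cV[R]_n -> R[i])).

Definition cmeasurable f : Prop :=
  measurable_fun setT (fun x => complex.Re (f x)) /\
  measurable_fun setT (fun x => complex.Im (f x)).

Definition cintegral f : R[i] :=
  Complex (Rintegral mu setT (fun x => complex.Re (f x)))
          (Rintegral mu setT (fun x => complex.Im (f x))).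

Definition L2norm f : \bar R :=
  Lnorm mu 2%:E (fun x => (Normc.normc (f x))%:E).

Definition L2 : set ('cV[R]_n -> R[i]) :=
  [set f | cmeasurable f /\ (L2norm f < +oo)%E].

Definition inner f g : R[i] := cintegral (fun x => f x * conjc (g x)).

Definition cspan E : set ('cV[R]_n -> R[i]) :=
  [set f | exists m (c : 'I_m -> R[i]) (e : 'I_m -> 'cV[R]_n -> R[i]),
    (forall i, E (e i)) /\ f = (fun x => \sum_(i < m) c i * e i x)].

Definition L2closure E : set ('cV[R]_n -> R[i]) :=
  [set f | L2 f /\ forall eps : R, 0 < eps ->
    exists2 g, E g & (L2norm (fun x => f x - g x)%R < eps%:E)%E].

Definition closed_span E := L2closure (cspan E).

Definition orthonormal_on (I : choiceType) (S : set I)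
    (e : I -> 'cV[R]_n -> R[i]) : Prop :=
  forall s t, S s -> S t -> inner (e s) (e t) = (s == t)%:R.

(* Every element of V is the unconditional sum of its Fourier series. *)
Definition orthonormal_basis (I : choiceType) (S : set I)
    (e : I -> 'cV[R]_n -> R[i]) (V : set ('cV[R]_n -> R[i])) : Prop :=
  [/\ forall s, S s -> V (e s), orthonormal_on S e &
      forall f, V f -> forall eps : R, 0 < eps ->
        exists2 T0 : {fset I}, [set` T0] `<=` S &
        forall T : {fset I}, [set` T0] `<=` [set` T] -> [set` T] `<=` S ->
          (L2norm (fun x => f x - \sum_(s <- T) inner f (e s) * e s x)%R
             < eps%:E)%E].

Definition compactly_supported f : Prop :=
  exists2 K : set 'cV[R]_n, compact K &
    {ae mu, forall x, ~ K x -> f x = 0}.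

Definition fourier f (w : 'cV[R]_n) : R[i] :=
  cintegral (fun x => f x * (Complex (cos (2 * pi * dotv x w))
                                     (- sin (2 * pi * dotv x w)))).

Definition dil (s : affine R n) f : 'cV[R]_n -> R[i] :=
  fun x => real_complex R (Num.sqrt `|\det s.1|)^-1
           * f (aff_apply (aff_inv s) x).

Definition V0 (Gamma : set (affine R n)) f : set ('cV[R]_n -> R[i]) :=
  closed_span [set dil s f | s in Gamma].

Definition refinable (Gamma : set (affine R n)) (a : 'M[R]_n) f : Prop :=
  exists (T : {fset affine R n}) (c : affine R n -> R[i]),
    [set` T] `<=` Gamma /\
    {ae mu, forall x, f x = \sum_(s <- T) c s * dil s f (a *m x)}.

End L2.

(* Positive dimension, so that square matrices form a ring and [a ^ j] makes
   sense for j : int. *)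
Definition Vj (R : realType) (n : nat) (Gamma : set (affine R n.+1))
    (a : 'M[R]_n.+1) (phi : 'cV[R]_n.+1 -> R[i]) (j : int) :
    set ('cV[R]_n.+1 -> R[i]) :=
  [set (fun x => f (a ^ j *m x)) | f in V0 Gamma phi].

(* Main.v *)
Require Import Defs.
From mathcomp Require Import all_boot all_order all_algebra.
From mathcomp Require Import fingroup perm finmap.
From mathcomp Require Import all_classical all_reals all_analysis.
From mathcomp Require Import measurable_realfun complex.
From mathcomp Require Import ring lra.

Set Implicit Arguments.
Unset Strict Implicit.
Unset Printing Implicit Defensive.

Import Order.TTheory GRing.Theory Num.Theory.
Import numFieldNormedType.Exports.

Local Open Scope classical_set_scope.
Local Open Scope ring_scope.

(** The proof takes place in the spatial domain; the Fourier transform enters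
    only through its value at 0, the integral of [phi].

    Everything is moved to scale 0: [f] lies in the [j]-th space if and only if
    [f (a^-j .)] lies in the closed span [V] of the translates of [phi], and
    dilation multiplies squared norms by a power of [|det a|].  Two facts make
    [V] manageable.  The translates are orthonormal, so partial Fourier sums
    are orthogonal projections ([orthonormal_basis_closed_span]).  And they are
    compactly supported around the points of a discrete set, so a function that
    vanishes far from the origin has only finitely many nonzero Fourier
    coefficients ([inner_far]); subtracting the corresponding finite sum leaves
    something orthogonal to [V] ([sub_proj_orthogonal]).

    Refinability.  If the spaces are nested then [phi (a^-1 .)] is a compactly
    supported element of [V], hence a finite sum of translates ([V_finite]).
    Conversely a refinement equation propagates to all translates because
    conjugation by [a] maps the group into itself ([V_pull_inv]).

    Intersection.  If [f] is in every space then, for a bounded [K], the function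
    [f (a^k .)] is in [V], and its restriction to [a^-k K], a set shrinking to
    the origin, only sees finitely many fixed translates of [phi].  By duality
    the norm of [f] on [K] is bounded by the norm of [f] times the mass of these
    translates on the shrinking set, and that mass tends to 0
    ([bigcap_V_cube]).

    Density.  Let [P] be a bounded fundamental domain of the group, and let [f]
    be Lipschitz with bounded support.  The function [h = f (a^-k .)] is almost
    constant on every tile [s P] and on the support of every translate of
    [phi].  So the Fourier coefficient of [h] at [s] is close to
    [h (s 0)] times the conjugate of the integral of [phi], and the integral of
    [|h|^2] over [s P] is close to [|h (s 0)|^2 |P|].  Summing over the tiles that
    meet the support of [h], whose number is at most a constant times
    [|det a|^k], shows that the squared distance from [f] to the [k]-th space
    tends to [1 - ratio] times the squared norm of [f], where [ratio] is
    [|phihat 0|^2 / |P|] ([fourier_energy], [test_projection]).  Such functions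
    are dense ([W_L2]), so [ratio = 1] gives density of the union
    ([ratio1_dense]); in a nested family, approximation at one scale persists at
    all later ones, which gives the converse ([nested_dense_ratio1]).  Finally
    the [r] tiles [g P], for [g] in the point group, form a fundamental domain
    of the lattice, so [|L| = r |P|] for every fundamental domain [L]
    ([lattice_domain_volume]), and [ratio = 1] is the condition on the Fourier
    transform at 0.

    The measure theory this needs on column vectors is the change of variables
    formula for linear maps ([scales_volume_unit]); the linear algebra is that
    the negative powers of a matrix with all eigenvalues outside the unit disk
    tend to 0 ([expanding_contraction]). *)

(** * Linear changes of variables *)

Section scaled_measure.
Context d (T : measurableType d) (R : realType).
Variables (mu : {measure set T -> \bar R}) (k : R) (h : T -> T).
Hypotheses (k0 : 0 <= k) (mh : measurable_fun [set: T] h).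
Hypothesis muh : forall S, measurable S -> mu S = (k%:E * mu (h @^-1` S))%E.

(** The hypothesis [muh] says that [mu] is [k] times its image under [h]; this
    is the form in which a change of variables is used. *)
Lemma eq_scaled_measure_integral (f : T -> \bar R) :
  (\int[mu]_x f x =
   \int[mscale (NngNum k0 : {nonneg R})
     (measure_function_pushforward__canonical__measure_function_Measure
        mu mh)]_x f x)%E.
Proof. by apply: eq_measure_integral => A mA _; rewrite muh. Qed.

Lemma ge0_integral_scaled (f : T -> \bar R) :
  measurable_fun [set: T] f -> (forall x, 0 <= f x)%E ->
  (\int[mu]_x f x = k%:E * \int[mu]_x f (h x))%E.
Proof.
move=> mf f0; rewrite eq_scaled_measure_integral ge0_integral_mscale//.
by rewrite ge0_integral_pushforward.
Qed.

End scaled_measure.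

Section linear_change.
Variable R : realType.

(** By uniqueness of Lebesgue measure it is enough to compare the lengths of
    half-open intervals. *)
Lemma lebesgue_measure_affine (c b : R) (A : set (measurableTypeR R)) :
  c != 0 -> measurable A ->
  lebesgue_measure A =
    (`|c|%:E * lebesgue_measure ((fun x : measurableTypeR R => (c * x + b)%R) @^-1` A))%E.
Proof.
move=> c0 mA.
have mT : measurable_fun [set: measurableTypeR R]
    (fun x : measurableTypeR R => c * x + b : measurableTypeR R)%R.
  apply: measurable_funD => //; exact: measurable_funM.
pose nu := mscale (NngNum (normr_ge0 c) : {nonneg R})
  (measure_function_pushforward__canonical__measure_function_Measure
     lebesgue_measure mT).
rewrite (_ : (_ * _)%E = nu A)//.
apply: lebesgue_measure_unique mA => //= _ [[u v]] _ <-.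
rewrite /nu /mscale /pushforward /=.
have [c1|c1|c1] := ltgtP c 0%R; last by rewrite c1 eqxx in c0.
- rewrite [X in _ = (_ * lebesgue_measure X)%E](_ : _ = `[(v - b) / c, (u - b) / c[%classic).
    rewrite !lebesgue_measure_itv /= !lte_fin.
    rewrite ltr_nM2r ?invr_lt0// ltrD2r.
    case: ifPn => uv; last by rewrite mule0.
    rewrite -EFinD -EFinB -EFinM ltr0_norm//.
    by congr EFin; field.
  apply/seteqP; split => x /=; rewrite !in_itv /=.
    by rewrite ltr_ndivlMr// ler_ndivrMr// lerBrDr ltrBlDr mulrC => /andP[-> ->].
  by rewrite ltr_ndivlMr// ler_ndivrMr// lerBrDr ltrBlDr mulrC => /andP[-> ->].
- rewrite [X in _ = (_ * lebesgue_measure X)%E](_ : _ = `](u - b) / c, (v - b) / c]%classic).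
    rewrite !lebesgue_measure_itv /= !lte_fin.
    rewrite ltr_pM2r ?invr_gt0// ltrD2r.
    case: ifPn => uv; last by rewrite mule0.
    rewrite -EFinD -EFinB -EFinM gtr0_norm//.
    by congr EFin; field.
  apply/seteqP; split => x /=; rewrite !in_itv /=.
    by rewrite ltr_pdivrMr// ler_pdivlMr// lerBrDr ltrBlDr mulrC => /andP[-> ->].
  by rewrite ltr_pdivrMr// ler_pdivlMr// lerBrDr ltrBlDr mulrC => /andP[-> ->].
Qed.

Lemma measurable_mulmxD m n (A : 'M[R]_(m, n)) (b : 'cV[R]_m) :
  measurable_fun [set: 'cV[R]_n] (fun v => A *m v + b).
Proof.
apply: measurable_fun_coord => i.
rewrite (_ : (fun _ => _) =
    (fun v : 'cV[R]_n => \sum_j A i j * v j ord0 + b i ord0)).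
  apply: measurable_funD => //; apply: measurable_sum => j.
  by apply: measurable_funM => //; exact: measurable_coord.
by apply/funext => v; rewrite !mxE.
Qed.

(** The translation is part of the definition because the induction on
    triangular matrices produces one in every section. *)
Definition scales_volume n (A : 'M[R]_n) := forall (b : 'cV[R]_n) S,
  measurable S ->
  lebesgue_cV R n S =
  (`|\det A|%:E * lebesgue_cV R n ((fun v => (A *m v + b)%R) @^-1` S))%E.

Lemma scales_volumeM n (A B : 'M[R]_n) :
  scales_volume A -> scales_volume B -> scales_volume (A *m B).
Proof.
move=> hA hB b S mS; rewrite (hA b)// (hB 0)//; last first.
  by rewrite -[X in measurable X]setTI; exact: measurable_mulmxD.
rewrite det_mulmx normrM EFinM muleA; congr (_ * lebesgue_cV R n _)%E.
by apply/seteqP; split => v /=; rewrite addr0 mulmxA.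
Qed.

Lemma lebesgue_cVS n (S : set 'cV[R]_n.+1) :
  lebesgue_cV R n.+1 S = (\int[@lebesgue_measure R]_x
    lebesgue_cV R n [set v : 'cV[R]_n | S (col_mx x%:M v)])%E.
Proof.
rewrite /= /lebesgue_step /pushforward /product_measure1.
by apply: eq_integral => x _ /=; rewrite /xsection /=; congr (lebesgue_cV R n _);
  apply/seteqP; split => v /=; rewrite in_setE.
Qed.

(** Fubini: over a fixed first coordinate a lower triangular map acts by a
    smaller lower triangular map, followed by a translation. *)
Lemma scales_volume_trig n (A : 'M[R]_n) :
  is_trig_mx A -> \det A != 0 -> scales_volume A.
Proof.
elim: n A => [A _ _ b S mS|n IH A tA dA b S mS].
  rewrite det_mx00 normr1 mul1e; rewrite [X in _ = lebesgue_cV R 0 X](_ : _ = S)//.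
  by apply/funext => v; rewrite /preimage /=; congr (S _); rewrite [LHS]flatmx0 [RHS]flatmx0.
pose A' := drsubmx (A : 'M[R]_(1 + n)); pose w := dlsubmx (A : 'M[R]_(1 + n)).
pose c := A ord0 ord0.
have AE : A = block_mx c%:M 0 w A' :> 'M[R]_(1 + n).
  rewrite -[LHS](submxK (A : 'M[R]_(1 + n))); congr block_mx.
    apply/matrixP => i j; rewrite !ord1 !mxE eqxx mulr1n.
    by rewrite (_ : lshift n 0 = ord0)//; exact: val_inj.
  apply/matrixP => i j; rewrite !ord1 !mxE.
  by apply: (elimT is_trig_mxP tA).
have tA' : is_trig_mx A'.
  apply/is_trig_mxP => i j ij; rewrite !mxE.
  by apply: (elimT is_trig_mxP tA).
have dAE : \det A = c * \det A'.
  by rewrite [in LHS]AE (@det_lblock _ 1) det_scalar1.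
have [c0 dA'] : c != 0 /\ \det A' != 0.
  by apply/andP; rewrite -negb_or -mulf_eq0 -dAE.
pose Sx x := [set v : 'cV[R]_n | S (col_mx x%:M v)].
pose F (x : measurableTypeR R) := lebesgue_cV R n (Sx x).
have mpre (U : set 'cV[R]_n.+1) : measurable U -> measurable
    ((fun p : R * 'cV[R]_n => col_mx (p.1)%:M p.2 : 'cV[R]_n.+1) @^-1` U).
  by move=> mU; rewrite -[X in measurable X]setTI; exact: measurable_cV_cons.
have xsE (U : set 'cV[R]_n.+1) x : xsection
    ((fun p : R * 'cV[R]_n => col_mx (p.1)%:M p.2 : 'cV[R]_n.+1) @^-1` U) x =
    [set v : 'cV[R]_n | U (col_mx x%:M v)].
  by apply/seteqP; split => v; rewrite /xsection /= in_setE.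
have mSx (U : set 'cV[R]_n.+1) x : measurable U ->
    measurable [set v : 'cV[R]_n | U (col_mx x%:M v)].
  by move=> mU; rewrite -xsE; apply: measurable_xsection; exact: mpre.
have mF (U : set 'cV[R]_n.+1) : measurable U ->
    measurable_fun [set: measurableTypeR R]
      (fun x => lebesgue_cV R n [set v : 'cV[R]_n | U (col_mx x%:M v)]).
  move=> mU; under eq_fun do rewrite -xsE.
  by apply: measurable_fun_xsection; exact: mpre.
pose TS := (fun v => A *m v + b) @^-1` S.
have mTS : measurable TS.
  by rewrite -[X in measurable X]setTI; exact: measurable_mulmxD.
have sec x : F (c * x + b ord0 ord0) =
    (`|\det A'|%:E * lebesgue_cV R n [set v : 'cV[R]_n | TS (col_mx x%:M v)])%E.
  rewrite /F (IH A' tA' dA' (w *m x%:M + dsubmx (b : 'cV[R]_(1 + n))))//; last first.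
    exact: mSx.
  congr (_ * lebesgue_cV R n _)%E; apply/seteqP.
  suff E (v : 'cV[R]_n) : col_mx (c * x + b ord0 ord0)%:M
      (A' *m v + (w *m x%:M + dsubmx (b : 'cV[R]_(1 + n)))) =
      A *m col_mx x%:M v + b.
    by split => v; rewrite /Sx /TS /= E.
  transitivity (@block_mx _ 1 n 1 n c%:M 0 w A' *m col_mx x%:M v +
      col_mx (usubmx (b : 'cV[R]_(1 + n))) (dsubmx (b : 'cV[R]_(1 + n)))).
    rewrite (@mul_block_col _ 1) mul0mx addr0 add_col_mx -scalar_mxM.
    congr col_mx; last by rewrite addrCA addrA.
    apply/matrixP => i j; rewrite !ord1 !mxE eqxx !mulr1n.
    by congr (_ + b _ _); exact: val_inj.
  by rewrite vsubmxK -AE.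
rewrite !lebesgue_cVS.
have mc : measurable_fun [set: measurableTypeR R]
    (fun x : measurableTypeR R => c * x + b ord0 ord0 : measurableTypeR R).
  by apply: measurable_funD => //; exact: measurable_funM.
rewrite (ge0_integral_scaled (normr_ge0 c) mc)//; last 2 first.
- by move=> U mU; exact: lebesgue_measure_affine.
- exact: mF.
rewrite dAE normrM EFinM -muleA; congr (_ * _)%E.
rewrite -ge0_integralZl//; last exact: mF.
by apply: eq_integral => x _; exact: sec.
Qed.

End linear_change.

Section rectangles.
Variables (R : realType) (n : nat).

Definition rectangle (A : 'I_n -> set R) : set 'cV[R]_n :=
  [set v | forall i, A i (v i ord0)].

Definition rectangles (H : set (set R)) : set (set 'cV[R]_n) :=
  [set S | exists2 A, (forall i, H (A i)) & S = rectangle A].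

Lemma measurable_rectangle (A : 'I_n -> set R) :
  (forall i, measurable (A i : set (measurableTypeR R))) ->
  measurable (rectangle A).
Proof.
move=> mA; rewrite (_ : rectangle A = \bigcap_(i in [set: 'I_n])
    ((fun v : 'cV[R]_n => v i ord0) @^-1` A i)).
  apply: fin_bigcap_measurable; first exact: finite_finset.
  by move=> i _; rewrite -[X in measurable X]setTI; apply: measurable_coord => //; exact: mA.
by apply/seteqP; split => v /= Av i; [move=> _|]; exact: Av.
Qed.

Lemma rectangles_setI H : setI_closed H -> setI_closed (rectangles H).
Proof.
move=> HI _ _ [A HA ->] [B HB ->]; exists (fun i => A i `&` B i).
  by move=> i; exact: HI.
by apply/seteqP; split => v /=; [move=> [? ?] i; split|
  move=> AB; split => i; case: (AB i)].
Qed.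

(** A cylinder over a generator is the increasing union of rectangles
    whose other sides exhaust the line. *)
Lemma measurable_rectangles (H : set (set R)) (h : nat -> set R) :
  (@measurable _ (measurableTypeR R) = <<s H >>) ->
  (forall k, H (h k)) -> {homo h : k l / (k <= l)%N >-> k `<=` l} ->
  \bigcup_k h k = setT ->
  @measurable _ 'cV[R]_n = <<s rectangles H >>.
Proof.
move=> mH Hh hnd hT; apply/seteqP; split; last first.
  apply: smallest_sub; first exact: sigma_algebra_measurable.
  move=> _ [A HA ->]; apply: measurable_rectangle => i.
  by rewrite mH; exact: sub_sigma_algebra.
apply: smallest_sub; first exact: smallest_sigma_algebra.
move=> S; rewrite -bigcup_seq/= => -[i _ [B mB <-]].
rewrite setTI => {S}; have {}mB : <<s H >> B by rewrite -mH; exact: mB.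
have sa : sigma_algebra setT (image_set_system setT
    (fun v : 'cV[R]_n => v i ord0) <<s rectangles H >>).
  by apply: sigma_algebra_image; exact: smallest_sigma_algebra.
suff : image_set_system setT
    (fun v : 'cV[R]_n => v i ord0) <<s rectangles H >> B.
  by rewrite /image_set_system /= setTI.
apply: (smallest_sub sa) mB => {}B HB; rewrite /image_set_system /= setTI.
rewrite (_ : _ @^-1` _ = \bigcup_k rectangle
    (fun j => if j == i then B else h k)); last first.
  apply/seteqP; split => v /=; last first.
    by move=> [k _] /(_ i); rewrite eqxx.
  move=> Bv.
  have hv j : exists k, [set k | h k (v j ord0)] k.
    have : (\bigcup_k h k) (v j ord0) by rewrite hT.
    by case=> k _; exists k.
  exists (\max_j xget 0%N [set k | h k (v j ord0)]) => // j /=.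
  case: eqP => [->//|_]; have := xgetPex 0%N (hv j).
  have le_j := @leq_bigmax _ (fun j => xget 0%N [set k | h k (v j ord0)]) j.
  exact: hnd le_j _.
apply: sigma_algebra_bigcup => k; apply: sub_sigma_algebra.
by exists (fun j => if j == i then B else h k) => // j; case: ifP.
Qed.

(** Rectangles are stable under intersection and the cubes among them, of
    finite measure, exhaust the space. *)
Lemma lebesgue_cV_unique (m : {measure set 'cV[R]_n -> \bar R}) :
  (forall A : 'I_n -> set R,
    (forall i, measurable (A i : set (measurableTypeR R))) ->
    m (rectangle A) = (\prod_(i < n) @lebesgue_measure R (A i))%E) ->
  forall S, measurable S -> lebesgue_cV R n S = m S.
Proof.
move=> mE S mS.
pose g k : set R := `[- k%:R, k%:R]%classic.
pose H := @measurable _ (measurableTypeR R).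
have cover : \bigcup_k rectangle (fun=> g k) = setT.
  apply/seteqP; split => v // _.
  exists (\max_j Num.bound `|v j ord0|) => // j; rewrite /g /= in_itv/= -ler_norml.
  apply: le_trans (ltW (archi_boundP (normr_ge0 _))) _.
  by rewrite ler_nat leq_bigmax.
apply: (measure_unique (rectangles H) (fun k => rectangle (fun=> g k))) => //.
- apply: (@measurable_rectangles _ (fun=> setT)) => //.
  + by rewrite sigma_algebra_id//; exact: sigma_algebra_measurable.
  + by move=> k; exact: measurableT.
  + by rewrite bigcup_const//; exists 0%N.
- by apply: rectangles_setI => A B; exact: measurableI.
- by move=> k; exists (fun=> g k) => // i; exact: measurable_itv.
- move=> _ [A HA ->]; rewrite mE//; exact: lebesgue_cV_box.
- move=> k; rewrite [X in (X < _)%E]lebesgue_cV_box; last first.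
    by move=> i; exact: measurable_itv.
  rewrite (_ : \prod_(i < n) _ = (\prod_(i < n) (k%:R - - k%:R))%:E)%E ?ltry//.
  rewrite -prodEFin; apply: eq_bigr => i _.
  rewrite /g lebesgue_measure_itv/= lte_fin.
  case: ltP => // kk; have -> : k = 0%N; last by rewrite oppr0 subrr.
  case: k kk => // k kk; exfalso; have : 0 < k.+1%:R :> R by [].
  lra.
Qed.

End rectangles.

Section linear_change_general.
Variable R : realType.

(** A permutation of the coordinates permutes the sides of a rectangle. *)
Lemma scales_volume_perm n (s : 'S_n) : scales_volume (perm_mx s : 'M[R]_n).
Proof.
suff hs : forall S, measurable S -> lebesgue_cV R n S =
    lebesgue_cV R n ((fun v => perm_mx s *m v + 0) @^-1` S).
  move=> b S mS; rewrite det_perm normrX normrN1 expr1n mul1e.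
  rewrite (@scales_volume_trig _ _ 1%:M _ _ b)// ?scalar_mx_is_trig// ?det1 ?oner_eq0//.
  rewrite normr1 mul1e hs; last first.
    by rewrite -[X in measurable X]setTI; exact: measurable_mulmxD.
  by congr (lebesgue_cV R n _); apply/seteqP; split => v /=; rewrite addr0 mul1mx.
have mp : measurable_fun [set: 'cV[R]_n] (fun v => perm_mx s *m v + 0).
  exact: measurable_mulmxD.
move=> S mS.
apply: (@lebesgue_cV_unique _ _
  (measure_function_pushforward__canonical__measure_function_Measure
     (lebesgue_cV R n) mp)) mS => A mA.
rewrite /= /pushforward (_ : _ @^-1` _ = rectangle (fun i => A (s^-1%g i))).
  rewrite lebesgue_cV_box//; last by move=> i; exact: mA.
  by rewrite (reindex_inj (@perm_inj _ s)); apply: eq_bigr => i _; rewrite permK.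
apply/seteqP; split => v /= Av i.
  by have := Av (s^-1%g i); rewrite -row_permE addr0 mxE permKV.
by have := Av (s i); rewrite -row_permE addr0 mxE permK.
Qed.

(** Every invertible matrix is a product of triangular and permutation
    matrices (LUP decomposition). *)
Theorem scales_volume_unit n (A : 'M[R]_n.+1) :
  \det A != 0 -> scales_volume A.
Proof.
move=> dA.
have := cormen_lup_correct A; have := cormen_lup_perm A.
have := cormen_lup_detL A; have := @cormen_lup_lower _ n A.
have := @cormen_lup_upper _ n A.
case: (cormen_lup A) => -[P L] U /= uU lL dL /is_perm_mxP[s ->] PA.
have sK : perm_mx s^-1 *m perm_mx s = 1%:M :> 'M[R]_n.+1.
  by rewrite -perm_mxM mulVg perm_mx1.
have {PA} AE : A = perm_mx s^-1 *m (L *m U).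
  by rewrite -[L *m U]PA mulmxA sK mul1mx.
have dU : \det U != 0.
  by apply: contra_neq dA => dU; rewrite AE !det_mulmx dU !mulr0.
rewrite AE; apply: scales_volumeM; first exact: scales_volume_perm.
apply: scales_volumeM.
  apply: scales_volume_trig; last by rewrite dL oner_eq0.
  apply/is_trig_mxP => i j ij; rewrite lL ?(ltnW ij)// -val_eqE/=.
  by rewrite ltn_eqF.
(* conjugation by the reversal of the coordinates exchanges upper and lower
   triangular matrices *)
pose t : 'S_n.+1 := perm (@rev_ord_inj n.+1).
have tt : perm_mx t *m perm_mx t = 1%:M :> 'M[R]_n.+1.
  rewrite -perm_mxM -perm_mx1; congr perm_mx; apply/permP => i.
  by rewrite permM !permE rev_ordK.
pose U' := perm_mx t *m U *m perm_mx t.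
have -> : U = perm_mx t *m U' *m perm_mx t.
  by rewrite /U' !mulmxA tt mul1mx -mulmxA tt mulmx1.
have dt : \det (perm_mx t) != 0 :> R by rewrite det_perm signr_eq0.
apply: scales_volumeM; last exact: scales_volume_perm.
apply: scales_volumeM; first exact: scales_volume_perm.
apply: scales_volume_trig; last by rewrite !det_mulmx !mulf_neq0.
apply/is_trig_mxP => i j ij.
have tV : t = (t^-1)%g.
  apply/permP => k; apply: (@perm_inj _ t); rewrite permKV !permE.
  exact: rev_ordK.
rewrite /U' -row_permE {2}tV -col_permE !mxE !permE; apply: uU => /=.
by apply: ltn_sub2l => //; rewrite ltnS (leq_trans ij)// leq_ord.
Qed.

End linear_change_general.

(** * Complex-valued integrals *)

Arguments Normc.normc : simpl never.
Arguments inner : simpl never.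
Arguments cintegral : simpl never.

Section complex_integral.
Variables (R : realType) (n : nat).
Let mu := lebesgue_cV R n.
Local Notation T := 'cV[R]_n.
Implicit Types (f g : T -> R[i]) (c : R[i]).
Local Notation Re := complex.Re.
Local Notation Im := complex.Im.
Local Notation normc := (@Normc.normc R).

Lemma sqr_normcE (z : R[i]) : normc z ^+ 2 = Re z ^+ 2 + Im z ^+ 2.
Proof. by case: z => a b /=; rewrite sqr_sqrtr// addr_ge0// sqr_ge0. Qed.

Lemma normc_ge0 (z : R[i]) : 0 <= normc z.
Proof. by case: z => a b /=; exact: sqrtr_ge0. Qed.

Lemma normcJ (z : R[i]) : normc (conjc z) = normc z.
Proof. by case: z => a b; rewrite /Normc.normc /= sqrrN. Qed.

Lemma le_Re_normc (z : R[i]) : `|Re z| <= normc z.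
Proof.
rewrite -(@ler_pXn2r _ 2)// ?nnegrE ?normc_ge0// real_normK ?num_real//.
by rewrite sqr_normcE lerDl sqr_ge0.
Qed.

Lemma le_Im_normc (z : R[i]) : `|Im z| <= normc z.
Proof.
rewrite -(@ler_pXn2r _ 2)// ?nnegrE ?normc_ge0// real_normK ?num_real//.
by rewrite sqr_normcE lerDr sqr_ge0.
Qed.

Lemma Re_mulc (z w : R[i]) : Re (z * w) = Re z * Re w - Im z * Im w.
Proof. by case: z; case: w. Qed.

Lemma Im_mulc (z w : R[i]) : Im (z * w) = Re z * Im w + Im z * Re w.
Proof. by case: z; case: w. Qed.

Lemma complex_eq (z w : R[i]) : Re z = Re w -> Im z = Im w -> z = w.
Proof. by case: z => a b; case: w => c d /= -> ->. Qed.

Lemma Re_conjc (z : R[i]) : Re (conjc z) = Re z. Proof. by case: z. Qed.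

Lemma Im_conjc (z : R[i]) : Im (conjc z) = - Im z. Proof. by case: z. Qed.

Lemma cmeasurableD f g : cmeasurable f -> cmeasurable g ->
  cmeasurable (fun x => f x + g x).
Proof.
move=> [f1 f2] [g1 g2]; split.
  by under eq_fun do rewrite raddfD; exact: measurable_funD.
by under eq_fun do rewrite raddfD; exact: measurable_funD.
Qed.

Lemma cmeasurableM f g : cmeasurable f -> cmeasurable g ->
  cmeasurable (fun x => f x * g x).
Proof.
move=> [f1 f2] [g1 g2]; split.
  by under eq_fun do rewrite Re_mulc; apply: measurable_funB; exact: measurable_funM.
by under eq_fun do rewrite Im_mulc; apply: measurable_funD; exact: measurable_funM.
Qed.

Lemma cmeasurable_cst c : cmeasurable (fun _ : T => c).
Proof. by split; exact: measurable_cst. Qed.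

Lemma cmeasurableJ f : cmeasurable f -> cmeasurable (fun x => conjc (f x)).
Proof.
move=> [f1 f2]; split; first by under eq_fun do rewrite Re_conjc.
by under eq_fun do rewrite Im_conjc; exact: measurable_funN.
Qed.

Lemma cmeasurable_comp (h : T -> T) f :
  measurable_fun setT h -> cmeasurable f -> cmeasurable (fun x => f (h x)).
Proof.
by move=> mh [f1 f2]; split; [exact: measurableT_comp f1 mh|
  exact: measurableT_comp f2 mh].
Qed.

Lemma cmeasurable_normc2 f : cmeasurable f ->
  measurable_fun setT (fun x => normc (f x) ^+ 2).
Proof.
move=> [f1 f2]; under eq_fun do rewrite sqr_normcE.
by apply: measurable_funD; apply: measurable_funX.
Qed.

Lemma cmeasurable_normc f : cmeasurable f ->
  measurable_fun setT (fun x => normc (f x)).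
Proof.
move=> mf; rewrite (_ : (fun _ => _) =
    (@Num.sqrt R) \o (fun x => normc (f x) ^+ 2)); last first.
  by apply/funext => x /=; rewrite sqrtr_sqr ger0_norm// normc_ge0.
apply: measurableT_comp (cmeasurable_normc2 mf).
by apply: continuous_measurable_fun; exact: sqrt_continuous.
Qed.

Definition cintegrable f :=
  cmeasurable f /\ mu.-integrable setT (fun x => (normc (f x))%:E).

Lemma cintegrable_le f (g : T -> R) : cmeasurable f ->
  mu.-integrable setT (EFin \o g) -> (forall x, normc (f x) <= g x) ->
  cintegrable f.
Proof.
move=> mf ig fg; split=> //.
apply: le_integrable ig => //; first by apply/measurable_EFinP; exact: cmeasurable_normc.
move=> x _ /=; rewrite lee_fin ger0_norm ?normc_ge0//.
by rewrite (le_trans (fg x))// ler_norm.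
Qed.

Lemma cintegrableRe f : cintegrable f -> mu.-integrable setT (fun x => (Re (f x))%:E).
Proof.
move=> [mf i]; apply: le_integrable i => //; first by apply/measurable_EFinP; exact: mf.1.
by move=> x _; rewrite /= lee_fin [leRHS]ger0_norm ?normc_ge0// le_Re_normc.
Qed.

Lemma cintegrableIm f : cintegrable f -> mu.-integrable setT (fun x => (Im (f x))%:E).
Proof.
move=> [mf i]; apply: le_integrable i => //; first by apply/measurable_EFinP; exact: mf.2.
by move=> x _; rewrite /= lee_fin [leRHS]ger0_norm ?normc_ge0// le_Im_normc.
Qed.

Lemma cintegrableD f g : cintegrable f -> cintegrable g ->
  cintegrable (fun x => f x + g x).
Proof.
move=> [mf fi] [mg gi].
apply: (@cintegrable_le _ (fun x => normc (f x) + normc (g x))).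
- exact: cmeasurableD.
- by rewrite /comp; under eq_fun do rewrite EFinD; exact: (integrableD measurableT fi gi).
- by move=> x; exact: le_normcD.
Qed.

Lemma cintegrableZ c f : cintegrable f -> cintegrable (fun x => c * f x).
Proof.
move=> [mf fi]; apply: (@cintegrable_le _ (fun x => normc c * normc (f x))).
- by apply: cmeasurableM => //; exact: cmeasurable_cst.
- by rewrite /comp; under eq_fun do rewrite EFinM; exact: (integrableZl measurableT _ fi).
- by move=> x; rewrite Normc.normcM.
Qed.

Lemma cintegrableJ f : cintegrable f -> cintegrable (fun x => conjc (f x)).
Proof.
move=> [mf fi]; split; first exact: cmeasurableJ.
by under eq_fun do rewrite normcJ.
Qed.

Lemma cintegralD f g : cintegrable f -> cintegrable g ->
  cintegral (fun x => f x + g x) = cintegral f + cintegral g.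
Proof.
move=> fi gi; rewrite /cintegral; apply: complex_eq => /=.
  under eq_Rintegral do rewrite raddfD.
  by rewrite RintegralD//; exact: cintegrableRe.
under eq_Rintegral do rewrite raddfD.
by rewrite RintegralD//; exact: cintegrableIm.
Qed.

Lemma cintegralZ c f : cintegrable f ->
  cintegral (fun x => c * f x) = c * cintegral f.
Proof.
move=> fi; have iR := cintegrableRe fi; have iI := cintegrableIm fi.
have Z (r : R) (h : T -> R) : mu.-integrable setT (fun x => (h x)%:E) ->
    mu.-integrable setT (fun x => (r * h x)%:E).
  by move=> hi; under eq_fun do rewrite EFinM; exact: (integrableZl measurableT r hi).
rewrite /cintegral; apply: complex_eq; rewrite ?Re_mulc ?Im_mulc /=.
  under eq_Rintegral do rewrite Re_mulc.
  by rewrite RintegralB ?RintegralZl//; exact: Z.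
under eq_Rintegral do rewrite Im_mulc.
by rewrite RintegralD ?RintegralZl//; exact: Z.
Qed.

Lemma cintegralJ f : cintegrable f ->
  cintegral (fun x => conjc (f x)) = conjc (cintegral f).
Proof.
move=> fi; rewrite /cintegral; apply: complex_eq; rewrite ?Re_conjc ?Im_conjc /=.
  by under eq_Rintegral do rewrite Re_conjc.
under eq_Rintegral do rewrite Im_conjc -mulN1r.
by rewrite RintegralZl ?mulN1r//; exact: cintegrableIm.
Qed.

Lemma cintegral0 : cintegral (fun _ : T => 0 : R[i]) = 0.
Proof.
rewrite /cintegral /=; apply: complex_eq => /=; rewrite /Rintegral/=;
  by under eq_integral do rewrite /=; rewrite integral0.
Qed.

(** Rotating the integral onto the positive real axis reduces the complex
    triangle inequality to the real one. *)
Lemma le_normc_cintegral f : cintegrable f ->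
  normc (cintegral f) <= \int[mu]_x normc (f x).
Proof.
move=> fi; set z := cintegral f.
have [z0|z0] := eqVneq (normc z) 0.
  by rewrite z0; apply: Rintegral_ge0 => x _; exact: normc_ge0.
have zE : Re (conjc z * z) = normc z ^+ 2 by rewrite Re_mulc sqr_normcE Re_conjc Im_conjc; ring.
have zp : 0 < normc z by rewrite lt_neqAle eq_sym z0 normc_ge0.
rewrite -(ler_pM2l zp) -expr2 -zE -cintegralZ//.
have fiz := cintegrableZ (conjc z) fi.
rewrite -RintegralZl//; last exact: fi.2.
apply: le_Rintegral => //; first exact: cintegrableRe.
  rewrite /comp; under eq_fun do rewrite EFinM.
  exact: (integrableZl measurableT _ fi.2).
move=> x _; apply: le_trans (ler_norm _) _; apply: le_trans (le_Re_normc _) _.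
by rewrite Normc.normcM normcJ.
Qed.

End complex_integral.

(** * Square-integrable functions *)

Section square_integrable.
Variables (R : realType) (n : nat).
Let mu := lebesgue_cV R n.
Local Notation T := 'cV[R]_n.
Implicit Types (f g h : T -> R[i]) (c : R[i]).
Local Notation Re := complex.Re.
Local Notation Im := complex.Im.
Local Notation normc := (@Normc.normc R).

(** Real squared norms keep square roots and infinite values out of the
    Hilbert space algebra. *)
Definition sqnorm f : R := \int[mu]_x normc (f x) ^+ 2.

Lemma sqnorm_ge0 f : 0 <= sqnorm f.
Proof. by apply: Rintegral_ge0 => x _; exact: sqr_ge0. Qed.

Lemma L2normE f :
  L2norm f = sqrte (\int[mu]_x (normc (f x) ^+ 2)%:E)%E.
Proof.
rewrite /L2norm Lnorm.unlock -poweR12_sqrt; last first.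
  by apply: integral_ge0 => x _; rewrite lee_fin sqr_ge0.
congr (_ `^ _)%E; apply: eq_integral => x _.
rewrite poweR_EFin powR_mulrn; last exact: normr_ge0.
by rewrite real_normK ?num_real.
Qed.

Lemma L2P f : L2 f <->
  cmeasurable f /\ mu.-integrable setT (fun x => (normc (f x) ^+ 2)%:E).
Proof.
have E : (\int[mu]_x `|(normc (f x) ^+ 2)%:E| =
    \int[mu]_x (normc (f x) ^+ 2)%:E)%E.
  by apply: eq_integral => x _; rewrite gee0_abs// lee_fin sqr_ge0.
split=> -[mf fi]; split=> //.
  apply/integrableP; split.
    by apply/measurable_EFinP; exact: cmeasurable_normc2.
  rewrite E; move: fi; rewrite L2normE.
  by case: (\int[mu]_x _)%E => [r||] //= _; rewrite ltry.
rewrite L2normE; move/integrableP : fi => [_]; rewrite E.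
by case: (\int[mu]_x _)%E => [r||] //= _; rewrite ltry.
Qed.

Lemma L2_cmeasurable f : L2 f -> cmeasurable f. Proof. by case. Qed.

Lemma L2_sqnormE f : L2 f ->
  (\int[mu]_x (normc (f x) ^+ 2)%:E = (sqnorm f)%:E)%E.
Proof. by move=> /L2P[_ fi]; rewrite fineK//; exact: integrable_fin_num. Qed.

Lemma L2norm_lt f (eps : R) : L2 f -> 0 < eps ->
  (L2norm f < eps%:E)%E = (sqnorm f < eps ^+ 2).
Proof.
move=> f2 e0; rewrite L2normE L2_sqnormE//= lte_fin.
have {1}-> : eps = Num.sqrt (eps ^+ 2) by rewrite sqrtr_sqr gtr0_norm.
by rewrite ltr_sqrt// exprn_gt0.
Qed.

Lemma L2_le f (g : T -> R) : cmeasurable f ->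
  mu.-integrable setT (EFin \o g) -> (forall x, normc (f x) ^+ 2 <= g x) ->
  L2 f.
Proof.
move=> mf ig fg; apply/L2P; split=> //.
apply: le_integrable ig => //.
  by apply/measurable_EFinP; exact: cmeasurable_normc2.
move=> x _ /=; rewrite lee_fin ger0_norm ?sqr_ge0//.
by rewrite (le_trans (fg x))// ler_norm.
Qed.

Lemma sqr_normcD_le (z w : R[i]) :
  normc (z + w) ^+ 2 <= 2 * normc z ^+ 2 + 2 * normc w ^+ 2.
Proof.
rewrite !sqr_normcE; case: z => a b; case: w => c d /=; rewrite -subr_ge0.
rewrite (_ : _ - _ = (a - c) ^+ 2 + (b - d) ^+ 2); last by ring.
by rewrite addr_ge0// sqr_ge0.
Qed.

Lemma L2D f g : L2 f -> L2 g -> L2 (f + g).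
Proof.
move=> /L2P[mf fi] /L2P[mg gi].
apply: (@L2_le _ (fun x => 2 * normc (f x) ^+ 2 + 2 * normc (g x) ^+ 2)).
- exact: cmeasurableD.
- rewrite /comp; under eq_fun do rewrite EFinD !EFinM.
  by apply: integrableD => //; exact: integrableZl.
- by move=> x; exact: sqr_normcD_le.
Qed.

Lemma L2Z c f : L2 f -> L2 (cst c * f).
Proof.
move=> /L2P[mf fi].
apply: (@L2_le _ (fun x => normc c ^+ 2 * normc (f x) ^+ 2)).
- by apply: cmeasurableM => //; exact: cmeasurable_cst.
- by rewrite /comp; under eq_fun do rewrite EFinM; exact: integrableZl.
- by move=> x; rewrite Normc.normcM exprMn.
Qed.

Lemma cstN1E f : cst (-1) * f = - f.
Proof. by apply/funext => x; exact: mulN1r. Qed.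

Lemma L2N f : L2 f -> L2 (- f).
Proof. by rewrite -cstN1E; exact: L2Z. Qed.

Lemma L2B f g : L2 f -> L2 g -> L2 (f - g).
Proof. by move=> f2 g2; apply: L2D => //; exact: L2N. Qed.

Lemma L2_0 : L2 (0 : T -> R[i]).
Proof.
apply/L2P; split; first exact: (@cmeasurable_cst R n 0).
rewrite (_ : (fun _ => _) = cst 0%E); first exact: integrable0.
by apply/funext => x; rewrite [X in normc X](_ : _ = 0)// Normc.normc0 expr0n.
Qed.

Lemma L2_comb (I : choiceType) (s : seq I) (c : I -> R[i]) (F : I -> T -> R[i]) :
  {in s, forall i, L2 (F i)} -> L2 (\sum_(i <- s) cst (c i) * F i).
Proof.
move=> F2; rewrite big_seq; elim/big_rec: _ => [|i f si f2]; first exact: L2_0.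
by apply: L2D => //; apply: L2Z; exact: F2.
Qed.

Lemma cintegrable_inner f g : L2 f -> L2 g ->
  cintegrable (fun x => f x * conjc (g x)).
Proof.
move=> /L2P[mf fi] /L2P[mg gi].
apply: (@cintegrable_le _ _ _ (fun x => normc (f x) ^+ 2 + normc (g x) ^+ 2)).
- by apply: cmeasurableM => //; exact: cmeasurableJ.
- by rewrite /comp; under eq_fun do rewrite EFinD; exact: integrableD.
- move=> x; rewrite Normc.normcM normcJ.
  rewrite -subr_ge0; have := sqr_ge0 (normc (f x) - normc (g x)).
  have := mulr_ge0 (normc_ge0 (f x)) (normc_ge0 (g x)); nra.
Qed.

Lemma innerDl f g h : L2 f -> L2 g -> L2 h ->
  inner (f + g) h = inner f h + inner g h.
Proof.
move=> f2 g2 h2; rewrite /inner -cintegralD; [|exact: cintegrable_inner..].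
by congr cintegral; apply/funext => x; rewrite -mulrDl.
Qed.

Lemma innerZl c f h : L2 f -> L2 h -> inner (cst c * f) h = c * inner f h.
Proof.
move=> f2 h2; rewrite /inner -cintegralZ; last exact: cintegrable_inner.
by congr cintegral; apply/funext => x; rewrite mulrA.
Qed.

Lemma innerJ f g : L2 f -> L2 g -> inner g f = conjc (inner f g).
Proof.
move=> f2 g2; rewrite /inner -cintegralJ; last exact: cintegrable_inner.
by congr cintegral; apply/funext => x; rewrite rmorphM /= conjcK mulrC.
Qed.

Lemma innerNl f h : L2 f -> L2 h -> inner (- f) h = - inner f h.
Proof. by move=> f2 h2; rewrite -cstN1E innerZl// mulN1r. Qed.

Lemma innerBl f g h : L2 f -> L2 g -> L2 h ->
  inner (f - g) h = inner f h - inner g h.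
Proof. by move=> f2 g2 h2; rewrite innerDl ?innerNl//; exact: L2N. Qed.

Lemma innerDr f g h : L2 f -> L2 g -> L2 h ->
  inner h (f + g) = inner h f + inner h g.
Proof.
move=> f2 g2 h2; rewrite innerJ ?innerDl ?rmorphD//; last exact: L2D.
by rewrite (innerJ f2 h2) (innerJ g2 h2).
Qed.

Lemma innerZr c f h : L2 f -> L2 h ->
  inner h (cst c * f) = conjc c * inner h f.
Proof.
move=> f2 h2; rewrite innerJ ?innerZl ?rmorphM//; last exact: L2Z.
by rewrite (innerJ f2 h2).
Qed.

Lemma innerNr f h : L2 f -> L2 h -> inner h (- f) = - inner h f.
Proof. by move=> f2 h2; rewrite -cstN1E innerZr// rmorphN1 mulN1r. Qed.

Lemma innerBr f g h : L2 f -> L2 g -> L2 h ->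
  inner h (f - g) = inner h f - inner h g.
Proof. by move=> f2 g2 h2; rewrite innerDr ?innerNr//; exact: L2N. Qed.

Lemma inner0l h : inner 0 h = 0.
Proof.
rewrite /inner (_ : (fun _ => _) = (fun=> 0)); first exact: cintegral0.
by apply/funext => x; rewrite /= mul0r.
Qed.

Lemma inner_combl (I : choiceType) (s : seq I) (c : I -> R[i])
    (F : I -> T -> R[i]) h : {in s, forall i, L2 (F i)} -> L2 h ->
  inner (\sum_(i <- s) cst (c i) * F i) h = \sum_(i <- s) c i * inner (F i) h.
Proof.
move=> F2 h2; elim: s F2 => [|i s IH] F2; first by rewrite !big_nil inner0l.
have F2i : L2 (F i) by apply: F2; rewrite mem_head.
have F2s : {in s, forall i, L2 (F i)}.
  by move=> j js; apply: F2; rewrite in_cons js orbT.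
rewrite !big_cons innerDl ?innerZl ?IH//; first exact: L2Z.
exact: L2_comb.
Qed.

Lemma inner_self f : L2 f -> inner f f = (sqnorm f)%:C%C.
Proof.
move=> f2; rewrite /inner /cintegral; apply: complex_eq => /=.
    apply: eq_Rintegral => x _ /=. rewrite Re_mulc Re_conjc Im_conjc sqr_normcE; ring.
rewrite /Rintegral (eq_integral (cst 0%E)) ?integral0// => x _.
by rewrite /= Im_mulc Re_conjc Im_conjc; congr EFin; ring.
Qed.

Lemma sqnormD f g : L2 f -> L2 g ->
  sqnorm (f + g) = sqnorm f + sqnorm g + 2 * Re (inner f g).
Proof.
move=> f2 g2; have /complexI -> // : (sqnorm (f + g))%:C%C =
  (sqnorm f + sqnorm g + 2 * Re (inner f g))%:C%C.
rewrite -inner_self; last exact: L2D.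
rewrite innerDl ?innerDr//; last exact: L2D.
rewrite [inner g f]innerJ// !inner_self//.
by case: (inner f g) => a b; apply: complex_eq => /=; ring.
Qed.

Lemma sqnormN f : sqnorm (- f) = sqnorm f.
Proof.
by apply: eq_Rintegral => x _; rewrite !sqr_normcE raddfN raddfN /= !sqrrN.
Qed.

Lemma sqnormB f g : L2 f -> L2 g ->
  sqnorm (f - g) = sqnorm f + sqnorm g - 2 * Re (inner f g).
Proof.
move=> f2 g2; rewrite sqnormD ?sqnormN ?innerNr//; last exact: L2N.
by rewrite raddfN mulrN.
Qed.

Lemma sqnormZ c f : L2 f -> sqnorm (cst c * f) = normc c ^+ 2 * sqnorm f.
Proof.
move=> /L2P[_ fi]; rewrite /sqnorm -RintegralZl//.
by apply: eq_Rintegral => x _; rewrite Normc.normcM exprMn.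
Qed.

(** This weak form of the triangle inequality is enough for every limiting
    argument, and saves the square roots. *)
Lemma sqnormD_le f g : L2 f -> L2 g ->
  sqnorm (f + g) <= 2 * sqnorm f + 2 * sqnorm g.
Proof.
move=> f2 g2; have := sqnorm_ge0 (f - g).
by rewrite sqnormB// sqnormD//; lra.
Qed.

Lemma sqnormB_le f g h : L2 f -> L2 g -> L2 h ->
  sqnorm (f - h) <= 2 * sqnorm (f - g) + 2 * sqnorm (g - h).
Proof.
move=> f2 g2 h2; rewrite -[f - h](subrKA g).
by apply: sqnormD_le; exact: L2B.
Qed.

(** The squared norm of [f - t z g], for real [t], is a nonnegative polynomial
    of degree at most 2 in [t]. *)
Lemma cauchy_schwarz f g : L2 f -> L2 g ->
  normc (inner f g) ^+ 2 <= sqnorm f * sqnorm g.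
Proof.
move=> f2 g2; set z := inner f g.
have P (t : R) : 0 <= sqnorm f - 2 * t * normc z ^+ 2 +
    t ^+ 2 * normc z ^+ 2 * sqnorm g.
  have := sqnorm_ge0 (f - cst (t%:C%C * z) * g).
  rewrite sqnormB ?innerZr ?sqnormZ//; last exact: L2Z.
  rewrite -/z (_ : Re (_ * _) = t * normc z ^+ 2); last first.
    by rewrite sqr_normcE; case: z => a b /=; ring.
  rewrite Normc.normcM exprMn (_ : normc t%:C%C ^+ 2 = t ^+ 2); last first.
    by rewrite sqr_normcE /=; ring.
  lra.
have [g0|g0] := eqVneq (sqnorm g) 0.
  rewrite g0 mulr0 leNgt; apply/negP => z0.
  have /(_ ((sqnorm f + 1) / normc z ^+ 2)) := P.
  rewrite g0 mulr0 addr0 -mulrA divfK ?gt_eqF//.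
  have := sqnorm_ge0 f; lra.
have gp : 0 < sqnorm g by rewrite lt_neqAle eq_sym g0 sqnorm_ge0.
have /(_ (sqnorm g)^-1) := P.
rewrite -(ler_pM2r gp) mul0r => H; rewrite -subr_ge0; apply: le_trans H _.
by rewrite le_eqVlt; apply/orP; left; apply/eqP; field.
Qed.

Lemma sqnorm_eq0 f : L2 f -> sqnorm f = 0 <-> {ae mu, forall x, f x = 0}.
Proof.
move=> f2; have [mf fi] := (L2P f).1 f2.
have mfE : measurable_fun setT (fun x => (normc (f x) ^+ 2)%:E).
  by apply/measurable_EFinP; exact: cmeasurable_normc2.
have absE : (\int[mu]_x `|(normc (f x) ^+ 2)%:E| = (sqnorm f)%:E)%E.
  by rewrite -L2_sqnormE//; apply: eq_integral => x _; rewrite gee0_abs// lee_fin sqr_ge0.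
have [ae1 ae2] := ae_eq_integral_abs mu measurableT mfE.
split=> [f0|f0].
  have /ae1 : (\int[mu]_x `|(normc (f x) ^+ 2)%:E| = 0)%E by rewrite absE f0.
  apply: filterS => x /(_ I) /= [].
  by move/eqP; rewrite sqrf_eq0 => /eqP; exact: Normc.eq0_normc.
have : (\int[mu]_x `|(normc (f x) ^+ 2)%:E| = 0)%E.
  by apply: ae2; apply: filterS f0 => x -> _; rewrite Normc.normc0 expr0n.
by rewrite absE => -[].
Qed.

End square_integrable.

(** * Closed spans and orthonormal families *)

Section spans.
Variables (R : realType) (n : nat).
Local Notation T := 'cV[R]_n.
Local Notation L2 := (@Defs.L2 R n).
Implicit Types (f g h : T -> R[i]) (c : R[i]) (E : set (T -> R[i])).
Local Notation Re := complex.Re.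
Local Notation normc := (@Normc.normc R).

Lemma L2closureP E f : E `<=` L2 ->
  L2closure E f <->
  L2 f /\ forall eps : R, 0 < eps -> exists2 g, E g & sqnorm (f - g) < eps.
Proof.
move=> E2; split=> -[f2 fE]; split=> // eps e0.
  have se0 : 0 < Num.sqrt eps by rewrite sqrtr_gt0.
  have [g Eg] := fE _ se0; rewrite (L2norm_lt (L2B f2 (E2 _ Eg)) se0).
  by rewrite sqr_sqrtr 1?ltW//; exists g.
have [g Eg fg] := fE (eps ^+ 2) (exprn_gt0 _ e0); exists g => //.
by rewrite (L2norm_lt (L2B f2 (E2 _ Eg)) e0).
Qed.

Lemma cspanE E f : cspan E f <->
  exists m (c : 'I_m -> R[i]) (e : 'I_m -> T -> R[i]),
    (forall i, E (e i)) /\ f = \sum_(i < m) cst (c i) * e i.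
Proof.
by split=> -[m [c [e [Ee ->]]]]; exists m, c, e; split=> //;
  apply/funext => x; rewrite fct_sumE.
Qed.

Lemma cspan_ind E (W : set (T -> R[i])) :
  W 0 -> (forall f g, W f -> W g -> W (f + g)) ->
  (forall c f, W f -> W (cst c * f)) -> E `<=` W -> cspan E `<=` W.
Proof.
move=> W0 WD WZ EW _ /cspanE[m [c [e [Ee ->]]]].
by elim/big_ind: _ => // i _; apply: WZ; exact: EW.
Qed.

Lemma cspan0 E : cspan E 0.
Proof.
apply/cspanE; exists 0%N, (fun=> 0), (fun=> 0); split; first by case.
by rewrite big_ord0.
Qed.

Lemma cspanZ E c f : cspan E f -> cspan E (cst c * f).
Proof.
move=> /cspanE[m [d [e [Ee ->]]]]; apply/cspanE.
exists m, (fun i => c * d i), e; split=> //; rewrite mulr_sumr.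
by apply: eq_bigr => i _; apply/funext => x; rewrite /= mulrA.
Qed.

Lemma cspanD E f g : cspan E f -> cspan E g -> cspan E (f + g).
Proof.
move=> /cspanE[m1 [c1 [e1 [Ee1 ->]]]] /cspanE[m2 [c2 [e2 [Ee2 ->]]]].
apply/cspanE; exists (m1 + m2)%N,
  (fun i => match fintype.split i with inl j => c1 j | inr j => c2 j end),
  (fun i => match fintype.split i with inl j => e1 j | inr j => e2 j end).
split; first by move=> i; case: (fintype.split i).
rewrite big_split_ord /=; congr (_ + _); apply: eq_bigr => i _.
  by rewrite (unsplitK (inl i)).
by rewrite (unsplitK (inr i)).
Qed.

Lemma cspan_sub E : E `<=` cspan E.
Proof.
move=> f Ef; apply/cspanE; exists 1%N, (fun=> 1), (fun=> f); split=> //.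
by rewrite big_ord1; apply/funext => x; rewrite /= mul1r.
Qed.

Lemma cspan_L2 E : E `<=` L2 -> cspan E `<=` L2.
Proof.
move=> E2; apply: cspan_ind => //; [exact: L2_0| |].
- by move=> f g; exact: L2D.
- by move=> c f; exact: L2Z.
Qed.

Lemma closed_spanP E f : E `<=` L2 -> closed_span E f <->
  L2 f /\ forall eps : R, 0 < eps -> exists2 g, cspan E g & sqnorm (f - g) < eps.
Proof. by move=> E2; apply: L2closureP; exact: cspan_L2. Qed.

Lemma sqnorm0 : sqnorm (0 : T -> R[i]) = 0.
Proof.
apply/sqnorm_eq0; first exact: L2_0.
by apply: aeW.
Qed.

Lemma cspan_closed_span E : E `<=` L2 -> cspan E `<=` closed_span E.
Proof.
move=> E2 f Ef; apply/closed_spanP => //; split; first exact: cspan_L2 Ef.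
by move=> eps e0; exists f => //; rewrite subrr sqnorm0.
Qed.

Lemma closed_spanD E f g : E `<=` L2 ->
  closed_span E f -> closed_span E g -> closed_span E (f + g).
Proof.
move=> E2 /closed_spanP[//|f2 fE] /closed_spanP[//|g2 gE].
apply/closed_spanP => //; split; first exact: L2D.
move=> eps e0; have e4 : 0 < eps / 4 by rewrite divr_gt0.
have [f' Ef' ff'] := fE _ e4; have [g' Eg' gg'] := gE _ e4.
exists (f' + g'); first exact: cspanD.
rewrite opprD addrACA; apply: (le_lt_trans (sqnormD_le _ _)).
- by apply: L2B => //; exact: cspan_L2 Ef'.
- by apply: L2B => //; exact: cspan_L2 Eg'.
- lra.
Qed.

Lemma closed_spanZ E c f : E `<=` L2 ->
  closed_span E f -> closed_span E (cst c * f).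
Proof.
move=> E2 /closed_spanP[//|f2 fE]; apply/closed_spanP => //.
split; first exact: L2Z.
move=> eps e0; have c0 : 0 < normc c ^+ 2 + 1 by rewrite ltr_wpDl// sqr_ge0.
have [f' Ef' ff'] := fE _ (divr_gt0 e0 c0).
exists (cst c * f'); first exact: cspanZ.
have f'2 := cspan_L2 E2 Ef'.
rewrite -mulrBr sqnormZ; last exact: L2B.
move: ff'; rewrite ltr_pdivlMr// => ff'.
have := sqnorm_ge0 (f - f'); nra.
Qed.

Lemma closed_span_closed E f : E `<=` L2 -> L2 f ->
  (forall eps : R, 0 < eps ->
    exists2 g, closed_span E g & sqnorm (f - g) < eps) ->
  closed_span E f.
Proof.
move=> E2 f2 fE; apply/closed_spanP => //; split=> // eps e0.
have e4 : 0 < eps / 4 by rewrite divr_gt0.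
have [g /closed_spanP[//|g2 gE] fg] := fE _ e4; have [h Eh gh] := gE _ e4.
exists h => //; apply: (le_lt_trans (sqnormB_le f2 g2 (cspan_L2 E2 Eh))).
lra.
Qed.

Lemma closed_span0 E : E `<=` L2 -> closed_span E 0.
Proof. by move=> E2; apply: cspan_closed_span => //; exact: cspan0. Qed.

(** The intended [U] is a dilation: it multiplies squared norms by [k], so it
    preserves approximability. *)
Lemma closed_span_map E E' (U : (T -> R[i]) -> (T -> R[i])) (k : R) :
  E `<=` L2 -> E' `<=` L2 -> 0 <= k ->
  U 0 = 0 -> (forall f g, U (f + g) = U f + U g) ->
  (forall c f, U (cst c * f) = cst c * U f) ->
  (forall f, L2 f -> L2 (U f)) ->
  (forall f, L2 f -> sqnorm (U f) = k * sqnorm f) ->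
  (forall e, E e -> closed_span E' (U e)) ->
  forall f, closed_span E f -> closed_span E' (U f).
Proof.
move=> E2 E'2 k0 U0 UD UZ U2 Uk UE f /closed_spanP[//|f2 fE].
apply: closed_span_closed => //; first exact: U2.
move=> eps e0; have k1 : 0 < k + 1 by lra.
have [g Eg fg] := fE _ (divr_gt0 e0 k1); exists (U g).
  move: g Eg {fg}; apply: cspan_ind => //.
  - by rewrite U0; exact: closed_span0.
  - by move=> g h Ug Uh; rewrite UD; exact: closed_spanD.
  - by move=> c g Ug; rewrite UZ; exact: closed_spanZ.
have g2 := cspan_L2 E2 Eg.
have -> : U f - U g = U (f - g) by rewrite -!cstN1E UD UZ.
rewrite Uk; last exact: L2B.
move: fg; rewrite ltr_pdivlMr// => fg; have := sqnorm_ge0 (f - g); nra.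
Qed.

(** Orthogonality passes to the span by linearity, and to its closure because
    the inner product is continuous. *)
Lemma orthogonal_closed_span E h : E `<=` L2 -> L2 h ->
  (forall e, E e -> inner h e = 0) ->
  forall g, closed_span E g -> inner h g = 0.
Proof.
move=> E2 h2 hE g /closed_spanP[//|g2 gE].
have hspan : cspan E `<=` [set f | L2 f /\ inner h f = 0].
  apply: cspan_ind => /=.
  - by split; [exact: L2_0|rewrite innerJ ?inner0l ?conjc0//; exact: L2_0].
  - move=> f f' [f2 hf] [f'2 hf']; split; first exact: L2D.
    by rewrite innerDr// hf hf' addr0.
  - move=> c f [f2 hf]; split; first exact: L2Z.
    by rewrite innerZr// hf mulr0.
  - by move=> e Ee; split; [exact: E2|exact: hE].
suff zle : normc (inner h g) ^+ 2 <= 0.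
  by apply: Normc.eq0_normc; apply/eqP; rewrite -sqrf_eq0 eq_le zle sqr_ge0.
suff zle eps : 0 < eps -> normc (inner h g) ^+ 2 <= eps.
  by apply/ler_addgt0Pr => eps e0; rewrite add0r; exact: zle.
move=> e0.
have h1 : 0 < sqnorm h + 1 by have := sqnorm_ge0 h; lra.
have [g' /hspan [g'2 hg'] gg'] := gE _ (divr_gt0 e0 h1).
have -> : inner h g = inner h (g - g') by rewrite innerBr// hg' subr0.
apply: le_trans (cauchy_schwarz h2 (L2B g2 g'2)) _.
move: gg'; rewrite ltr_pdivlMr// => gg'.
have := sqnorm_ge0 (g - g'); have := sqnorm_ge0 h; nra.
Qed.

Lemma pythagoras f g : L2 f -> L2 g -> inner f g = 0 ->
  sqnorm (f + g) = sqnorm f + sqnorm g.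
Proof. by move=> f2 g2 fg; rewrite sqnormD// fg /= mulr0 addr0. Qed.

End spans.

Section orthonormal_families.
Variables (R : realType) (n : nat) (I : choiceType).
Local Notation T := 'cV[R]_n.
Local Notation L2 := (@Defs.L2 R n).
Variables (S : set I) (e : I -> T -> R[i]).
Hypothesis e2 : forall s, S s -> L2 (e s).
Hypothesis oe : orthonormal_on S e.
Implicit Types (f g : T -> R[i]) (F : seq I).
Local Notation Re := complex.Re.
Local Notation normc := (@Normc.normc R).

Let eS2 : [set e s | s in S] `<=` L2.
Proof. by move=> _ [s Ss <-]; exact: e2. Qed.

(** For an orthonormal family, and [F] without repetition, this is the
    orthogonal projection on the span of the members indexed by [F]. *)
Definition proj F f := \sum_(s <- F) cst (inner f (e s)) * e s.

Lemma L2_proj F f : {in F, forall s, S s} -> L2 (proj F f).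
Proof. by move=> FS; apply: L2_comb => s /FS; exact: e2. Qed.

Lemma inner_proj F f t : uniq F -> {in F, forall s, S s} -> S t ->
  inner (proj F f) (e t) = if t \in F then inner f (e t) else 0.
Proof.
move=> uF FS St; rewrite inner_combl; [|by move=> s /FS; exact: e2|exact: e2].
rewrite (eq_big_seq (fun s => if s == t then inner f (e t) else 0)); last first.
  move=> s /FS Ss; rewrite oe//; case: eqP => [->|_]; first by rewrite mulr1.
  by rewrite mulr0.
case: ifPn => tF.
  rewrite (bigD1_seq t)//= eqxx big1_seq ?addr0// => s /andP[/negPf ->//].
by rewrite big1_seq// => s /andP[_ sF]; case: eqP => // st; rewrite -st sF in tF.
Qed.

Lemma inner_sub_proj F f t : uniq F -> {in F, forall s, S s} -> L2 f ->
  t \in F -> inner (f - proj F f) (e t) = 0.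
Proof.
move=> uF FS f2 tF; have St := FS _ tF.
by rewrite innerBl ?inner_proj ?tF ?subrr//; [exact: L2_proj|exact: e2].
Qed.

Lemma inner_sub_proj_proj F f : uniq F -> {in F, forall s, S s} -> L2 f ->
  inner (f - proj F f) (proj F f) = 0.
Proof.
move=> uF FS f2; have p2 := L2_proj f FS; have s2 := L2B f2 p2.
rewrite innerJ// inner_combl//; last by move=> s /FS; exact: e2.
rewrite big1_seq ?conjc0// => s /andP[_ sF]; have es2 := e2 (FS _ sF).
by rewrite (innerJ s2 es2) inner_sub_proj// conjc0 mulr0.
Qed.

Lemma sqnorm_proj F f : uniq F -> {in F, forall s, S s} -> L2 f ->
  sqnorm (proj F f) = \sum_(s <- F) normc (inner f (e s)) ^+ 2.
Proof.
move=> uF FS f2; have p2 := L2_proj f FS.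
have /complexI -> // : (sqnorm (proj F f))%:C%C =
  (\sum_(s <- F) normc (inner f (e s)) ^+ 2)%:C%C.
rewrite -inner_self// inner_combl//; last by move=> s /FS; exact: e2.
rewrite rmorph_sum; apply: eq_big_seq => s sF.
have Ss := FS _ sF.
rewrite [inner (e s) _]innerJ ?inner_proj ?sF//; last exact: e2.
rewrite sqr_normcE; case: (inner f (e s)) => a b.
by apply: complex_eq => /=; ring.
Qed.

Lemma sqnorm_sub_proj F f : uniq F -> {in F, forall s, S s} -> L2 f ->
  sqnorm (f - proj F f) = sqnorm f - \sum_(s <- F) normc (inner f (e s)) ^+ 2.
Proof.
move=> uF FS f2; have p2 := L2_proj f FS.
have := pythagoras (L2B f2 p2) p2 (inner_sub_proj_proj uF FS f2).
by rewrite subrK sqnorm_proj// => ->; rewrite addrK.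
Qed.

(** The remainder is orthogonal to the members in [F] by construction, and to
    the others because [f] and the finite sum both are. *)
Lemma sub_proj_orthogonal F f : uniq F -> {in F, forall s, S s} -> L2 f ->
  (forall t, S t -> t \notin F -> inner f (e t) = 0) ->
  forall g, closed_span [set e s | s in S] g -> inner (f - proj F f) g = 0.
Proof.
move=> uF FS f2 f0; apply: orthogonal_closed_span => //.
  by apply: L2B => //; exact: L2_proj.
move=> _ [t St <-]; have [tF|tF] := boolP (t \in F); first exact: inner_sub_proj.
by rewrite innerBl ?inner_proj ?(negPf tF) ?f0 ?subrr//; [exact: L2_proj|exact: e2].
Qed.

Lemma sqnorm_sub_proj_le F f g : {in F, forall s, S s} -> L2 f -> L2 g ->
  inner (f - proj F f) (proj F f - g) = 0 ->
  sqnorm (f - proj F f) <= sqnorm (f - g).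
Proof.
move=> FS f2 g2 fg; have p2 := L2_proj f FS.
have := pythagoras (L2B f2 p2) (L2B p2 g2) fg.
by rewrite subrKA => ->; rewrite lerDl sqnorm_ge0.
Qed.

Lemma proj_cspan F f : {in F, forall s, S s} ->
  cspan [set e s | s in S] (proj F f).
Proof.
move=> FS; rewrite /proj big_seq; elim/big_rec: _ => [|s g sF Eg].
  exact: cspan0.
apply: cspanD => //; apply: cspanZ; apply: cspan_sub.
by exists s => //; exact: FS.
Qed.

Lemma proj_closed_span F f : {in F, forall s, S s} ->
  closed_span [set e s | s in S] (proj F f).
Proof. by move=> FS; apply: cspan_closed_span => //; exact: proj_cspan. Qed.

(** Past the indices that occur in a good approximation [g] of [f], partial
    Fourier sums are at least as close to [f] as [g] is. *)
Theorem orthonormal_basis_closed_span :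
  orthonormal_basis S e (closed_span [set e s | s in S]).
Proof.
split=> //.
  move=> s Ss; apply: cspan_closed_span => //; apply: cspan_sub.
  by exists s.
move=> f /closed_spanP[//|f2 fE] eps e0.
have [g /cspanE[m [c [h [Eh gE]]]] fg] := fE _ (exprn_gt0 2 e0).
have /choice[t tE] : forall i, exists s, S s /\ e s = h i.
  by move=> i; have [s Ss <-] := Eh i; exists s.
exists [fset t i | i in 'I_m]%fset.
  by move=> s /= /imfsetP[i _ ->]; exact: (tE i).1.
move=> F F0 FS; have uF : uniq F by exact: fset_uniq.
have FS' : {in F, forall s, S s} by move=> s sF; exact: FS.
have p2 := L2_proj f FS'.
rewrite (_ : (fun _ => _) = f - proj F f); last first.
  by apply/funext => x; rewrite /proj !fctE fct_sumE.
rewrite L2norm_lt//; last exact: L2B.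
have g2 : L2 g.
  by rewrite gE; apply: L2_comb => i _; rewrite -(tE i).2; exact: e2 (tE i).1.
apply: le_lt_trans fg; apply: sqnorm_sub_proj_le => //.
have s2 := L2B f2 p2.
rewrite innerBr// inner_sub_proj_proj// sub0r gE.
rewrite innerJ//; last by rewrite -gE.
rewrite inner_combl//; last by move=> i _; rewrite -(tE i).2; exact: e2 (tE i).1.
rewrite big1 ?conjc0 ?oppr0// => i _; rewrite -(tE i).2.
have tF : t i \in F by apply: F0; exact: in_imfset.
have es2 := e2 (tE i).1.
by rewrite (innerJ s2 es2) inner_sub_proj// conjc0 mulr0.
Qed.

End orthonormal_families.

(** * Affine changes of variables for functions *)

Section affine_pullback.
Variables (R : realType) (n : nat).
Let mu := lebesgue_cV R n.+1.
Local Notation T := 'cV[R]_n.+1.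
Variables (A : 'M[R]_n.+1) (b : T).
Hypothesis dA : \det A != 0.
Local Notation h := (fun v : T => A *m v + b).
Implicit Types (f g : T -> R[i]).
Local Notation Re := complex.Re.
Local Notation Im := complex.Im.
Local Notation normc := (@Normc.normc R).

Let mh : measurable_fun [set: T] h. Proof. exact: measurable_mulmxD. Qed.

Lemma lebesgue_cV_affine S : measurable S ->
  mu S = (`|\det A|%:E * mu (h @^-1` S))%E.
Proof. exact: scales_volume_unit. Qed.

Lemma ge0_integral_affine (f : T -> \bar R) :
  measurable_fun setT f -> (forall x, 0 <= f x)%E ->
  (\int[mu]_x f x = `|\det A|%:E * \int[mu]_x f (h x))%E.
Proof.
by apply: ge0_integral_scaled => // S mS; exact: lebesgue_cV_affine.
Qed.

Lemma integrable_affine (f : T -> \bar R) : mu.-integrable setT f ->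
  mu.-integrable setT (fun x => f (h x)).
Proof.
move=> /integrableP[mf fi]; apply/integrableP; split.
  exact: measurableT_comp mf mh.
move: fi; rewrite (@ge0_integral_affine (fun x => `|f x|%E))//; last first.
  exact: measurableT_comp.
have : (0 <= \int[mu]_x `|f (h x)|)%E by exact: integral_ge0.
case: (\int[mu]_x `|f (h x)|)%E => [r _ _||//]; first by rewrite ltry.
by rewrite gt0_muley// lte_fin normr_gt0.
Qed.

(** Reduced to nonnegative functions through positive and negative parts. *)
Lemma Rintegral_affine (f : T -> R) : mu.-integrable setT (EFin \o f) ->
  \int[mu]_x f x = `|\det A| * \int[mu]_x f (h x).
Proof.
move=> fi; have fhi := integrable_affine fi.
have -> : `|\det A| * \int[mu]_x f (h x) =
    fine (`|\det A|%:E * \int[mu]_x (f (h x))%:E)%E.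
  by rewrite fineM//; exact: integrable_fin_num.
rewrite /Rintegral; congr fine; rewrite integralE [in RHS]integralE.
have [mf _] := integrableP _ _ _ fi.
rewrite (@ge0_integral_affine ((EFin \o f)^\+)%E)//; last exact: measurable_funepos.
rewrite (@ge0_integral_affine ((EFin \o f)^\-)%E)//; last exact: measurable_funeneg.
rewrite -muleBr//; last first.
  apply: fin_num_adde_defl; rewrite fin_numN.
  have := integrable_neg_fin_num measurableT fhi.
  by rewrite (funeneg_comp (EFin \o f) h).
congr (_ * (_ - _))%E; apply: eq_integral => x _.
  exact: esym (congr1 (@^~ x) (funepos_comp (EFin \o f) h)).
exact: esym (congr1 (@^~ x) (funeneg_comp (EFin \o f) h)).
Qed.

Lemma ae_affine (P : T -> Prop) :
  {ae mu, forall x, P x} -> {ae mu, forall x, P (h x)}.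
Proof.
move=> [N [mN N0 NP]]; exists (h @^-1` N); split.
- by rewrite -[X in measurable X]setTI; exact: mh.
- apply/eqP; move/eqP: N0; rewrite lebesgue_cV_affine// mule_eq0 => /orP[|//].
  by rewrite eqe normr_eq0 (negPf dA).
- by move=> x /= Px; apply: NP.
Qed.

Lemma cintegrable_affine f : cintegrable f -> cintegrable (fun x => f (h x)).
Proof.
move=> [mf fi]; split; first exact: cmeasurable_comp mf.
exact: (integrable_affine fi).
Qed.

Lemma cintegral_affine f : cintegrable f ->
  cintegral f = (`|\det A|)%:C%C * cintegral (fun x => f (h x)).
Proof.
move=> fi; apply: complex_eq.
  rewrite Re_mulc /= mul0r subr0 /cintegral /=.
  by rewrite (Rintegral_affine (cintegrableRe fi)).
rewrite Im_mulc /= mul0r addr0 /cintegral /=.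
by rewrite (Rintegral_affine (cintegrableIm fi)).
Qed.

Lemma L2_affine f : L2 f -> L2 (fun x => f (h x)).
Proof.
move=> /L2P[mf fi]; apply/L2P; split; first exact: cmeasurable_comp mf.
exact: (integrable_affine fi).
Qed.

Lemma sqnorm_affine f : L2 f ->
  sqnorm f = `|\det A| * sqnorm (fun x => f (h x)).
Proof. by move=> /L2P[mf fi]; rewrite /sqnorm -(Rintegral_affine fi). Qed.

End affine_pullback.

(** * Powers of expanding matrices *)

Section contraction.
Variable R : realType.
Local Notation normc := (@Normc.normc R).

(** For nonnegative sequences this is convergence to 0. *)
Definition vanishes (t : nat -> R) :=
  forall eps : R, 0 < eps -> exists K, forall k, (K <= k)%N -> t k <= eps.

Lemma vanishes_geometric (rho c : R) : 0 <= rho < 1 ->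
  vanishes (fun k => rho ^+ k * c).
Proof.
move=> /andP[r0 r1] eps e0.
have rc : (fun k => rho ^+ k) @ \oo --> (0 : R).
  by apply: cvg_expr; rewrite ger0_norm.
have c1 : 0 < `|c| + 1 by rewrite ltr_wpDl.
have /cvgr0Pnorm_le/(_ _ (divr_gt0 e0 c1)) [K _ rK] := rc.
exists K => k /rK /=; rewrite ger0_norm ?exprn_ge0// ler_pdivlMr// => rk.
apply: le_trans rk; apply: ler_wpM2l; first exact: exprn_ge0.
by rewrite (le_trans (ler_norm _))// lerDl.
Qed.

(** A contracting recursion forgets its past, so it inherits the limit 0 of
    its forcing term. *)
Lemma vanishes_recursion (rho : R) (t w : nat -> R) : 0 <= rho < 1 ->
  (forall k, t k.+1 <= rho * t k + w k) -> vanishes w -> vanishes t.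
Proof.
move=> r01 tw w0 eps e0; have /andP[r0 r1] := r01.
have e2 : 0 < (1 - rho) * (eps / 2) by apply: mulr_gt0; lra.
have [K wK] := w0 _ e2.
have bound m : t (K + m)%N - eps / 2 <= rho ^+ m * (t K - eps / 2).
  elim: m => [|m IH]; first by rewrite addn0 expr0 mul1r.
  have := ler_wpM2l r0 IH; rewrite mulrA -exprS.
  have := tw (K + m)%N; have := wK (K + m)%N (leq_addr _ _); rewrite addnS.
  set x := t (K + m).+1; set y := t (K + m)%N; set z := rho ^+ _ * _; nra.
have e20 : 0 < eps / 2 by lra.
have [M rM] := vanishes_geometric (t K - eps / 2) r01 e20.
exists (K + M)%N => k kKM; have KK : (K <= k)%N := leq_trans (leq_addr _ _) kKM.
have := rM (k - K)%N; rewrite leq_subRL// => /(_ kKM).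
have := bound (k - K)%N; rewrite subnKC//; lra.
Qed.

(** By Cayley-Hamilton a matrix is killed by a product of factors [B - z].
    Peeling them off one at a time, each power sequence satisfies a
    contracting recursion of ratio [|z|] whose forcing term is already known
    to vanish. *)
Lemma vanishes_expmx n (B : 'M[R[i]]_n.+1) :
  (forall z : R[i], eigenvalue B z -> normc z < 1) ->
  forall i j, vanishes (fun k => normc ((B ^+ k) i j)).
Proof.
move=> Bz; have [zs zsE] := closed_field_poly_normal (char_poly B).
have charE : char_poly B = \prod_(z <- zs) ('X - z%:P).
  by rewrite zsE (eqP (char_poly_monic B)) scale1r.
have zs1 : {in zs, forall z, normc z < 1}.
  move=> z zzs; apply: Bz; rewrite eigenvalue_root_char charE.
  by rewrite root_prod_XsubC.
suff main (s : seq R[i]) (X : 'M[R[i]]_n.+1) : {in s, forall z, normc z < 1} ->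
    (\prod_(z <- s) (B - z%:M)) * X = 0 ->
    forall i j, vanishes (fun k => normc ((B ^+ k * X) i j)).
  move=> i j; have := main zs 1 zs1; rewrite mulr1.
  have -> : \prod_(z <- zs) (B - z%:M) = 0.
    rewrite -(Cayley_Hamilton B) charE rmorph_prod; apply: eq_bigr => z _.
    by rewrite rmorphB /= horner_mx_X horner_mx_C.
  by move=> /(_ erefl i j); under eq_fun do rewrite mulr1.
elim: s X => [|z s IH] X s1.
  rewrite big_nil mul1r => -> i j eps e0; exists 0%N => k _.
  by rewrite mulr0 mxE Normc.normc0 ltW.
rewrite big_cons => BX i j.
have comm : (B - z%:M) * \prod_(z <- s) (B - z%:M) =
    (\prod_(z <- s) (B - z%:M)) * (B - z%:M).
  have scal (y : R[i]) (Y : 'M[R[i]]_n.+1) : GRing.comm Y y%:M.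
    exact: scalar_mxC.
  apply: commr_prod => y _; apply: commrB; last exact: scal.
  by apply/commr_sym; apply: commrB; [exact: commr_refl|exact: scal].
have X'0 : (\prod_(z <- s) (B - z%:M)) * ((B - z%:M) * X) = 0.
  by rewrite mulrA -comm.
have s1' : {in s, forall z, normc z < 1}.
  by move=> y ys; apply: s1; rewrite in_cons ys orbT.
apply: (@vanishes_recursion (normc z) _
    (fun k => normc ((B ^+ k * ((B - z%:M) * X)) i j))).
- by rewrite normc_ge0 s1// mem_head.
- move=> k; rewrite -Normc.normcM; apply: le_trans (le_normcD _ _).
  rewrite le_eqVlt; apply/orP; left; apply/eqP; congr normc.
  have -> : B ^+ k * ((B - z%:M) * X) = B ^+ k.+1 * X - z *: (B ^+ k * X).
    rewrite mulrBl mulrBr mulrA -exprSr -[z%:M * X]/(z%:M *m X) mul_scalar_mx.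
    by rewrite -scalerAr.
  have sub (Y Z : 'M[R[i]]_n.+1) : (Y - z *: Z) i j = Y i j - z * Z i j.
    by rewrite !mxE.
  by rewrite sub addrC subrK.
- exact: IH.
Qed.

End contraction.

Section expanding_matrix.
Variables (R : realType) (n : nat) (a : 'M[R]_n.+1).
Local Notation normc := (@Normc.normc R).
Hypothesis a1 : forall z : R[i],
  eigenvalue (map_mx (real_complex R) a) z -> 1 < `|z|.

Lemma expanding_unit : a \in unitmx.
Proof.
rewrite -(map_unitmx (real_complex R)) -row_free_unit -kermx_eq0.
apply/negPn/negP => ka; have /a1 : eigenvalue (map_mx (real_complex R) a) 0.
  by rewrite /eigenvalue /eigenspace raddf0 subr0.
by rewrite normr0 ltr10.
Qed.

Lemma expanding_det : \det a != 0.
Proof. by rewrite -unitfE -unitmxE expanding_unit. Qed.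

Lemma mx_norm_le m (v : 'cV[R]_m) (r : R) : 0 <= r ->
  (`|v| <= r) <-> forall i, `|v i ord0| <= r.
Proof.
move=> r0; have -> : `|v| = \big[Num.max/0]_ij `|v ij.1 ij.2| by exact: mx_normrE.
split=> [vr i|vr].
  apply: le_trans vr; exact: (le_bigmax _ (fun ij : 'I_m * 'I_1 => `|v ij.1 ij.2|) (i, ord0)).
by apply/bigmax_leP; split=> // -[i j] _ /=; rewrite ord1.
Qed.

Lemma norm_coord m (v : 'cV[R]_m) i : `|v i ord0| <= `|v|.
Proof. by apply: (mx_norm_le v (normr_ge0 _)).1. Qed.

Lemma mulmx_norm_le m p (A : 'M[R]_(m, p)) (c : R) (v : 'cV[R]_p) :
  0 <= c -> (forall i j, `|A i j| <= c) -> `|A *m v| <= p%:R * c * `|v|.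
Proof.
move=> c0 Ac; apply/mx_norm_le => [|i]; first by rewrite !mulr_ge0.
rewrite mxE; apply: le_trans (ler_norm_sum _ _ _) _.
apply: le_trans (_ : \sum_(j < p) c * `|v| <= _).
  apply: ler_sum => j _; rewrite normrM; apply: ler_pM => //.
  exact: norm_coord.
by rewrite sumr_const card_ord -mulrA mulr_natl.
Qed.

(** The eigenvalues of the inverse are the inverses of those of [a], so they
    lie inside the unit disk. *)
Theorem expanding_contraction (eps : R) : 0 < eps ->
  exists K, forall k, (K <= k)%N -> forall v : 'cV[R]_n.+1,
    `|invmx a ^+ k *m v| <= eps * `|v|.
Proof.
move=> e0; pose toC := real_complex R; pose B := map_mx toC (invmx a).
have ua := expanding_unit.
have BE : B = (map_mx toC a)^-1 by rewrite /B map_invmx.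
have uC : map_mx toC a \is a GRing.unit by rewrite map_unitmx.
have Bz (z : R[i]) : eigenvalue B z -> normc z < 1.
  move=> /eigenvalueP[v vB v0].
  have z0 : z != 0.
    apply: contraNneq v0 => z0; move: vB; rewrite z0 scale0r => vB.
    by rewrite -[v]mulmx1 -(mulVmx uC) mulmxA -[invmx _]/((map_mx toC a)^-1) -BE vB mul0mx.
  have : eigenvalue (map_mx toC a) z^-1.
    apply/eigenvalueP; exists v => //.
    rewrite -[v in RHS]mulmx1 -(mulVmx uC) mulmxA -[invmx _]/((map_mx toC a)^-1) -BE vB.
    by rewrite -scalemxAl scalerA mulVf// scale1r.
  move=> /a1; rewrite normrV ?unitfE//.
  have -> : `|z| = (normc z)%:C%C by [].
  rewrite -fmorphV ltcR => z1.
  have zp : 0 < normc z.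
    by rewrite lt_neqAle normc_ge0 eq_sym andbT; apply: contraNneq z0 => /Normc.eq0_normc ->.
  by move: z1; rewrite invf_gt1.
have en : 0 < eps / n.+1%:R by rewrite divr_gt0.
have /choice[K HK] : forall ij : 'I_n.+1 * 'I_n.+1, exists K, forall k, (K <= k)%N ->
    normc ((B ^+ k) ij.1 ij.2) <= eps / n.+1%:R.
  by move=> ij; exact: (vanishes_expmx Bz ij.1 ij.2).
exists (\max_ij K ij) => k kK v.
have -> : eps = n.+1%:R * (eps / n.+1%:R) by field.
apply: mulmx_norm_le; first exact: ltW.
move=> i j; have := HK (i, j) k (leq_trans (leq_bigmax _) kK) => /=.
apply: le_trans; rewrite /B -rmorphXn /= mxE.
by rewrite /toC -[leLHS]sqrtr_sqr; rewrite /Normc.normc /= expr0n addr0.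
Qed.

End expanding_matrix.

(** * Isometries and discrete subgroups *)

Section isometries.
Variables (R : realType) (n : nat).
Implicit Types (s t : affine R n) (x y v : 'cV[R]_n) (A : 'M[R]_n).

Lemma dotvD x y : dotv (x + y) (x + y) = dotv x x + dotv y y + 2 * dotv x y.
Proof.
rewrite /dotv mulr_sumr -!big_split /=; apply: eq_bigr => i _.
by rewrite !mxE; ring.
Qed.

Lemma dotv_ge0 x : 0 <= dotv x x.
Proof. by apply: sumr_ge0 => i _; rewrite -expr2 sqr_ge0. Qed.

(** Polarization: an isometry preserves the inner product, so its linear part
    is orthogonal. *)
Lemma isometry_orthogonal s : Defs.isometry s -> s.1^T *m s.1 = 1%:M.
Proof.
move=> si; have sq x : dotv (s.1 *m x) (s.1 *m x) = dotv x x.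
  have := si x 0; rewrite /aff_apply mulmx0 add0r addrK subr0 /enorm.
  move/eqP; rewrite eqr_sqrt ?dotv_ge0// => /eqP //.
have pol x y : dotv (s.1 *m x) (s.1 *m y) = dotv x y.
  have := sq (x + y); rewrite mulmxDr !dotvD !sq => /addrI.
  by apply: mulfI; rewrite pnatr_eq0.
have colM (M : 'M[R]_n) i k : (M *m delta_mx i ord0 : 'cV[R]_n) k ord0 = M k i.
  rewrite mxE (bigD1 i)//= mxE !eqxx mulr1 big1 ?addr0// => l li.
  by rewrite mxE (negPf li) mulr0.
have E (M : 'M[R]_n) i j :
    dotv (M *m delta_mx i ord0) (M *m delta_mx j ord0) = (M^T *m M) i j.
  by rewrite /dotv mxE; apply: eq_bigr => k _; rewrite !colM mxE.
apply/matrixP => i j; rewrite -E pol.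
rewrite -[delta_mx i ord0]mul1mx -[delta_mx j ord0]mul1mx E.
by rewrite trmx1 mul1mx.
Qed.

Lemma isometry_unit s : Defs.isometry s -> s.1 \in unitmx.
Proof. by move=> /isometry_orthogonal /mulmx1_unit[]. Qed.

Lemma isometry_inv s : Defs.isometry s -> invmx s.1 = s.1^T.
Proof.
move=> si; have us := isometry_unit si.
by rewrite -[LHS]mul1mx -(isometry_orthogonal si) mulmxK.
Qed.

Lemma isometry_det s : Defs.isometry s -> `|\det s.1| = 1.
Proof.
move=> /isometry_orthogonal/(congr1 determinant).
rewrite det_mulmx det_tr det1 -expr2 => /eqP.
rewrite -real_normK ?num_real// sqrf_eq1 => /orP[/eqP//|/eqP d1].
by have := normr_ge0 (\det s.1); rewrite d1 oppr_ge0 ler10.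
Qed.

Lemma isometry_entry s i j : Defs.isometry s -> `|s.1 i j| <= 1.
Proof.
move=> /isometry_orthogonal/matrixP/(_ j j); rewrite !mxE eqxx.
rewrite (bigD1 i)//= mxE -expr2 => H.
rewrite -(@ler_pXn2r _ 2)// ?nnegrE// expr1n real_normK ?num_real//.
rewrite -[leRHS]H lerDl; apply: sumr_ge0 => k _; rewrite mxE -expr2.
exact: sqr_ge0.
Qed.

(** The norm of column vectors is the sup norm, which an orthogonal matrix may
    increase, but at most by a factor equal to the dimension. *)
Lemma isometry_norm_le s v : Defs.isometry s -> `|s.1 *m v| <= n%:R * `|v|.
Proof.
move=> si; rewrite -[n%:R]mulr1; apply: mulmx_norm_le => // i j.
exact: isometry_entry.
Qed.

End isometries.

(** Points of a discrete additive subgroup are separated by a fixed gap, so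
    rounding to a fine grid is injective on them. *)
Lemma discrete_subgroup_locally_finite (R : realType) n
    (L : set 'cV[R]_n) (eps rho : R) : 0 < eps ->
  (forall u v, L u -> L v -> L (u - v)) ->
  (forall v, L v -> `|v| < eps -> v = 0) ->
  finite_set [set v | L v /\ `|v| <= rho].
Proof.
move=> e0 LB Le; pose q (x : R) := Num.floor (2 / eps * x).
(* the shift by [N] makes the codes nonnegative, so that rounding down to the
   multiples of [eps / 2] lands in a finite type *)
pose N := (Num.bound (2 / eps * rho)).+1.
pose code (v : 'cV[R]_n) : {ffun 'I_n -> 'I_(N + N).+1} :=
  [ffun i => inord (absz (q (v i ord0) + N%:Z))].
have e2 : 0 < 2 / eps by rewrite divr_gt0.
have qb (v : 'cV[R]_n) i : `|v| <= rho -> 0 <= q (v i ord0) + N%:Z <= (N + N)%:Z.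
  move=> vr; have := le_trans (norm_coord v i) vr; rewrite ler_norml => /andP[v1 v2].
  have rN : 2 / eps * rho <= N.-1%:R.
    apply: ltW; apply: archi_boundP; apply: mulr_ge0; first exact: ltW.
    exact: le_trans (normr_ge0 _) vr.
  have NE : N%:R = N.-1%:R + 1 :> R by rewrite -natr1.
  have w1 := ler_wpM2l (ltW e2) v1; have w2 := ler_wpM2l (ltW e2) v2.
  rewrite -(ler_int R) -[X in _ && X](ler_int R) rmorphD /= !PoszD !rmorphD /=.
  rewrite -!pmulrn NE.
  have := floor_le (2 / eps * v i ord0).
  have := floorD1_gt (2 / eps * v i ord0); rewrite rmorphD /= -/(q _).
  lra.
have ci : {in [set v | L v /\ `|v| <= rho] &, injective code}.
  move=> u v /set_mem[Lu ur] /set_mem[Lv vr] cuv.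
  apply/eqP; rewrite -subr_eq0; apply/eqP; apply: Le; first exact: LB.
  have e20 : 0 <= eps / 2 by rewrite divr_ge0// ltW.
  apply: (@le_lt_trans _ _ (eps / 2)); last lra.
  apply/mx_norm_le => // i; rewrite !mxE.
  have /andP[u0 uN] := qb u i ur; have /andP[v0 vN] := qb v i vr.
  have quv : q (u i ord0) = q (v i ord0).
    have /ffunP/(_ i) := cuv; rewrite !ffunE => /(congr1 val) /=.
    rewrite !inordK; last 2 first.
    - by rewrite ltnS -lez_nat gez0_abs.
    - by rewrite ltnS -lez_nat gez0_abs.
    by move=> /(congr1 Posz); rewrite !gez0_abs// => /addIr.
  have fu := floor_le (2 / eps * u i ord0).
  have fu1 := floorD1_gt (2 / eps * u i ord0).
  have fv := floor_le (2 / eps * v i ord0).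
  have fv1 := floorD1_gt (2 / eps * v i ord0).
  rewrite -/(q _) in fu fu1; rewrite -/(q _) -quv in fv fv1.
  rewrite rmorphD /= in fu1 fv1.
  have /andP[H1 H2] : - 1 <= 2 / eps * (u i ord0 - v i ord0) <= 1 by lra.
  rewrite ler_norml; apply/andP; split.
    rewrite -(ler_pM2l e2); apply: le_trans H1; rewrite le_eqVlt; apply/orP; left.
    by apply/eqP; field; rewrite gt_eqF.
  rewrite -(ler_pM2l e2); apply: (le_trans H2); rewrite le_eqVlt; apply/orP; left.
  by apply/eqP; field; rewrite gt_eqF.
by rewrite -(eq_finite_set (inj_card_eq ci)); exact: finite_finset.
Qed.

(** * Tilings *)

Section affine_action.
Variables (R : realType) (n : nat).
Let mu := lebesgue_cV R n.+1.
Implicit Types (s t : affine R n.+1) (v x : 'cV[R]_n.+1) (S : set 'cV[R]_n.+1).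

Lemma aff_comp_apply s t v :
  aff_apply (aff_comp s t) v = aff_apply s (aff_apply t v).
Proof. by rewrite /aff_apply /= mulmxDr mulmxA addrA. Qed.

Lemma aff_invK s v : Defs.isometry s -> aff_apply (aff_inv s) (aff_apply s v) = v.
Proof.
move=> /isometry_unit us; rewrite /aff_apply /= mulmxDr mulKmx//.
by rewrite addrK.
Qed.

Lemma aff_invVK s v : Defs.isometry s -> aff_apply s (aff_apply (aff_inv s) v) = v.
Proof.
move=> /isometry_unit us; rewrite /aff_apply /= mulmxDr mulmxN !mulKVmx//.
by rewrite subrK.
Qed.

Lemma aff_image s S : Defs.isometry s ->
  aff_apply s @` S = aff_apply (aff_inv s) @^-1` S.
Proof.
move=> si; apply/seteqP; split => x /=; first by move=> [y Sy <-]; rewrite aff_invK.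
by move=> Sx; exists (aff_apply (aff_inv s) x) => //; rewrite aff_invVK.
Qed.

Lemma det_aff_inv s : Defs.isometry s -> `|\det (aff_inv s).1| = 1.
Proof.
by move=> si; rewrite /= isometry_inv// det_tr isometry_det.
Qed.

Lemma det_aff_inv_neq0 s : Defs.isometry s -> \det (aff_inv s).1 != 0.
Proof. by move=> si; rewrite -normr_gt0 det_aff_inv. Qed.

Lemma measurable_aff_image s S : Defs.isometry s -> measurable S ->
  measurable (aff_apply s @` S).
Proof.
move=> si mS; rewrite aff_image// -[X in measurable X]setTI.
exact: (measurable_mulmxD (aff_inv s).1 (aff_inv s).2).
Qed.

Lemma lebesgue_aff_image s S : Defs.isometry s -> measurable S ->
  mu (aff_apply s @` S) = mu S.
Proof.
move=> si mS; rewrite aff_image// [RHS](lebesgue_cV_affine (aff_inv s).2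
  (det_aff_inv_neq0 si) mS).
by rewrite det_aff_inv// mul1e.
Qed.

Lemma dil_isometry s (f : 'cV[R]_n.+1 -> R[i]) : Defs.isometry s ->
  dil s f = (fun x => f (aff_apply (aff_inv s) x)).
Proof.
move=> si; apply/funext => x.
by rewrite /dil isometry_det// sqrtr1 invr1 mul1r.
Qed.

Lemma aff_apply_norm_le s v : Defs.isometry s ->
  `|v - s.2| <= n.+1%:R * `|aff_apply (aff_inv s) v|.
Proof.
move=> si; rewrite -{1}(aff_invVK v si) {1}/aff_apply addrK.
exact: isometry_norm_le.
Qed.

End affine_action.

Section ae_partitions.
Context d (T : measurableType d) (R : realType).
Variable mu : {measure set T -> \bar R}.

Lemma ae_seq (I : eqType) (F : seq I) (P : I -> T -> Prop) :
  {in F, forall s, {ae mu, forall x, P s x}} ->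
  {ae mu, forall x, {in F, forall s, P s x}}.
Proof.
elim: F => [|s F IH] FP; first by apply: aeW.
have Ps : {ae mu, forall x, P s x} by apply: FP; rewrite mem_head.
have /IH PF : {in F, forall s, {ae mu, forall x, P s x}}.
  by move=> t tF; apply: FP; rewrite in_cons tF orbT.
apply: filterS2 Ps PF => x Psx PFx t; rewrite in_cons => /orP[/eqP ->//|].
exact: PFx.
Qed.

Lemma Rintegral_sum (I : eqType) (F : seq I) (f : I -> T -> R) :
  {in F, forall s, mu.-integrable setT (EFin \o f s)} ->
  mu.-integrable setT (fun x => (\sum_(s <- F) f s x)%:E) /\
  \int[mu]_x (\sum_(s <- F) f s x) = \sum_(s <- F) \int[mu]_x f s x.
Proof.
elim: F => [|s F IH] Ff.
  split; first by under eq_fun do rewrite big_nil; exact: integrable0.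
  by rewrite big_nil; under eq_Rintegral do rewrite big_nil; rewrite Rintegral_cst// mul0r.
have fs : mu.-integrable setT (EFin \o f s) by apply: Ff; rewrite mem_head.
have [|iF eF] := IH; first by move=> t tF; apply: Ff; rewrite in_cons tF orbT.
split.
  under eq_fun do rewrite big_cons EFinD.
  exact: (integrableD measurableT fs iF).
under eq_Rintegral do rewrite big_cons.
by rewrite RintegralD// eF big_cons.
Qed.

(** Almost every point of the support lies in exactly one piece, and there the
    function is the sum of its restrictions. *)
Lemma Rintegral_ae_partition (I : eqType) (F : seq I) (D : I -> set T)
    (f : T -> R) : uniq F -> (forall s, s \in F -> measurable (D s)) ->
  (forall s t, s \in F -> t \in F -> s != t -> mu (D s `&` D t) = 0%E) ->
  mu.-integrable setT (EFin \o f) ->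
  (forall x, f x != 0 -> exists2 s, s \in F & D s x) ->
  \int[mu]_x f x = \sum_(s <- F) \int[mu]_x (f x * \1_(D s) x).
Proof.
move=> uF mD D0 fi fD.
have mf : measurable_fun setT f by apply/measurable_EFinP; case/integrableP: fi.
have mfD s : s \in F -> measurable_fun setT (fun x => f x * \1_(D s) x).
  by move=> sF; apply: measurable_funM => //; apply: measurable_indic; exact: mD.
have fDi : {in F, forall s, mu.-integrable setT (EFin \o (fun x => f x * \1_(D s) x))}.
  move=> s sF; apply: le_integrable fi => //.
    by apply/measurable_EFinP; exact: mfD.
  move=> x _ /=; rewrite lee_fin normrM ler_piMr// indicE.
  by case: (_ \in _); rewrite ?normr1 ?normr0.
have [si <-] := Rintegral_sum fDi.
rewrite /Rintegral; congr fine; apply: ae_eq_integral => //.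
- by case/integrableP: fi.
- by case/integrableP: si.
have : {ae mu, forall x, {in F, forall s, {in F, forall t, s != t ->
    ~ (D s x /\ D t x)}}}.
  apply: ae_seq => s sF; apply: ae_seq => t tF.
  have [->|st] := eqVneq s t; first by apply: aeW.
  exists (D s `&` D t); split; [|exact: D0|].
  - by apply: measurableI; exact: mD.
  - by move=> x /= /not_implyP[_ /contrapT].
apply: filterS => x Dx _ /=; congr EFin.
have [->|fx0] := eqVneq (f x) 0; first by rewrite big1// => s _; rewrite mul0r.
have [s sF Dsx] := fD x fx0.
rewrite (bigD1_seq s)//= indicE mem_set// mulr1 big1_seq ?addr0// => t /andP[ts tF].
rewrite indicE memNset ?mulr0// => Dtx; apply: (Dx s sF t tF) => //.
by rewrite eq_sym.
Qed.

(** Making the pieces disjoint removes only null sets from them. *)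
Lemma measure_ae_partition (D : nat -> set T) (E : set T) : measurable E ->
  (forall i, measurable (D i)) -> \bigcup_i D i = setT ->
  (forall i j, i != j -> mu (D i `&` D j) = 0%E) ->
  mu E = (\sum_(0 <= i <oo) mu (E `&` D i))%E.
Proof.
move=> mE mD DT D0.
have mS i : measurable (seqDU D i).
  by apply: measurableD => //; exact: bigsetU_measurable.
have -> : mu E = mu (\bigcup_i (E `&` seqDU D i)).
  by rewrite -setI_bigcupr -seqDU_bigcup_eq DT setIT.
rewrite measure_semi_bigcup; last 3 first.
- by move=> i; exact: measurableI.
- by apply: trivIset_setIl; exact: trivIset_seqDU.
- by apply: bigcup_measurable => i _; exact: measurableI.
apply: eq_eseriesr => i _.
pose Z := E `&` D i `&` \big[setU/set0]_(j < i) D j.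
have mU : measurable (\big[setU/set0]_(j < i) D j) by exact: bigsetU_measurable.
have mZ : measurable Z by apply: measurableI => //; exact: measurableI.
have Z0 : mu Z = 0%E.
  apply/negligibleP => //.
  apply: (@negligibleS _ _ _ _ (\bigcup_(j in [set j | (j < i)%N]) (D i `&` D j))).
    by move=> x [[_ Dix]]; rewrite -bigcup_mkord => -[j ji Djx]; exists j.
  rewrite bigcup_mkcond; apply: negligible_bigcup => j; case: ifPn => [ji|_].
    apply/negligibleP; first exact: measurableI.
    by apply: D0; rewrite gt_eqF//; exact: set_mem ji.
  exact: negligible_set0.
have -> : E `&` D i = (E `&` seqDU D i) `|` Z.
  rewrite /Z /seqDU; apply/seteqP; split => x.
    move=> [Ex Dx]; have [Ux|Ux] := pselect ((\big[setU/set0]_(j < i) D j) x).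
      by right.
    by left.
  by move=> [[Ex [Dx _]]|[[Ex Dx] _]].
by rewrite measureU0//; exact: measurableI.
Qed.

End ae_partitions.

Section lattice_domains.
Variables (R : realType) (n : nat).
Let mu := lebesgue_cV R n.+1.
Local Notation T := 'cV[R]_n.+1.

Lemma aff_trans_image (k : T) (S : set T) :
  aff_apply (aff_trans k) @` S = [set x | S (x - k)].
Proof.
apply/seteqP; split => x /=.
  by move=> [y Sy <-]; rewrite /aff_apply /= mul1mx addrK.
by move=> Sx; exists (x - k) => //; rewrite /aff_apply /= mul1mx subrK.
Qed.

Lemma measurable_shift (k : T) S : measurable S ->
  measurable [set x : T | S (x - k)].
Proof.
move=> mS; rewrite (_ : mkset _ = (fun v => 1%:M *m v + - k) @^-1` S).
  by rewrite -[X in measurable X]setTI; exact: measurable_mulmxD.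
by apply/seteqP; split => x /=; rewrite mul1mx.
Qed.

Lemma lebesgue_shift (k : T) S : measurable S ->
  mu [set x | S (x - k)] = mu S.
Proof.
move=> mS; have d1 : \det (1%:M : 'M[R]_n.+1) != 0 by rewrite det1 oner_eq0.
rewrite [RHS](lebesgue_cV_affine (- k) d1 mS) det1 normr1 mul1e.
by congr (mu _); apply/seteqP; split => x /=; rewrite mul1mx.
Qed.

(** The translate of [L] that has number [m], or the empty set if there is
    none: an injection [f] of a countable lattice into the integers turns the
    family of translates into a sequence. *)
Definition lattice_piece (Lambda L : set T) (f : T -> nat) m :=
  \bigcup_(k in [set k | Lambda k /\ f k = m]) [set x | L (x - k)].

Lemma lattice_pieceE (Lambda L : set T) (f : T -> nat) m k :
  {in Lambda &, injective f} -> Lambda k -> f k = m ->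
  lattice_piece Lambda L f m = [set x | L (x - k)].
Proof.
move=> finj Lk fk; apply/seteqP; split => x /=; last by move=> Lx; exists k.
move=> [k' [/= Lk' fk'] Lx]; rewrite (finj k k') ?inE//.
by rewrite fk fk'.
Qed.

Lemma lattice_piece0 (Lambda L : set T) (f : T -> nat) m :
  ~ (exists2 k, Lambda k & f k = m) -> lattice_piece Lambda L f m = set0.
Proof.
move=> nk; apply/seteqP; split => x //= -[k [/= Lk fk] _].
by apply: nk; exists k.
Qed.

Lemma lattice_pieces (Lambda L : set T) (f : T -> nat) :
  {in Lambda &, injective f} ->
  fundamental_domain [set aff_trans v | v in Lambda] L ->
  [/\ forall m, measurable (lattice_piece Lambda L f m),
      \bigcup_m lattice_piece Lambda L f m = setT &
      forall i j, i != j ->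
        mu (lattice_piece Lambda L f i `&` lattice_piece Lambda L f j) = 0%E].
Proof.
move=> finj [mL covL dL]; split.
- move=> m; have [[k Lk fk]|nk] := pselect (exists2 k, Lambda k & f k = m).
    by rewrite (lattice_pieceE L finj Lk fk); exact: measurable_shift.
  by rewrite lattice_piece0.
- apply/seteqP; split => x // _.
  have : (\bigcup_(s in [set aff_trans v | v in Lambda]) (aff_apply s @` L)) x.
    by rewrite covL.
  by move=> [_ [k Lk <-]]; rewrite aff_trans_image /= => Lx; exists (f k) => //; exists k.
- move=> i j ij.
  have [[k Lk fk]|nk] := pselect (exists2 k, Lambda k & f k = i); last first.
    by rewrite lattice_piece0// set0I measure0.
  have [[l Ll fl]|nl] := pselect (exists2 k, Lambda k & f k = j); last first.
    by rewrite [lattice_piece _ _ _ j]lattice_piece0// setI0 measure0.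
  rewrite (lattice_pieceE L finj Lk fk) (lattice_pieceE L finj Ll fl).
  rewrite -!aff_trans_image; apply: dL; [by exists k|by exists l|].
  by move=> /(congr1 snd) /= kl; move: ij; rewrite -fk -fl kl eqxx.
Qed.

(** Cutting [L1] along the translates of [L2], and moving the pieces back,
    gives [L2] cut along the translates of [L1]. *)
Lemma fundamental_domain_volume (Lambda L1 L2 : set T) :
  countable Lambda -> (forall k, Lambda k -> Lambda (- k)) ->
  fundamental_domain [set aff_trans v | v in Lambda] L1 ->
  fundamental_domain [set aff_trans v | v in Lambda] L2 ->
  mu L1 = mu L2.
Proof.
move=> /countable_injP[f finj] LN fd1 fd2.
(* numbering the translates of [L1] by [- k] matches the piece of [L1] in
   [L2 + k] with the piece of [L2] in [L1 - k] *)
pose f' k := f (- k).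
have f'inj : {in Lambda &, injective f'}.
  move=> k l /set_mem Lk /set_mem Ll /finj H; apply: oppr_inj.
  by apply: H; apply/mem_set; exact: LN.
have [mD cD dD] := lattice_pieces finj fd2.
have [mE cE dE] := lattice_pieces f'inj fd1.
have [mL1 _ _] := fd1; have [mL2 _ _] := fd2.
rewrite (measure_ae_partition mL1 mD cD dD) (measure_ae_partition mL2 mE cE dE).
apply: eq_eseriesr => m _.
have [[k Lk fk]|nk] := pselect (exists2 k, Lambda k & f k = m); last first.
  rewrite lattice_piece0// setI0 measure0 lattice_piece0 ?setI0 ?measure0//.
  by move=> [k Lk fk]; apply: nk; exists (- k) => //; exact: LN.
rewrite (lattice_pieceE L2 finj Lk fk) (@lattice_pieceE _ L1 f' m (- k))//; last 2 first.
- exact: LN.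
- by rewrite /f' opprK.
transitivity (mu [set x | (L1 `&` [set x | L2 (x - k)]) (x - - k)]).
  by rewrite lebesgue_shift//; apply: measurableI => //; exact: measurable_shift.
by congr (mu _); apply/seteqP; split => x /=; rewrite opprK addrK => -[].
Qed.

End lattice_domains.

(** * Crystal groups *)

Section cubes.
Variables (R : realType) (n : nat).
Let mu := lebesgue_cV R n.
Local Notation T := 'cV[R]_n.

Definition cube (C : R) : set T := [set x | `|x| <= C].

Lemma cube_rectangle C : 0 <= C -> cube C = rectangle (fun=> `[- C, C]%classic).
Proof.
move=> C0; apply/seteqP; split => x /=.
  by move=> /(mx_norm_le x C0) xC i; rewrite /= in_itv/= -ler_norml.
by move=> xC; apply/(mx_norm_le x C0) => i; rewrite ler_norml; exact: xC.
Qed.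

Lemma measurable_cube C : measurable (cube C).
Proof.
have [C0|C0] := leP 0 C.
  by rewrite cube_rectangle//; apply: measurable_rectangle => i; exact: measurable_itv.
rewrite (_ : cube C = set0)//; apply/seteqP; split => x //= xC.
by have := le_lt_trans xC C0; rewrite ltNge normr_ge0.
Qed.

Lemma lebesgue_cube C : 0 <= C -> mu (cube C) = ((2 * C) ^+ n)%:E.
Proof.
move=> C0; rewrite cube_rectangle// [LHS]lebesgue_cV_box; last first.
  by move=> i; exact: measurable_itv.
rewrite (eq_bigr (fun=> (2 * C)%:E)); last first.
  move=> i _; rewrite lebesgue_measure_itv/= lte_fin.
  case: ltP => [_|CC]; first by rewrite -EFinD; congr EFin; ring.
  have C00 : C = 0 by lra.
  by rewrite C00 mulr0.
by rewrite prodEFin prodr_const card_ord.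
Qed.

Lemma lebesgue_bounded_fin (S : set T) C : measurable S ->
  (forall x, S x -> `|x| <= C) -> mu S \is a fin_num.
Proof.
move=> mS SC; rewrite ge0_fin_numE ?measure_ge0//.
have [C0|C0] := leP 0 C; last first.
  rewrite (_ : S = set0) ?measure0//; apply/seteqP; split => x //= /SC xC.
  by have := le_lt_trans xC C0; rewrite ltNge normr_ge0.
apply: (@le_lt_trans _ _ (mu (cube C))); last first.
  by rewrite [X in (X < _)%E]lebesgue_cube// ltry.
exact: (le_measure _ (mem_set mS) (mem_set (measurable_cube C)) SC).
Qed.

Lemma integrable_indic_fin (S : set T) : measurable S -> mu S \is a fin_num ->
  mu.-integrable setT (EFin \o (\1_S : T -> R)).
Proof.
move=> mS Sfin; apply/integrableP; split.
  by apply/measurable_EFinP; exact: measurable_indic.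
rewrite (eq_integral (fun x => (\1_S x)%:E)); last first.
  by move=> x _; rewrite /= ger0_norm.
by rewrite integral_indic// setIT -ge0_fin_numE.
Qed.

Lemma Rintegral_indic (S : set T) : measurable S ->
  \int[mu]_x (\1_S x : R) = fine (mu S).
Proof. by move=> mS; rewrite /Rintegral integral_indic// setIT. Qed.

End cubes.

Section crystal_groups.
Variables (R : realType) (n : nat) (Gamma : set (affine R n.+1))
  (G : set 'M[R]_n.+1) (Lambda : set 'cV[R]_n.+1).
Let mu := lebesgue_cV R n.+1.
Local Notation T := 'cV[R]_n.+1.
Hypothesis hGamma : crystal_triple Gamma G Lambda.
Hypothesis hsplit : splitting Gamma G Lambda.
Hypothesis finG : finite_set G.
Implicit Types (s t : affine R n.+1) (v k : T).

Lemma Gamma_isometry s : Gamma s -> Defs.isometry s.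
Proof. by move=> Gs; case: hGamma => -[[iso _ _ _] _ _] _ _; exact: iso. Qed.

Lemma Gamma_id : Gamma (aff_id R n.+1).
Proof. by case: hGamma => -[[_ + _ _] _ _] _ _. Qed.

Lemma Gamma_comp s t : Gamma s -> Gamma t -> Gamma (aff_comp s t).
Proof. by case: hGamma => -[[_ _ + _] _ _] _ _; apply. Qed.

Lemma Gamma_inv s : Gamma s -> Gamma (aff_inv s).
Proof. by case: hGamma => -[[_ _ _ +] _ _] _ _; apply. Qed.

Lemma LambdaE : Lambda = [set v | Gamma (aff_trans v)].
Proof. by case: hGamma. Qed.

Lemma G_E : G = [set s.1 | s in Gamma]. Proof. by case: hGamma. Qed.

Lemma Gamma_lin g : G g -> Gamma (aff_lin g).
Proof.
move=> Gg; rewrite hsplit; exists g => //; exists 0; last by rewrite /aff_lin mulmx0.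
by rewrite LambdaE; exact: Gamma_id.
Qed.

Lemma G_unit g : G g -> g \in unitmx.
Proof. by move=> /Gamma_lin/Gamma_isometry/isometry_unit. Qed.

(** Since the point group preserves the lattice, the group is the full product
    of its linear and translation parts. *)
Lemma GammaP s : Gamma s <-> G s.1 /\ Lambda s.2.
Proof.
split=> [Gs|[Gs Ls]].
  have Gg : G s.1 by rewrite G_E; exists s.
  split=> //; rewrite LambdaE /=.
  have := Gamma_comp Gs (Gamma_inv (Gamma_lin Gg)).
  rewrite /aff_comp /aff_inv /aff_lin /= !mulmx0 oppr0 mulmx0 add0r.
  by rewrite mulmxV ?G_unit.
have : Gamma (aff_trans s.2) by move: Ls; rewrite LambdaE.
move=> /Gamma_comp/(_ (Gamma_lin Gs)).
by rewrite /aff_comp /aff_lin /= mul1mx mulmx0 add0r -surjective_pairing.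
Qed.

Lemma LambdaB u v : Lambda u -> Lambda v -> Lambda (u - v).
Proof.
rewrite LambdaE /= => Gu Gv; have := Gamma_comp Gu (Gamma_inv Gv).
rewrite /aff_comp /aff_inv /aff_trans /= mul1mx.
by rewrite invmx1 mul1mx mul1mx addrC.
Qed.

Lemma Lambda0 : Lambda 0.
Proof. by rewrite LambdaE; exact: Gamma_id. Qed.

Lemma LambdaN v : Lambda v -> Lambda (- v).
Proof. by move=> Lv; rewrite -sub0r; apply: LambdaB => //; exact: Lambda0. Qed.

(** Isolation of the identity in the group bounds the lattice vectors from
    below. *)
Lemma Lambda_discrete : exists2 eps : R, 0 < eps &
  forall v, Lambda v -> `|v| < eps -> v = 0.
Proof.
case: hGamma => -[_ iso _] _ _; have [_ [V Vid VG]] := iso _ Gamma_id.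
have /nbhs_ballP[eps /= e0 eV] := Vid; exists eps => // v Lv ve.
have : (V `&` Gamma) (aff_trans v).
  split; last by move: Lv; rewrite LambdaE.
  apply: eV; split => /=; first exact: ballxx.
  by rewrite mx_norm_ball /ball_ /= sub0r normrN.
by rewrite VG => -[].
Qed.

Lemma Lambda_finite rho : finite_set [set v | Lambda v /\ `|v| <= rho].
Proof.
have [eps e0 Le] := Lambda_discrete.
by apply: discrete_subgroup_locally_finite e0 _ Le => u v; exact: LambdaB.
Qed.

Lemma Gamma_finite rho : finite_set [set s | Gamma s /\ `|s.2| <= rho].
Proof.
apply: (@sub_finite_set _ _ (G `*` [set v | Lambda v /\ `|v| <= rho])).
  by move=> s [/GammaP[Gs Ls] sr].
by apply: finite_setX => //; exact: Lambda_finite.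
Qed.

Lemma Lambda_countable : countable Lambda.
Proof.
rewrite (_ : Lambda = \bigcup_N [set v | Lambda v /\ `|v| <= N%:R]).
  by apply: bigcup_countable => // N _; apply: finite_set_countable; exact: Lambda_finite.
apply/seteqP; split => v; last by move=> [N _ []].
move=> Lv; exists (Num.bound `|v|) => //; split=> //.
exact: ltW (archi_boundP (normr_ge0 _)).
Qed.

Lemma bounded_fundamental_domain : exists (P : set T) (rho : R),
  [/\ 0 < rho, forall x, P x -> `|x| <= rho & fundamental_domain Gamma P].
Proof.
case: hGamma => -[_ _ [P cP fP]] _ _.
have [M [_ PM]] := compact_bounded cP.
exists P, (`|M| + 1); split=> //.
move=> x Px; apply: (PM (`|M| + 1)) => //.
by rewrite (le_lt_trans (ler_norm _))// ltrDl.
Qed.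

(** Discreteness makes these sets finite; they index the finite sums that
    replace sums over the group. *)
Definition Gamma_ball (rho : R) : {fset affine R n.+1} :=
  fset_set [set s | Gamma s /\ `|s.2| <= rho].

Lemma Gamma_ballP rho s : s \in Gamma_ball rho <-> Gamma s /\ `|s.2| <= rho.
Proof.
rewrite /Gamma_ball in_fset_set; last exact: Gamma_finite.
by rewrite inE.
Qed.

Section bounded_domain.
Variables (P : set T) (rho : R).
Hypotheses (rho0 : 0 < rho) (Prho : forall x, P x -> `|x| <= rho).
Hypothesis fdP : fundamental_domain Gamma P.

Let mP : measurable P. Proof. by case: fdP. Qed.

Lemma tile_near s y : Gamma s -> (aff_apply s @` P) y ->
  `|y - s.2| <= n.+1%:R * rho.
Proof.
move=> /Gamma_isometry si [x Px <-]; rewrite /aff_apply addrK.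
apply: le_trans (isometry_norm_le x si) _.
by apply: ler_wpM2l => //; exact: Prho.
Qed.

Lemma tile_cover y : exists s, Gamma s /\ (aff_apply s @` P) y.
Proof.
have [_ cov _] := fdP; have : setT y by [].
by rewrite -cov => -[s Gs Py]; exists s.
Qed.

Lemma domain_fin_num : mu P \is a fin_num.
Proof. exact: lebesgue_bounded_fin Prho. Qed.

(** Finitely many tiles cover the unit cube, and all have the volume of [P]. *)
Lemma domain_volume_gt0 : 0 < fine (mu P).
Proof.
rewrite lt_neqAle fine_ge0 ?measure_ge0// andbT; apply/negP => /eqP P0.
have muP0 : mu P = 0%E by rewrite -(fineK domain_fin_num) -P0.
pose F := Gamma_ball (1 + n.+1%:R * rho).
suff : mu (cube 1) = 0%E.
  rewrite lebesgue_cube// => -[] /eqP; rewrite expf_eq0 mulr1 /=.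
  by rewrite pnatr_eq0.
apply/negligibleP; first exact: measurable_cube.
apply: (@negligibleS _ _ _ _ (\bigcup_(s in [set` F]) (aff_apply s @` P))).
  move=> y /= y1; have [s [Gs Py]] := tile_cover y; exists s => //=.
  apply/Gamma_ballP; split=> //; rewrite -[s.2](subKr y).
  apply: (le_trans (ler_normB _ _)); apply: lerD => //; exact: tile_near.
rewrite bigcup_fset big_seq; elim/big_rec: _ => [|s U sF U0].
  exact: negligible_set0.
apply: negligibleU => //.
have /Gamma_ballP[/Gamma_isometry si _] := sF.
apply/negligibleP; first exact: measurable_aff_image.
exact: etrans (lebesgue_aff_image si mP) muP0.
Qed.

Lemma Rintegral_tiles (F : {fset affine R n.+1}) (f : T -> R) :
  {in F, forall s, Gamma s} -> mu.-integrable setT (EFin \o f) ->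
  (forall x, f x != 0 -> exists2 s, s \in F & (aff_apply s @` P) x) ->
  \int[mu]_x f x = \sum_(s <- F) \int[mu]_x (f x * \1_(aff_apply s @` P) x).
Proof.
move=> FG fi fF; apply: Rintegral_ae_partition => //.
- by move=> s /FG/Gamma_isometry si; exact: measurable_aff_image.
- move=> s t sF tF st; have [_ _ dP] := fdP; apply: dP; [exact: FG|exact: FG|].
  exact/eqP.
Qed.

Lemma measurable_tiles (F : {fset affine R n.+1}) : {in F, forall s, Gamma s} ->
  measurable (\bigcup_(s in [set` F]) (aff_apply s @` P)).
Proof.
move=> FG; apply: fin_bigcup_measurable => // s sF.
exact: measurable_aff_image (Gamma_isometry (FG _ sF)) mP.
Qed.

Lemma bounded_tiles (F : {fset affine R n.+1}) : {in F, forall s, Gamma s} ->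
  exists C, forall x, (\bigcup_(s in [set` F]) (aff_apply s @` P)) x -> `|x| <= C.
Proof.
move=> FG; exists (\sum_(s <- F) `|s.2| + n.+1%:R * rho) => x [s sF Px].
rewrite -[x](subrK s.2) addrC; apply: (le_trans (ler_normD _ _)).
apply: lerD; last exact: tile_near (FG _ sF) Px.
by rewrite (big_fsetD1 s)//= lerDl sumr_ge0.
Qed.

Lemma lebesgue_tiles (F : {fset affine R n.+1}) : {in F, forall s, Gamma s} ->
  mu (\bigcup_(s in [set` F]) (aff_apply s @` P)) =
  (#|` F|%:R * fine (mu P))%:E.
Proof.
move=> FG; set U := \bigcup_(s in _) _.
have mU : measurable U by exact: measurable_tiles.
have [C UC] := bounded_tiles FG; have Ufin := lebesgue_bounded_fin mU UC.
rewrite -(fineK Ufin); congr EFin; rewrite -Rintegral_indic//.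
rewrite (Rintegral_tiles FG (integrable_indic_fin mU Ufin)); last first.
  move=> x; rewrite indicE; case: (boolP (x \in U)); last by rewrite eqxx.
  by move=> /set_mem[s sF Px] _; exists s.
rewrite (eq_big_seq (fun=> fine (mu P))); last first.
  move=> s sF; have si := Gamma_isometry (FG _ sF).
  rewrite -[in RHS](lebesgue_aff_image si mP) -Rintegral_indic//; last first.
    exact: measurable_aff_image.
  apply: eq_Rintegral => x _; rewrite !indicE.
  case: (boolP (x \in aff_apply s @` P)) => [/set_mem Px|]; last by rewrite mulr0.
  by rewrite mem_set ?mulr1//; exists s.
by rewrite big_const_seq count_predT iter_addr_0 mulr_natl.
Qed.

(** The tiles [g P], for [g] in the point group, make up a fundamental domain of
    the lattice, and any other has the same volume. *)
Lemma lattice_domain_volume (r : nat) (L : set T) : (G #= `I_r)%card ->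
  fundamental_domain [set aff_trans v | v in Lambda] L ->
  mu L = (r%:R * fine (mu P))%:E.
Proof.
move=> Gr fdL.
have lin_in s : s \in [fset aff_lin g | g in fset_set G]%fset -> Gamma s.
  by move=> /imfsetP[g /=]; rewrite in_fset_set// inE => Gg ->; exact: Gamma_lin.
have linG g : G g -> aff_lin g \in [fset aff_lin g | g in fset_set G]%fset.
  by move=> Gg; apply: in_imfset; rewrite /= in_fset_set// inE.
set F := [fset aff_lin g | g in fset_set G]%fset in lin_in linG.
pose L0 : set T := \bigcup_(s in [set` F]) (aff_apply s @` P).
have mtile s : Gamma s -> measurable (aff_apply s @` P).
  by move=> /Gamma_isometry si; exact: measurable_aff_image.
have mL0 : measurable L0 by exact: measurable_tiles.
have compE k g v : aff_apply (aff_trans k) (aff_apply (aff_lin g) v) =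
    aff_apply (g, k) v.
  by rewrite -aff_comp_apply /aff_comp /= mul1mx mulmx0 add0r.
have fdL0 : fundamental_domain [set aff_trans v | v in Lambda] L0.
  split=> //.
    apply/seteqP; split => x // _; have [s [Gs [v Pv vx]]] := tile_cover x.
    have [Gg Lk] := (GammaP s).1 Gs.
    exists (aff_trans s.2); first by exists s.2.
    exists (aff_apply (aff_lin s.1) v); first by exists (aff_lin s.1); [exact: linG|exists v].
    by rewrite compE -surjective_pairing.
  move=> _ _ [k Lk <-] [l Ll <-] kl.
  have shE k' : aff_apply (aff_trans k') @` L0 =
      \bigcup_(s in [set` F]) (aff_apply (s.1, k') @` P).
    apply/seteqP; split => x.
      move=> [_ [s sF [v Pv <-]] <-]; exists s => //; exists v => //.
      by case/imfsetP: sF => g _ ->; rewrite compE.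
    move=> [s sF [v Pv <-]]; exists (aff_apply s v); first by exists s => //; exists v.
    by case/imfsetP: sF => g _ ->; rewrite compE.
  rewrite !shE setI_bigcupl.
  have mk s k' : Lambda k' -> s \in F -> Gamma (s.1, k').
    by move=> Lk' sF; apply/GammaP; split=> //=; exact: ((GammaP s).1 (lin_in _ sF)).1.
  have [_ _ dP] := fdP.
  apply/negligibleP.
    apply: fin_bigcup_measurable => // s sF; apply: measurableI.
      by apply: mtile; exact: mk.
    by apply: fin_bigcup_measurable => // t tF; apply: mtile; exact: mk.
  rewrite bigcup_fset big_seq; elim/big_rec: _ => [|s U sF U0]; first exact: negligible_set0.
  apply: negligibleU => //; rewrite setI_bigcupr bigcup_fset big_seq.
  elim/big_rec: _ => [|t W tF W0]; first exact: negligible_set0.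
  apply: negligibleU => //; apply/negligibleP.
    by apply: measurableI; apply: mtile; exact: mk.
  apply: dP; [exact: mk|exact: mk|].
  by move=> [_ kl']; apply: kl; rewrite kl'.
rewrite (fundamental_domain_volume Lambda_countable LambdaN fdL fdL0).
rewrite lebesgue_tiles//; congr (_%:R * _)%:E.
rewrite card_imfset/=; last by move=> g h [].
exact: card_fset_set.
Qed.

End bounded_domain.
End crystal_groups.

(** * Dilations and truncations *)

Section pull.
Variables (R : realType) (n : nat).
Let mu := lebesgue_cV R n.+1.
Local Notation T := 'cV[R]_n.+1.
Local Notation L2 := (@Defs.L2 R n.+1).
Implicit Types (A B : 'M[R]_n.+1) (f g : T -> R[i]).

Definition pull A f : T -> R[i] := fun x => f (A *m x).

Let pullE A f : pull A f = fun x => f (A *m x + 0).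
Proof. by apply/funext => x; rewrite addr0. Qed.

Lemma pullM A B f : pull A (pull B f) = pull (B *m A) f.
Proof. by apply/funext => x; rewrite /pull mulmxA. Qed.

Lemma pull1 f : pull 1%:M f = f.
Proof. by apply/funext => x; rewrite /pull mul1mx. Qed.

Lemma L2_pull A f : \det A != 0 -> L2 f -> L2 (pull A f).
Proof. by move=> dA f2; rewrite pullE; exact: L2_affine. Qed.

Lemma sqnorm_pull A f : \det A != 0 -> L2 f ->
  sqnorm f = `|\det A| * sqnorm (pull A f).
Proof. by move=> dA f2; rewrite pullE -sqnorm_affine. Qed.

Lemma ae_pull A (P : T -> Prop) : \det A != 0 ->
  {ae mu, forall x, P x} -> {ae mu, forall x, P (A *m x)}.
Proof. by move=> dA /(ae_affine 0 dA); apply: filterS => x; rewrite addr0. Qed.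

Lemma closed_span_ae (E : set (T -> R[i])) f g : E `<=` L2 -> L2 f ->
  {ae mu, forall x, f x = g x} -> closed_span E g -> closed_span E f.
Proof.
move=> E2 f2 fg Eg; have g2 : L2 g by case: Eg.
apply: closed_span_closed => // eps e0; exists g => //.
rewrite ((sqnorm_eq0 (L2B f2 g2)).2 _)//.
by apply: filterS fg => x fgx; rewrite !fctE fgx subrr.
Qed.

Lemma cintegral_ae0 f : cintegrable f -> {ae mu, forall x, f x = 0} ->
  cintegral f = 0.
Proof.
move=> fi f0; apply: Normc.eq0_normc; apply/eqP; rewrite eq_le normc_ge0 andbT.
apply: le_trans (le_normc_cintegral fi) _.
rewrite /Rintegral (ae_eq_integral (cst 0%E))//=; first by rewrite integral0.
  by case: fi => _ /integrableP[].
by apply: filterS f0 => x -> _; rewrite Normc.normc0.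
Qed.

Lemma cmeasurable_indic (S : set T) : measurable S ->
  cmeasurable (fun x => (\1_S x)%:C%C).
Proof. by move=> mS; split => /=; [exact: measurable_indic|exact: measurable_cst]. Qed.

Definition trunc (S : set T) f : T -> R[i] := fun x => (\1_S x)%:C%C * f x.

Lemma truncE S f x : trunc S f x = if x \in S then f x else 0.
Proof.
by rewrite /trunc indicE; case: (x \in S); rewrite ?mul1r// mul0r.
Qed.

Lemma L2_trunc S f : measurable S -> L2 f -> L2 (trunc S f).
Proof.
move=> mS /L2P[mf fi]; apply: (@L2_le _ _ _ (fun x => Normc.normc (f x) ^+ 2)) => //.
  by apply: cmeasurableM => //; exact: cmeasurable_indic.
move=> x; rewrite truncE; case: ifP => // _.
by rewrite Normc.normc0 expr0n sqr_ge0.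
Qed.

(** This is dominated convergence for the squared moduli. *)
Lemma vanishes_sqnorm (F : nat -> T -> R[i]) (g : T -> R) :
  (forall k, cmeasurable (F k)) -> mu.-integrable setT (EFin \o g) ->
  (forall k x, Normc.normc (F k x) ^+ 2 <= g x) ->
  {ae mu, forall x, (fun k => Normc.normc (F k x) ^+ 2) @ \oo --> (0 : R)} ->
  vanishes (fun k => sqnorm (F k)).
Proof.
move=> mF ig Fg F0 eps e0.
have F2 k : L2 (F k) by apply: L2_le ig _.
have [|||||_ _ cvg] := @dominated_convergence _ _ _ mu setT measurableT
  (fun k x => (Normc.normc (F k x) ^+ 2)%:E) (cst 0%E) (EFin \o g).
- by move=> k; apply/measurable_EFinP; exact: cmeasurable_normc2.
- exact: measurable_cst.
- by apply: filterS F0 => x cv _; apply/fine_cvgP; split; [exact: nearW|].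
- exact: ig.
- by apply: aeW => x k _; rewrite /= lee_fin ger0_norm ?sqr_ge0.
move: cvg; rewrite integral0.
have -> : (fun k => \int[mu]_x (Normc.normc (F k x) ^+ 2)%:E)%E =
    fun k => (sqnorm (F k))%:E.
  by apply/funext => k; rewrite -L2_sqnormE.
move=> /fine_cvgP[_ /cvgr0Pnorm_le/(_ _ e0)[K _ H]]; exists K => k /H /=.
by apply: le_trans; exact: ler_norm.
Qed.

(** The truncations are dominated by [f] and eventually vanish at almost every
    point. *)
Lemma vanishes_trunc (S : nat -> set T) f : (forall k, measurable (S k)) ->
  L2 f -> {ae mu, forall x, exists K, forall k, (K <= k)%N -> ~ S k x} ->
  vanishes (fun k => sqnorm (trunc (S k) f)).
Proof.
move=> mS f2 S0; have [mf fi] := (L2P f).1 f2.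
apply: vanishes_sqnorm fi _ _.
- by move=> k; exact/L2_cmeasurable/L2_trunc.
- move=> k x; rewrite truncE; case: ifP => // _.
  by rewrite Normc.normc0 expr0n sqr_ge0.
- apply: filterS S0 => x [K SK]; apply: cvg_near_cst.
  exists K => // k /= /SK nS; rewrite truncE memNset//.
  by rewrite Normc.normc0 expr0n.
Qed.

Lemma lebesgue_point (x : T) : mu [set x] = 0%E.
Proof.
have mx : measurable [set x].
  rewrite (_ : [set x] = rectangle (fun i => [set x i ord0])).
    by apply: measurable_rectangle => i; exact: measurable_set1.
  apply/seteqP; split => y /=; first by move=> ->.
  by move=> xy; apply/matrixP => i j; rewrite ord1; exact: xy.
rewrite (_ : [set x] = rectangle (fun i => [set x i ord0])) in mx *.
  rewrite [LHS]lebesgue_cV_box; last by move=> i; exact: measurable_set1.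
  by rewrite big_ord_recl lebesgue_measure_set1 mul0e.
apply/seteqP; split => y /=; first by move=> ->.
by move=> xy; apply/matrixP => i j; rewrite ord1; exact: xy.
Qed.

End pull.

Lemma vanishes_sum (R : realType) (I : eqType) (F : seq I) (t : I -> nat -> R) :
  {in F, forall i, vanishes (t i)} -> vanishes (fun k => \sum_(i <- F) t i k).
Proof.
elim: F => [|i F IH] t0 eps e0; first by exists 0%N => k _; rewrite big_nil ltW.
have e2 : 0 < eps / 2 by rewrite divr_gt0.
have [K1 H1] := t0 i (mem_head _ _) _ e2.
have [|K2 H2] := IH _ _ e2; first by move=> j jF; apply: t0; rewrite in_cons jF orbT.
exists (maxn K1 K2) => k; rewrite geq_max big_cons => /andP[/H1 h1 /H2 h2].
lra.
Qed.

(** * Refinability *)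

Section multiresolution.
Variables (R : realType) (n : nat) (Gamma : set (affine R n.+1))
  (G : set 'M[R]_n.+1) (Lambda : set 'cV[R]_n.+1)
  (a : 'M[R]_n.+1) (phi : 'cV[R]_n.+1 -> R[i]).
Let mu := lebesgue_cV R n.+1.
Local Notation T := 'cV[R]_n.+1.
Local Notation L2 := (@Defs.L2 R n.+1).
Local Notation normc := (@Normc.normc R).
Hypothesis hGamma : crystal_triple Gamma G Lambda.
Hypothesis hsplit : splitting Gamma G Lambda.
Hypothesis finG : finite_set G.
Hypothesis ha : admissible Gamma a.
Hypothesis hphi : L2 phi.
Hypothesis hsupp : compactly_supported phi.
Hypothesis horth : orthonormal_on Gamma (fun s => dil s phi).
Implicit Types (s t : affine R n.+1) (x v : T) (f g h : T -> R[i]).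

Local Notation e := (fun s => dil s phi).
Local Notation V := (V0 Gamma phi).

Lemma det_neq0 : \det a != 0. Proof. exact: (expanding_det ha.1). Qed.

Lemma a_unit : a \is a GRing.unit. Proof. exact: (expanding_unit ha.1). Qed.

Lemma det_expz_neq0 (j : int) : \det (a ^ j) != 0.
Proof. by rewrite -unitfE -[_ \is a _]/(a ^ j \is a GRing.unit) unitrXz// a_unit. Qed.

Lemma expzK (j : int) : a ^ j *m a ^ (- j) = 1%:M.
Proof. by rewrite -[_ *m _]/(a ^ j * a ^ (- j)) -exprzDr ?a_unit// subrr expr0z. Qed.

Lemma expzVK (j : int) : a ^ (- j) *m a ^ j = 1%:M.
Proof. by have := expzK (- j); rewrite opprK. Qed.

Lemma dilE s : Gamma s -> e s = (fun x => phi (aff_apply (aff_inv s) x)).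
Proof. by move=> /(Gamma_isometry hGamma); exact: dil_isometry. Qed.

Lemma L2_dil s : Gamma s -> L2 (e s).
Proof.
move=> Gs; have si := Gamma_isometry hGamma Gs; rewrite dilE//.
exact: (L2_affine (aff_inv s).2 (det_aff_inv_neq0 si)).
Qed.

Lemma generators_L2 : [set dil s phi | s in Gamma] `<=` L2.
Proof. by move=> _ [s Gs <-]; exact: L2_dil. Qed.

Lemma sqnorm_dil s : Gamma s -> sqnorm (e s) = 1.
Proof.
move=> Gs; apply: complexI; rewrite -inner_self; last exact: L2_dil.
by rewrite horth// eqxx.
Qed.

Lemma phi_support : exists2 kappa : R, 0 < kappa &
  {ae mu, forall x, kappa < `|x| -> phi x = 0}.
Proof.
have [K cK phiK] := hsupp; have [M [_ KM]] := compact_bounded cK.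
exists (`|M| + 1) => //; apply: filterS phiK => x phiK xM; apply: phiK => Kx.
have : `|x| <= `|M| + 1.
  apply: (KM (`|M| + 1)) => //.
  by rewrite (le_lt_trans (ler_norm _))// ltrDl.
by rewrite leNgt xM.
Qed.

(** The translate [dil s phi] is supported near the point [s.2], at a distance
    that does not depend on [s]. *)
Lemma inner_far : exists2 kappa : R, 0 < kappa &
  forall (C : R) f s, L2 f -> {ae mu, forall x, C < `|x| -> f x = 0} ->
    Gamma s -> C + kappa < `|s.2| -> inner f (e s) = 0.
Proof.
have [kappa k0 phik] := phi_support.
exists (n.+1%:R * kappa); first by rewrite mulr_gt0.
move=> C f s f2 fC Gs sC; have si := Gamma_isometry hGamma Gs.
apply: cintegral_ae0; first by apply: cintegrable_inner => //; exact: L2_dil.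
have := ae_affine (aff_inv s).2 (det_aff_inv_neq0 si) phik.
apply: filterS2 fC => x fx phix.
have [xC|xC] := leP `|x| C; last by rewrite fx// mul0r.
rewrite dilE// phix ?conjc0 ?mulr0//.
have n0 : 0 < n.+1%:R :> R by [].
rewrite -(ltr_pM2l n0); apply: lt_le_trans (aff_apply_norm_le x si).
have := ler_normB x (x - s.2); rewrite subKr; lra.
Qed.

Lemma V_L2 f : V f -> L2 f. Proof. by case. Qed.

Lemma VZ c f : V f -> V (cst c * f).
Proof. by apply: closed_spanZ; exact: generators_L2. Qed.

Lemma V_ae f g : L2 f -> {ae mu, forall x, f x = g x} -> V g -> V f.
Proof. by move=> f2 fg; apply: closed_span_ae => //; exact: generators_L2. Qed.

Lemma V_dil s : Gamma s -> V (e s).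
Proof.
move=> Gs; apply: cspan_closed_span; first exact: generators_L2.
by apply: cspan_sub; exists s.
Qed.

Lemma Vj_pull j f : Vj Gamma a phi j f <-> V (pull (a ^ (- j)) f).
Proof.
split=> [[g Vg <-]|Vf].
  by rewrite -[X in pull _ X]/(pull (a ^ j) g) pullM expzK pull1.
exists (pull (a ^ (- j)) f) => //.
by rewrite -[LHS]/(pull (a ^ j) _) pullM expzVK pull1.
Qed.

Lemma Vj_succ j : Vj Gamma a phi (j + 1) = dil (aff_lin a) @^-1` Vj Gamma a phi j.
Proof.
pose c : R[i] := real_complex R (Num.sqrt `|\det a|)^-1.
have c0 : c != 0.
  rewrite /c fmorph_eq0 invr_eq0 sqrtr_eq0 -ltNge normr_gt0; exact: det_neq0.
have dilE f : dil (aff_lin a) f = cst c * pull (invmx a) f.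
  apply/funext => x; rewrite /dil /pull /aff_apply /= mulmx0 oppr0 addr0.
  by [].
have pE f : pull (a ^ (- j)) (pull (invmx a) f) = pull (a ^ (- (j + 1))) f.
  by rewrite pullM opprD addrC exprzDr ?a_unit// -exprN1.
have pZ A (d : R[i]) f : pull A (cst d * f) = cst d * pull A f by [].
apply/seteqP; split => f /=; rewrite !Vj_pull dilE pZ pE; first exact: VZ.
move=> /(VZ c^-1); rewrite mulrA; congr V; apply/funext => x.
by rewrite !fctE mulVf// mul1r.
Qed.

Lemma V_basis : orthonormal_basis Gamma e V.
Proof. by apply: orthonormal_basis_closed_span => //; exact: L2_dil. Qed.

Lemma Gamma_conj s : Gamma s ->
  Gamma (aff_comp (aff_comp (aff_lin a) s) (aff_inv (aff_lin a))).
Proof. by move=> Gs; apply: ha.2; exists s. Qed.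

(** By [inner_far] only finitely many Fourier coefficients of [f] are nonzero.
    What remains after subtracting their sum is in [V] and orthogonal to [V],
    hence null. *)
Lemma V_finite f C : V f -> {ae mu, forall x, C < `|x| -> f x = 0} ->
  exists T0 : {fset affine R n.+1}, [set` T0] `<=` Gamma /\
    {ae mu, forall x, f x = \sum_(s <- T0) inner f (e s) * e s x}.
Proof.
move=> Vf fC; have f2 := V_L2 Vf; have [kappa k0 far] := inner_far.
pose F := Gamma_ball Gamma (C + kappa); exists F.
have FG : {in F, forall s, Gamma s}.
  by move=> s /(Gamma_ballP hGamma hsplit finG)[].
have uF : uniq F by exact: fset_uniq.
split; first by move=> s /= /FG.
have p2 : L2 (proj e F f) by apply: L2_proj FG; exact: L2_dil.
have r2 := L2B f2 p2.
have perp : inner (f - proj e F f) (f - proj e F f) = 0.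
  apply: (sub_proj_orthogonal L2_dil horth uF FG f2).
    move=> t Gt tF; apply: (far C) => //; rewrite ltNge; apply/negP => tC.
    by move/negP: tF; apply; apply/(Gamma_ballP hGamma hsplit finG).
  apply: closed_spanD => //; first exact: generators_L2.
  rewrite -cstN1E; apply: VZ; apply: proj_closed_span FG.
  exact: L2_dil.
have r0 : sqnorm (f - proj e F f) = 0.
  by apply: complexI; rewrite -inner_self.
apply: filterS ((sqnorm_eq0 r2).1 r0) => x; rewrite !fctE /proj fct_sumE => /eqP.
by rewrite subr_eq0 => /eqP.
Qed.

(** The coefficients are those of [phi (a^-1 .)], to which [V_finite] applies. *)
Lemma refinable_V : V (pull (invmx a) phi) -> refinable Gamma a phi.
Proof.
move=> Vf; have [kappa k0 phik] := phi_support.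
have dA := det_neq0; have ua := a_unit.
pose c : R := \sum_(ij : 'I_n.+1 * 'I_n.+1) `|a ij.1 ij.2|.
have c0 : 0 <= c by apply: sumr_ge0.
have ac i j : `|a i j| <= c.
  by rewrite /c (bigD1 (i, j))//= lerDl sumr_ge0.
have dV : \det (invmx a) != 0 by rewrite det_inv invr_eq0.
have [|T0 [T0G H]] := @V_finite _ (n.+1%:R * c * kappa) Vf; last first.
  exists T0, (fun s => inner (pull (invmx a) phi) (e s)); split=> //.
  apply: filterS (ae_pull dA H) => x <-.
  by rewrite /pull mulKmx.
apply: filterS (ae_pull dV phik) => x phix xC; apply: phix.
rewrite ltNge; apply/negP => xk; move: xC; apply/negP; rewrite -leNgt.
rewrite -[x in leLHS](mulKVmx ua); apply: le_trans (mulmx_norm_le _ c0 ac) _.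
by apply: ler_wpM2l => //; rewrite mulr_ge0.
Qed.

(** Applying [s] to the refinement equation gives one for [dil s phi], with
    translates by [(a s a^-1) t], which are again in the group. *)
Lemma V_pull_inv : refinable Gamma a phi -> forall g, V g -> V (pull (invmx a) g).
Proof.
move=> [T0 [c [T0G phiE]]]; have dA := det_neq0; have ua := a_unit.
have dV : \det (invmx a) != 0 by rewrite det_inv invr_eq0.
apply: (@closed_span_map _ _ _ _ (pull (invmx a)) `|\det a|) => //.
- exact: generators_L2.
- exact: generators_L2.
- by move=> f; exact: L2_pull.
- move=> f f2; rewrite (sqnorm_pull dV f2) mulrA -normrM det_inv mulfV//.
  by rewrite normr1 mul1r.
move=> _ [s Gs <-]; have si := Gamma_isometry hGamma Gs.
pose sa := aff_comp (aff_comp (aff_lin a) s) (aff_inv (aff_lin a)).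
have Gsa : Gamma sa by exact: Gamma_conj.
have E2 := generators_L2.
apply: (@V_ae _ (\sum_(t <- T0) cst (c t) * e (aff_comp sa t))).
- by apply: L2_pull => //; exact: L2_dil.
- have := ae_pull dV (ae_affine (aff_inv s).2 (det_aff_inv_neq0 si) phiE).
  apply: filterS => x phix; rewrite /pull dilE// [LHS]phix fct_sumE.
  apply: eq_big_seq => t tT0; have Gt : Gamma t by exact: T0G.
  have ti := Gamma_isometry hGamma Gt.
  have Gst := Gamma_comp hGamma Gsa Gt; have sti := Gamma_isometry hGamma Gst.
  pose w := a *m aff_apply (aff_inv s) (invmx a *m x).
  have wx : aff_apply (aff_comp sa t) (aff_apply (aff_inv t) w) = x.
    rewrite aff_comp_apply (aff_invVK _ ti) /sa !aff_comp_apply.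
    have -> : aff_apply (aff_inv (aff_lin a)) w = aff_apply (aff_inv s) (invmx a *m x).
      by rewrite {1}/aff_apply /= mulmx0 oppr0 addr0 /w mulKmx.
    by rewrite aff_invVK// /aff_apply /= addr0 mulKVmx.
  rewrite [in LHS]dilE// !fctE dilE//; congr (_ * phi _).
  by rewrite -[in RHS]wx aff_invK.
- rewrite big_seq; elim/big_rec: _ => [|t f tT0 Vf]; first exact: closed_span0.
  apply: closed_spanD => //; apply: VZ; apply: V_dil.
  by apply: (Gamma_comp hGamma Gsa); exact: T0G.
Qed.

Lemma nested_refinable :
  (forall j : int, Vj Gamma a phi j `<=` Vj Gamma a phi (j + 1)) <->
  refinable Gamma a phi.
Proof.
have phi1 : phi = e (aff_id R n.+1).
  rewrite dilE; last exact: (Gamma_id hGamma).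
  by apply/funext => x; rewrite /aff_apply /= invmx1 !mul1mx oppr0 addr0.
split=> [nest|ref j f].
  apply: refinable_V; have := nest 0 phi; rewrite !Vj_pull add0r oppr0 expr0z.
  rewrite exprN1 pull1; apply; rewrite {2}phi1.
  by apply: V_dil; exact: (Gamma_id hGamma).
rewrite !Vj_pull => /(V_pull_inv ref); rewrite pullM opprD.
by rewrite exprzDr ?a_unit// exprN1.
Qed.

End multiresolution.

(** * Intersection of the scales *)

Section intersection.
Variables (R : realType) (n : nat) (Gamma : set (affine R n.+1))
  (G : set 'M[R]_n.+1) (Lambda : set 'cV[R]_n.+1)
  (a : 'M[R]_n.+1) (phi : 'cV[R]_n.+1 -> R[i]).
Let mu := lebesgue_cV R n.+1.
Local Notation T := 'cV[R]_n.+1.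
Local Notation L2 := (@Defs.L2 R n.+1).
Local Notation normc := (@Normc.normc R).
Hypothesis hGamma : crystal_triple Gamma G Lambda.
Hypothesis hsplit : splitting Gamma G Lambda.
Hypothesis finG : finite_set G.
Hypothesis ha : admissible Gamma a.
Hypothesis hphi : L2 phi.
Hypothesis hsupp : compactly_supported phi.
Hypothesis horth : orthonormal_on Gamma (fun s => dil s phi).
Implicit Types (s t : affine R n.+1) (x v : T) (f g h : T -> R[i]).

Local Notation e := (fun s => dil s phi).
Local Notation V := (V0 Gamma phi).

Let dA := det_neq0 ha.

Lemma det_expn_neq0 k : \det (a ^+ k) != 0.
Proof. exact: (det_expz_neq0 ha k). Qed.

Lemma expz_unit (j : int) : a ^ j \in unitmx.
Proof. by rewrite unitmxE unitfE (det_expz_neq0 ha). Qed.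

Lemma invmx_expn k : invmx (a ^+ k) = invmx a ^+ k.
Proof. by rewrite -[invmx _]/((a ^+ k)^-1) exprVn. Qed.

Let B (N : R) k := [set x : T | cube N (a ^+ k *m x)].

Let measurable_B N k : measurable (B N k).
Proof.
rewrite (_ : B N k = (fun x => a ^+ k *m x + 0) @^-1` cube N).
  rewrite -[X in measurable X]setTI; apply: measurable_mulmxD => //.
  exact: measurable_cube.
by apply/seteqP; split => x /=; rewrite addr0.
Qed.

Let B_norm N (eps : R) : 0 < N -> 0 < eps ->
  exists K, forall k, (K <= k)%N -> forall x, B N k x -> `|x| <= eps.
Proof.
move=> N0 e0; have [K HK] := expanding_contraction ha.1 (divr_gt0 e0 N0).
exists K => k kK x Bx.
rewrite -[x](mulKmx (expz_unit k)) [invmx _]invmx_expn.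
apply: le_trans (HK k kK _) _; rewrite -[leRHS](divfK (lt0r_neq0 N0)).
by apply: ler_wpM2l Bx; rewrite divr_ge0 ?ltW.
Qed.

(** On the shrinking set [a^-k K] only finitely many, fixed, generators are
    visible, and their mass there vanishes; by duality, so does the share of
    the norm that a member of [V] can have there. *)
Lemma bigcap_V_cube f N : 0 < N -> L2 f -> (forall k, V (pull (a ^+ k) f)) ->
  sqnorm (trunc (cube N) f) = 0.
Proof.
move=> N0 f2 Vf; have [kappa k0 far] := inner_far hGamma hphi hsupp.
pose F := Gamma_ball Gamma (1 + kappa).
have FG : {in F, forall s, Gamma s}.
  by move=> s /(Gamma_ballP hGamma hsplit finG)[].
have uF : uniq F by exact: fset_uniq.
pose S k := \sum_(s <- F) sqnorm (trunc (B N k) (e s)).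
have S0 : vanishes S.
  apply: vanishes_sum => s /FG Gs; apply: vanishes_trunc => //.
    exact: (L2_dil hGamma hphi).
  exists [set 0]; split; [|exact: lebesgue_point|].
    rewrite (_ : [set 0] = cube 0); first exact: measurable_cube.
    by apply/seteqP; split => x /=; rewrite /cube /= normr_le0 => /eqP.
  move=> x /= nx; apply: contrapT => x0; apply: nx.
  have xp : 0 < `|x| / 2 by rewrite divr_gt0// normr_gt0; exact/eqP.
  have [K HK] := B_norm N0 xp; exists K => k /HK Bk Bx.
  by have := Bk _ Bx; lra.
have [K0 HK0] := B_norm N0 ltr01.
have fK2 : L2 (trunc (cube N) f) by apply: L2_trunc => //; exact: measurable_cube.
have main k : (K0 <= k)%N -> sqnorm (trunc (cube N) f) <= sqnorm f * S k.
  move=> kK0; pose g := pull (a ^+ k) f; have Vg : V g := Vf k.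
  have g2 := V_L2 Vg; pose h := trunc (B N k) g.
  have h2 : L2 h by exact: L2_trunc.
  have hE : h = pull (a ^+ k) (trunc (cube N) f).
    by apply/funext => x; rewrite /h /g /pull !truncE.
  have dk := det_expn_neq0 k.
  rewrite (sqnorm_pull dk fK2) (sqnorm_pull dk f2) -/g -hE -mulrA.
  apply: ler_wpM2l => //.
  have p2 : L2 (proj e F h) by apply: L2_proj FG; exact: (L2_dil hGamma hphi).
  have perp : inner (h - proj e F h) g = 0.
    apply: (sub_proj_orthogonal (L2_dil hGamma hphi) horth uF FG h2) Vg.
    move=> t Gt tF; apply: (far 1) => //.
      apply: aeW => x x1; rewrite /h truncE; case: ifPn => // /set_mem Bx.
      by have := HK0 k kK0 x Bx; rewrite leNgt x1.
    rewrite ltNge; apply/negP => tC; move/negP: tF; apply.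
    exact/(Gamma_ballP hGamma hsplit finG).
  have hg : (sqnorm h)%:C%C = inner h g.
    rewrite -inner_self// /inner; congr cintegral; apply/funext => x.
    by rewrite /h !truncE; case: ifP => // _; rewrite !mul0r.
  have hg2 : inner h g = inner (proj e F h) g.
    by apply/eqP; rewrite -subr_eq0 -innerBl//; apply/eqP.
  have cs := cauchy_schwarz p2 g2; rewrite -hg2 -hg in cs.
  have ps : sqnorm (proj e F h) <= sqnorm h * S k.
    rewrite (sqnorm_proj (L2_dil hGamma hphi) horth uF FG h2) /S mulr_sumr.
    rewrite big_seq [leRHS]big_seq; apply: ler_sum => s /FG Gs.
    have es2 := L2_dil hGamma hphi Gs.
    have -> : inner h (e s) = inner h (trunc (B N k) (e s)).
      congr cintegral; apply/funext => x; rewrite /h !truncE.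
      by case: ifP => // _; rewrite !mul0r.
    by apply: cauchy_schwarz => //; exact: L2_trunc.
  have [->|hn0] := eqVneq (sqnorm h) 0.
    rewrite mulr_ge0 ?sqnorm_ge0//; apply: sumr_ge0 => s _; exact: sqnorm_ge0.
  have hp : 0 < sqnorm h by rewrite lt_neqAle eq_sym hn0 sqnorm_ge0.
  rewrite -(ler_pM2l hp); rewrite sqr_normcE /= expr0n addr0 expr2 in cs.
  apply: le_trans cs _; rewrite [sqnorm g * _]mulrC mulrA.
  by apply: ler_wpM2r ps; exact: sqnorm_ge0.
apply/eqP; rewrite eq_le sqnorm_ge0 andbT; apply/ler_addgt0Pr => eps e0.
rewrite add0r; have f1 : 0 < sqnorm f + 1 by rewrite ltr_wpDl// sqnorm_ge0.
have [K1 HK1] := S0 _ (divr_gt0 e0 f1).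
have := HK1 _ (leq_maxr K0 K1); have := main _ (leq_maxl K0 K1).
set k := maxn _ _; rewrite ler_pdivlMr// => H1 H2.
have Sk0 : 0 <= S k by apply: sumr_ge0 => s _; exact: sqnorm_ge0.
by apply: le_trans H1 (le_trans _ H2); rewrite mulrC; apply: ler_wpM2l => //; lra.
Qed.

Lemma bigcap_Vj : \bigcap_(j in [set: int]) Vj Gamma a phi j =
  [set f | L2 f /\ {ae mu, forall x, f x = 0}].
Proof.
apply/seteqP; split => f; last first.
  move=> [f2 f0] j _; rewrite Vj_pull//.
  have dj := det_expz_neq0 ha (- j).
  apply: (V_ae hGamma hphi (g := 0)); first exact: L2_pull.
    exact: (ae_pull dj f0).
  by apply: closed_span0; exact: (generators_L2 hGamma hphi).
move=> fV; have Vf k : V (pull (a ^+ k) f).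
  by have := fV (- k%:Z) I; rewrite Vj_pull// opprK.
have f2 : L2 f by have := V_L2 (Vf 0%N); rewrite expr0 pull1.
split=> //.
have cube0 N : {ae mu, forall x, trunc (cube N.+1%:R) f x = 0}.
  apply/sqnorm_eq0; first by apply: L2_trunc => //; exact: measurable_cube.
  exact: bigcap_V_cube.
have : mu.-negligible (\bigcup_N [set x | trunc (cube N.+1%:R) f x <> 0]).
  by apply: negligible_bigcup => N; exact: cube0.
apply: negligibleS => x /= fx0; exists (Num.bound `|x|) => //=.
rewrite truncE mem_set// /cube /=.
apply: le_trans (ltW (archi_boundP (normr_ge0 _))) _.
by rewrite ler_nat.
Qed.

End intersection.

(** * Fourier energy of test functions *)

Section asymptotics.
Variables (R : realType) (n : nat) (Gamma : set (affine R n.+1))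
  (G : set 'M[R]_n.+1) (Lambda : set 'cV[R]_n.+1)
  (a : 'M[R]_n.+1) (phi : 'cV[R]_n.+1 -> R[i]).
Let mu := lebesgue_cV R n.+1.
Local Notation T := 'cV[R]_n.+1.
Local Notation L2 := (@Defs.L2 R n.+1).
Local Notation normc := (@Normc.normc R).
Hypothesis hGamma : crystal_triple Gamma G Lambda.
Hypothesis hsplit : splitting Gamma G Lambda.
Hypothesis finG : finite_set G.
Hypothesis ha : admissible Gamma a.
Hypothesis hphi : L2 phi.
Hypothesis hsupp : compactly_supported phi.
Implicit Types (s t : affine R n.+1) (x v : T) (f g h : T -> R[i]).

Local Notation e := (fun s => dil s phi).
Local Notation V := (V0 Gamma phi).

Variables (P : set T) (rho : R).
Hypotheses (rho0 : 0 < rho) (Prho : forall x, P x -> `|x| <= rho).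
Hypothesis fdP : fundamental_domain Gamma P.

Let mP : measurable P. Proof. by case: fdP. Qed.

(** On a bounded set, [2 |phi| <= 1 + |phi|^2]. *)
Lemma cintegrable_phi : cintegrable phi.
Proof.
have [kappa k0 phik] := phi_support hsupp; have [mf fi] := (L2P phi).1 hphi.
split=> //; set u := fun x => (normc (phi x))%:E.
have mu_u : measurable_fun setT u.
  by apply/measurable_EFinP; exact: cmeasurable_normc.
pose g x : R := \1_(cube kappa) x + normc (phi x) ^+ 2.
have ig : mu.-integrable setT (EFin \o g).
  rewrite /comp; under eq_fun do rewrite EFinD; apply: integrableD => //.
  apply: integrable_indic_fin; first exact: measurable_cube.
  by rewrite [X in X \is a fin_num](lebesgue_cube _ (ltW k0)).
apply/integrableP; split=> //; case/integrableP: ig => mg; apply: le_lt_trans.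
apply: ae_ge0_le_integral => //.
- exact: measurableT_comp.
- exact: measurableT_comp.
apply: filterS phik => x phix _; rewrite /u /g /= lee_fin.
rewrite ger0_norm ?normc_ge0// ger0_norm; last by rewrite addr_ge0// sqr_ge0.
have [xk|xk] := leP `|x| kappa; last first.
  by rewrite phix// Normc.normc0 expr0n addr0.
rewrite indicE mem_set//=; have := sqr_ge0 (normc (phi x) - 1).
have := normc_ge0 (phi x); nra.
Qed.

Lemma cintegrable_dil s : Gamma s -> cintegrable (e s).
Proof.
move=> Gs; have si := Gamma_isometry hGamma Gs; rewrite (dilE phi hGamma)//.
apply: (cintegrable_affine (aff_inv s).2 (det_aff_inv_neq0 si)).
exact: cintegrable_phi.
Qed.

Lemma cintegral_dil s : Gamma s -> cintegral (e s) = cintegral phi.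
Proof.
move=> Gs; have si := Gamma_isometry hGamma Gs; rewrite (dilE phi hGamma)//.
rewrite [RHS](cintegral_affine (aff_inv s).2 (det_aff_inv_neq0 si) cintegrable_phi).
by rewrite det_aff_inv// mul1r.
Qed.

Let m1 := \int[mu]_x normc (phi x).

Lemma Rintegral_normc_dil s : Gamma s -> \int[mu]_x normc (e s x) = m1.
Proof.
move=> Gs; have si := Gamma_isometry hGamma Gs; rewrite (dilE phi hGamma)//.
rewrite /m1 [RHS](Rintegral_affine (aff_inv s).2 (det_aff_inv_neq0 si) cintegrable_phi.2).
by rewrite det_aff_inv// mul1r.
Qed.

(** The translate is supported within [rad] of its centre, where [h] differs
    from [z] by at most [eta]. *)
Lemma inner_near_mean : exists2 rad : R, 0 < rad &
  forall s h (z : R[i]) (eta : R), Gamma s -> L2 h -> 0 <= eta ->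
    (forall y, `|y - s.2| <= rad -> normc (h y - z) <= eta) ->
    normc (inner h (e s) - z * conjc (cintegral phi)) <= eta * m1.
Proof.
have [kappa k0 phik] := phi_support hsupp.
exists (n.+1%:R * kappa); first by rewrite mulr_gt0.
move=> s h z eta Gs h2 eta0 hz; have si := Gamma_isometry hGamma Gs.
have es2 := L2_dil hGamma hphi Gs; have ei := cintegrable_dil Gs.
have eJ := cintegrableJ ei; have hi := cintegrable_inner h2 es2.
have di : cintegrable (fun x => (h x - z) * conjc (e s x)).
  under eq_fun do rewrite mulrBl -mulNr.
  by apply: cintegrableD => //; exact: cintegrableZ.
have -> : inner h (e s) - z * conjc (cintegral phi) =
    cintegral (fun x => (h x - z) * conjc (e s x)).
  rewrite -(cintegral_dil Gs) -(cintegralJ ei) -mulNr -cintegralZ//.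
  rewrite /inner -cintegralD//; last exact: cintegrableZ.
  by congr cintegral; apply/funext => x; rewrite mulNr -mulrBl.
apply: le_trans (le_normc_cintegral di) _.
rewrite -(Rintegral_normc_dil Gs) -RintegralZl//; last exact: ei.2.
rewrite /Rintegral; apply: fine_le.
- by apply: integrable_fin_num => //; exact: di.2.
- apply: integrable_fin_num => //; under eq_fun do rewrite EFinM.
  by apply: integrableZl => //; exact: ei.2.
apply: ae_ge0_le_integral => //.
- by move=> x _; rewrite lee_fin normc_ge0.
- by case: di => _ /integrableP[].
- by move=> x _; rewrite lee_fin mulr_ge0// normc_ge0.
- apply/measurable_EFinP; apply: measurable_funM => //.
  by apply: cmeasurable_normc; exact: ei.1.
have := ae_affine (aff_inv s).2 (det_aff_inv_neq0 si) phik.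
apply: filterS => x phix _; rewrite lee_fin Normc.normcM normcJ.
have [xs|xs] := leP `|x - s.2| (n.+1%:R * kappa).
  by apply: ler_wpM2r; [exact: normc_ge0|exact: hz].
rewrite (dilE phi hGamma)// phix ?Normc.normc0 ?mulr0//.
have n0 : 0 < n.+1%:R :> R by [].
by rewrite -(ltr_pM2l n0); apply: lt_le_trans (aff_apply_norm_le x si).
Qed.

Let p := fine (mu P).

Lemma tile_near_mean s (u : T -> R) (z eta : R) : Gamma s ->
  mu.-integrable setT (EFin \o u) ->
  (forall y, `|y - s.2| <= n.+1%:R * rho -> `|u y - z| <= eta) ->
  `|\int[mu]_x (u x * \1_(aff_apply s @` P) x) - z * p| <= eta * p.
Proof.
move=> Gs ui uz; have si := Gamma_isometry hGamma Gs.
set D := aff_apply s @` P; have mD : measurable D by exact: measurable_aff_image.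
have muD : mu D = mu P by exact: lebesgue_aff_image.
have Dfin : mu D \is a fin_num by rewrite muD; exact: (domain_fin_num Prho fdP).
have iD := integrable_indic_fin mD Dfin.
have pE : p = \int[mu]_x \1_D x by rewrite Rintegral_indic// muD.
have mu_u : measurable_fun setT u by apply/measurable_EFinP; case/integrableP: ui.
have iuD : mu.-integrable setT (EFin \o (fun x => u x * \1_D x)).
  apply: le_integrable ui => //.
    by apply/measurable_EFinP; apply: measurable_funM => //; exact: measurable_indic.
  move=> x _ /=; rewrite lee_fin normrM ler_piMr// indicE.
  by case: (_ \in _); rewrite ?normr1 ?normr0.
have izD (c : R) : mu.-integrable setT (EFin \o (fun x => c * \1_D x)).
  by rewrite /comp; under eq_fun do rewrite EFinM; exact: integrableZl.
have iv : mu.-integrable setT (EFin \o (fun x => u x * \1_D x - z * \1_D x)).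
  rewrite /comp; under eq_fun do rewrite EFinB.
  by apply: integrableB => //; exact: izD.
rewrite pE -!RintegralZl// -RintegralB//.
apply: le_trans (le_normr_Rintegral measurableT iv) _.
apply: le_Rintegral => //; first exact: (integrable_abse iv).
move=> x _; rewrite -mulrBl normrM indicE.
case: (boolP (x \in D)) => [/set_mem Dx|_]; last by rewrite normr0 !mulr0.
rewrite normr1 !mulr1; apply: uz.
exact: (tile_near hGamma Prho Gs Dx).
Qed.

Lemma L2_bounded_support (f : T -> R) C M : 0 <= C -> measurable_fun setT f ->
  (forall x, `|f x| <= M) -> (forall x, C < `|x| -> f x = 0) ->
  L2 (fun x => (f x)%:C%C).
Proof.
move=> C0 mf fM fC.
apply: (@L2_le _ _ _ (fun x => M ^+ 2 * \1_(cube C) x)).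
- by split => //=; exact: measurable_cst.
- rewrite /comp; under eq_fun do rewrite EFinM; apply: integrableZl => //.
  apply: integrable_indic_fin; first exact: measurable_cube.
  by rewrite [X in X \is a fin_num](lebesgue_cube _ C0).
move=> x; rewrite sqr_normcE /= expr0n addr0 indicE.
have [xC|xC] := leP `|x| C; last first.
  by rewrite fC// expr0n mulr_ge0// ?sqr_ge0//; case: (_ \in _).
rewrite mem_set// mulr1 -[f x ^+ 2]real_normK ?num_real//.
by apply: lerXn2r (fM x); rewrite nnegrE// (le_trans _ (fM x)).
Qed.

(** Seen from scale [k], the function [f (a^-k .)] is almost constant on every
    tile and on the support of every translate of [phi]. Its squared Fourier
    coefficients and its squared norm are therefore both Riemann sums over the
    same centres, up to errors that the number of tiles involved controls. *)
Theorem fourier_energy (f : T -> R) (C M Lip : R) :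
  0 <= C -> 0 <= M -> 0 <= Lip -> measurable_fun setT f ->
  (forall x, `|f x| <= M) -> (forall x, C < `|x| -> f x = 0) ->
  (forall x y, `|f x - f y| <= Lip * `|x - y|) ->
  forall eps : R, 0 < eps -> exists K, forall k, (K <= k)%N ->
    let h := pull (invmx a ^+ k) (fun x => (f x)%:C%C) in
    exists F : {fset affine R n.+1},
    [/\ {in F, forall s, Gamma s},
        forall s, Gamma s -> s \notin F -> inner h (e s) = 0 &
        `|\sum_(s <- F) normc (inner h (e s)) ^+ 2 -
          normc (cintegral phi) ^+ 2 / p * sqnorm h| <= eps * `|\det a| ^+ k].
Proof.
move=> C0 M0 Lip0 mf fM fC fL eps e0.
have [rad rad0 near] := inner_near_mean.
have m1c : normc (cintegral phi) <= m1 := le_normc_cintegral cintegrable_phi.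
have m10 : 0 <= m1 := le_trans (normc_ge0 _) m1c.
have p0 : 0 < p := domain_volume_gt0 hGamma hsplit finG Prho fdP.
set R2 := n.+1%:R * rho; have R20 : 0 < R2 by rewrite mulr_gt0.
pose vol : R := (2 * (C + 2)) ^+ n.+1.
have vol0 : 0 <= vol by apply: exprn_ge0; lra.
(* [err] bounds the error made at one centre, per unit of the contraction
   factor [dl]; [vol / p] bounds the number of centres, per unit of
   [|det a| ^+ k]. The other summands of [D] keep the images of supports and
   tiles under [a^-k] of radius at most 1. *)
pose err := 2 * M * m1 * (Lip * rad * m1) + m1 ^+ 2 * (2 * M * (Lip * R2)).
have err0 : 0 <= err.
  by rewrite /err addr_ge0// !mulr_ge0// ?sqr_ge0// ltW.
have ev0 : 0 <= vol / p * err / eps by rewrite !mulr_ge0// ?invr_ge0 ltW.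
pose D := rad + R2 + vol / p * err / eps + 1.
have D0 : 0 < D by rewrite /D; lra.
pose dl := D^-1; have dl0 : 0 < dl by rewrite invr_gt0.
have dlD : dl * D = 1 by rewrite mulVf// gt_eqF.
have dlrad : dl * rad <= 1.
  by rewrite -dlD; apply: ler_wpM2l; [exact: ltW|rewrite /D; lra].
have dlR2 : dl * R2 <= 1.
  by rewrite -dlD; apply: ler_wpM2l; [exact: ltW|rewrite /D; lra].
have dlerr : vol / p * (dl * err) <= eps.
  have : dl * (vol / p * err / eps) <= 1.
    by rewrite -dlD; apply: ler_wpM2l; [exact: ltW|rewrite /D; lra].
  by rewrite mulrA ler_pdivrMr// mul1r mulrCA.
have [K HK] := expanding_contraction ha.1 dl0.
exists K => k kK h; pose A := invmx a ^+ k.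
have dA : \det a != 0 := det_neq0 ha.
have detA : \det A = (\det a ^+ k)^-1.
  rewrite /A -invmx_expn det_inv; congr (_^-1).
  by elim: k {kK h A} => [|k IH]; rewrite ?expr0 ?det1// !exprS -IH -det_mulmx.
have dA0 : \det A != 0 by rewrite detA invr_eq0 expf_neq0.
have AL (x y : T) : `|A *m x - A *m y| <= dl * `|x - y|.
  by rewrite -mulmxBr; exact: HK.
have AN (x y : T) : `|A *m x| <= `|A *m y| + dl * `|x - y|.
  by rewrite -[A *m x](subrK (A *m y)) addrC (le_trans (ler_normD _ _))// lerD2l.
(* a crude bound on [a ^+ k], only needed for [F] to be finite *)
pose ck : R := \sum_(ij : 'I_n.+1 * 'I_n.+1) `|(a ^+ k) ij.1 ij.2|.
have ck0 : 0 <= ck by apply: sumr_ge0.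
have ckE i j : `|(a ^+ k) i j| <= ck.
  by rewrite /ck (bigD1 (i, j))//= lerDl sumr_ge0.
pose X := n.+1%:R * ck * (C + 1).
pose F := [fset s in Gamma_ball Gamma X | (`|A *m s.2| <= C + 1)%R]%fset.
have FP s : reflect (Gamma s /\ `|A *m s.2| <= C + 1) (s \in F).
  rewrite !inE /=; apply: (iffP andP) => [[/(Gamma_ballP hGamma hsplit finG)[Gs _] sC]|[Gs sC]].
    by split.
  split=> //; apply/(Gamma_ballP hGamma hsplit finG); split=> //.
  rewrite -[s.2](mulKVmx (expz_unit ha k)) invmx_expn.
  apply: le_trans (mulmx_norm_le _ ck0 ckE) _.
  by apply: ler_wpM2l => //; rewrite mulr_ge0.
have FG : {in F, forall s, Gamma s} by move=> s /FP[].
have h2 : L2 h.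
  apply: L2_pull => //; exact: L2_bounded_support fM fC.
have fnear s y r : `|y - s.2| <= r -> `|f (A *m y) - f (A *m s.2)| <= Lip * (dl * r).
  move=> yr; apply: le_trans (fL _ _) _; apply: ler_wpM2l => //.
  by apply: le_trans (AL _ _) _; apply: ler_wpM2l => //; exact: ltW.
exists F; split=> //.
  move=> s Gs sF; apply: Normc.eq0_normc; apply/eqP; rewrite eq_le normc_ge0 andbT.
  have := near s h 0 0 Gs h2 (lexx _); rewrite !mul0r subr0; apply=> y ys.
  rewrite subr0 /h /pull fC ?Normc.normc0//.
  have sC : C + 1 < `|A *m s.2|.
    by rewrite ltNge; apply/negP => sC; move/FP: sF; apply.
  have := AN s.2 y; rewrite distrC.
  have : dl * `|y - s.2| <= 1.
    by apply: le_trans dlrad; apply: ler_wpM2l => //; exact: ltW.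
  rewrite -/A; lra.
pose u (y : T) := f (A *m y) ^+ 2.
have uE y : normc (h y) ^+ 2 = u y.
  by rewrite sqr_normcE /= expr0n addr0.
have ui : mu.-integrable setT (EFin \o u).
  have [_] := (L2P h).1 h2; apply: eq_integrable => // y _ /=.
  by rewrite uE.
pose I s := \int[mu]_x (u x * \1_(aff_apply s @` P) x).
have hI : sqnorm h = \sum_(s <- F) I s.
  rewrite /sqnorm; under eq_Rintegral do rewrite uE.
  apply: (Rintegral_tiles hGamma fdP FG ui) => y uy.
  have [s [Gs Py]] := tile_cover fdP y; exists s => //; apply/FP; split=> //.
  have yC : `|A *m y| <= C.
    by rewrite leNgt; apply: contra uy => yC; rewrite /u fC// expr0n.
  have := AN s.2 y; have := tile_near hGamma Prho Gs Py; rewrite distrC => sy.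
  have : dl * `|s.2 - y| <= 1.
    by apply: le_trans dlR2; apply: ler_wpM2l => //; exact: ltW.
  lra.
have count : #|` F|%:R * p <= `|\det a| ^+ k * vol.
  pose S := [set y : T | cube (C + 2) (A *m y)].
  have C20 : 0 <= C + 2 by lra.
  have SE : S = (fun y => A *m y + 0) @^-1` cube (C + 2).
    by apply/seteqP; split => y /=; rewrite addr0.
  have mS : measurable S.
    rewrite SE -[X in measurable X]setTI; apply: measurable_mulmxD => //.
    exact: measurable_cube.
  have := lebesgue_cV_affine 0 dA0 (@measurable_cube R n.+1 (C + 2)).
  rewrite -SE lebesgue_cube// detA => volS.
  have US : \bigcup_(s in [set` F]) (aff_apply s @` P) `<=` S.
    move=> y [s /FP[Gs sC] Py]; rewrite /S /cube /=.
    have := AN y s.2; have := tile_near hGamma Prho Gs Py => ys.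
    have : dl * `|y - s.2| <= 1.
      by apply: le_trans dlR2; apply: ler_wpM2l => //; exact: ltW.
    lra.
  have le_S : ((#|` F|%:R * p)%:E <= mu S)%E.
    rewrite -(lebesgue_tiles hGamma Prho fdP FG).
    exact: (le_measure _ (mem_set (measurable_tiles hGamma fdP FG)) (mem_set mS) US).
  have q0 : 0 < `|\det a| ^+ k by rewrite exprn_gt0// normr_gt0.
  rewrite -lee_fin; apply: le_trans le_S _.
  rewrite EFinM /vol volS muleA -EFinM normfV normrX divff ?gt_eqF//.
  by rewrite mul1e.
set c0 := cintegral phi in m1c *.
have step s : s \in F ->
    `|normc (inner h (e s)) ^+ 2 - normc c0 ^+ 2 / p * I s| <= dl * err.
  move=> sF; have Gs := FG _ sF; set v := f (A *m s.2).
  set z := inner h (e s); pose w := v%:C%C * conjc c0.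
  have normcR (r : R) : normc r%:C%C = `|r|.
    by rewrite /Normc.normc /= expr0n addr0 sqrtr_sqr.
  have zw : normc (z - w) <= Lip * (dl * rad) * m1.
    apply: near => //; first by rewrite !mulr_ge0// ltW.
    move=> y yr; rewrite /h /pull (_ : _ - _ = (f (A *m y) - v)%:C%C).
      by rewrite normcR; exact: fnear.
    by rewrite rmorphB.
  have wM : normc w <= M * m1.
    rewrite Normc.normcM normcR normcJ.
    exact: ler_pM (normr_ge0 _) (normc_ge0 _) (fM _) m1c.
  have zM : normc z <= M * m1.
    have := near s h 0 M Gs h2 M0; rewrite mul0r subr0; apply=> y _.
    by rewrite subr0 normcR.
  have zw' : `|normc z - normc w| <= Lip * (dl * rad) * m1.
    apply: le_trans zw; rewrite ler_norml; apply/andP; split.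
      have := le_normcD (w - z) z; rewrite subrK -[normc (w - z)]normcN opprB; lra.
    have := le_normcD (z - w) w; rewrite subrK; lra.
  have Iv : `|I s - v ^+ 2 * p| <= 2 * M * (Lip * (dl * R2)) * p.
    apply: tile_near_mean => // y ys.
    rewrite /u subr_sqr normrM mulrC; apply: ler_pM => //.
      apply: le_trans (ler_normD _ _) _; rewrite mulr_natl mulr2n.
      exact: lerD (fM _) (fM _).
    exact: fnear.
  have wE : normc w ^+ 2 = v ^+ 2 * normc c0 ^+ 2.
    by rewrite Normc.normcM exprMn normcR normcJ real_normK// num_real.
  have -> : normc z ^+ 2 - normc c0 ^+ 2 / p * I s =
      (normc z - normc w) * (normc z + normc w) -
      normc c0 ^+ 2 / p * (I s - v ^+ 2 * p).
    by rewrite -subr_sqr wE; field; rewrite gt_eqF.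
  apply: le_trans (ler_normB _ _) _.
  have -> : dl * err = Lip * (dl * rad) * m1 * (2 * M * m1) +
      m1 ^+ 2 / p * (2 * M * (Lip * (dl * R2)) * p).
    by rewrite /err; field; rewrite gt_eqF.
  apply: lerD; rewrite normrM.
    apply: ler_pM => //; rewrite ger0_norm ?addr_ge0 ?normc_ge0//; lra.
  apply: ler_pM => //; rewrite ger0_norm; last first.
    by rewrite mulr_ge0 ?sqr_ge0// invr_ge0 ltW.
  apply: ler_wpM2r; first by rewrite invr_ge0 ltW.
  by apply: lerXn2r m1c; rewrite nnegrE// normc_ge0.
rewrite hI mulr_sumr -sumrB; apply: le_trans (ler_norm_sum _ _ _) _.
apply: (@le_trans _ _ (\sum_(s <- F) dl * err)).
  by rewrite big_seq [leRHS]big_seq; apply: ler_sum => s; exact: step.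
rewrite big_const_seq count_predT iter_addr_0 -mulr_natl.
have de0 : 0 <= dl * err by rewrite mulr_ge0// ltW.
have cnt : (size F)%:R <= `|\det a| ^+ k * (vol / p).
  by rewrite mulrA ler_pdivlMr.
apply: le_trans (ler_wpM2r de0 cnt) _; rewrite -mulrA mulrC.
by apply: ler_wpM2r; rewrite ?exprn_ge0.
Qed.

End asymptotics.

(** * Density of test functions *)

Section trapezoids.
Variable R : realType.
Implicit Types (x y z l u : R).

Definition clamp z : R := Num.max 0 (Num.min 1 z).

Lemma clampP z : [\/ z <= 0 /\ clamp z = 0, 0 <= z <= 1 /\ clamp z = z |
  1 <= z /\ clamp z = 1].
Proof.
rewrite /clamp; case: (leP 1 z) => h1.
  by apply: Or33; split=> //; rewrite max_r.
by case: (leP 0 z) => h2; [apply: Or32|apply: Or31]; split=> //; lra.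
Qed.

Lemma clamp_itv z : 0 <= clamp z <= 1.
Proof. by case: (clampP z) => -[z1 ->]; lra. Qed.

Lemma clamp0 z : z <= 0 -> clamp z = 0.
Proof. by move=> z0; case: (clampP z) => -[z1 ->]; lra. Qed.

Lemma clamp1 z : 1 <= z -> clamp z = 1.
Proof. by move=> z0; case: (clampP z) => -[z1 ->]; lra. Qed.

Lemma clamp_lipschitz x y : `|clamp x - clamp y| <= `|x - y|.
Proof.
suff main u v : u <= v -> clamp v - clamp u <= v - u /\ 0 <= clamp v - clamp u.
  have [xy|/ltW yx] := leP x y.
    by have [h1 h2] := main _ _ xy; rewrite distrC [leRHS]distrC !ger0_norm// subr_ge0.
  by have [h1 h2] := main _ _ yx; rewrite !ger0_norm// subr_ge0.
by move=> uv; case: (clampP u) => -[u1 ->]; case: (clampP v) => -[v1 ->]; lra.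
Qed.

Lemma measurable_clamp d (S : measurableType d) (f : S -> R) :
  measurable_fun setT f -> measurable_fun setT (fun s => clamp (f s)).
Proof.
move=> mf; rewrite /clamp.
have m1 : measurable_fun setT (fun s => Num.min 1 (f s)).
  by apply: measurable_minr => //; exact: measurable_cst.
by apply: measurable_maxr => //; exact: measurable_cst.
Qed.

(** For positive [N] it vanishes outside the interval from [l] to [u + 1 / N],
    and it is 1 from [l + 1 / N] to [u]. *)
Definition trapezoid (N : R) l u y := clamp (N * (y - l)) * (1 - clamp (N * (y - u))).

Lemma trapezoid_itv N l u y : 0 <= trapezoid N l u y <= 1.
Proof.
rewrite /trapezoid; have := clamp_itv (N * (y - l)).
have := clamp_itv (N * (y - u)); nra.
Qed.

Lemma mulr_itv_lipschitz a b c d : 0 <= a <= 1 -> 0 <= b <= 1 ->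
  0 <= c <= 1 -> 0 <= d <= 1 -> `|a * b - c * d| <= `|a - c| + `|b - d| :> R.
Proof.
move=> a01 b01 c01 d01.
have -> : a * b - c * d = (a - c) * b + c * (b - d) by ring.
apply: le_trans (ler_normD _ _) _; rewrite !normrM; apply: lerD.
  by rewrite ler_piMr// ger0_norm; lra.
by rewrite ler_piMl// ger0_norm; lra.
Qed.

Lemma prodr_itv (I : Type) (s : seq I) (a : I -> R) :
  (forall i, 0 <= a i <= 1) -> 0 <= \prod_(i <- s) a i <= 1.
Proof.
move=> a01; elim/big_rec: _ => [|i x _ x01]; first by rewrite ler01 lexx.
by have := a01 i; nra.
Qed.

Lemma prodr_itv_lipschitz (I : Type) (s : seq I) (a b : I -> R) :
  (forall i, 0 <= a i <= 1) -> (forall i, 0 <= b i <= 1) ->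
  `|\prod_(i <- s) a i - \prod_(i <- s) b i| <= \sum_(i <- s) `|a i - b i|.
Proof.
move=> a01 b01; elim: s => [|i s IH]; first by rewrite !big_nil subrr normr0.
rewrite !big_cons; apply: le_trans (mulr_itv_lipschitz _ _ _ _) _ => //.
- exact: prodr_itv.
- exact: prodr_itv.
- by rewrite lerD2l.
Qed.

Lemma trapezoid_lipschitz N l u x y : 0 <= N ->
  `|trapezoid N l u x - trapezoid N l u y| <= 2 * N * `|x - y|.
Proof.
move=> N0; have c01 z : 0 <= 1 - clamp z <= 1 by have := clamp_itv z; lra.
apply: le_trans (mulr_itv_lipschitz (clamp_itv _) (c01 _) (clamp_itv _) (c01 _)) _.
have L v : `|clamp (N * (x - v)) - clamp (N * (y - v))| <= N * `|x - y|.
  apply: le_trans (clamp_lipschitz _ _) _.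
  by rewrite -mulrBr normrM ger0_norm// opprB addrA subrK.
have -> : 1 - clamp (N * (x - u)) - (1 - clamp (N * (y - u))) =
   - (clamp (N * (x - u)) - clamp (N * (y - u))) by ring.
by rewrite normrN; have := L l; have := L u; lra.
Qed.

Lemma trapezoid_support N l u y : 1 <= N -> trapezoid N l u y != 0 ->
  `|y| <= `|l| + `|u| + 1.
Proof.
move=> N1; apply: contraR; rewrite -ltNge => yb; apply/eqP; rewrite /trapezoid.
have lb := ler_norm l; have lb' := ler_norm (- l); rewrite normrN in lb'.
have ub := ler_norm u; have ub' := ler_norm (- u); rewrite normrN in ub'.
have l0 := normr_ge0 l; have u0 := normr_ge0 u.
have [y0|y0] := leP 0 y.
  rewrite (ger0_norm y0) in yb.
  have yu : 1 <= y - u by lra.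
  by rewrite [clamp (N * (y - u))]clamp1 ?subrr ?mulr0//; nra.
rewrite (ltr0_norm y0) in yb.
by rewrite clamp0 ?mul0r// mulr_ge0_le0; lra.
Qed.

(** The rising ramp starts at [l] and the falling one at [u], so the limit
    excludes [l] and includes [u]. *)
Lemma trapezoid_eventually l u y : exists K, forall k, (K <= k)%N ->
  trapezoid k.+1%:R l u y = \1_(`]l, u]%classic) y.
Proof.
have large (c : R) : 0 < c -> exists K, forall k, (K <= k)%N -> 1 <= k.+1%:R * c.
  move=> c0; exists (Num.bound (c^-1)) => k Kk.
  rewrite -ler_pdivrMr// mul1r; apply: le_trans (ltW (archi_boundP _)) _.
    by rewrite invr_ge0 ltW.
  by rewrite ler_nat ltnW.
have [yl|ly] := leP y l.
  exists 0%N => k _; rewrite /trapezoid clamp0 ?mul0r.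
    by rewrite indicE memNset//= in_itv/= ltNge yl.
  by rewrite mulr_ge0_le0// subr_le0.
have yl0 : 0 < y - l by rewrite subr_gt0.
have [K1 H1] := large _ yl0.
have [yu|uy] := leP y u.
  exists K1 => k /H1 k1; rewrite /trapezoid clamp1// clamp0; last first.
    by rewrite mulr_ge0_le0// subr_le0.
  by rewrite mul1r subr0 indicE mem_set//= in_itv/= ly yu.
have uy0 : 0 < y - u by rewrite subr_gt0.
have [K2 H2] := large _ uy0.
exists K2 => k /H2 k1; rewrite /trapezoid [clamp (_ * (y - u))]clamp1// subrr mulr0.
by rewrite indicE memNset//= in_itv/= ly/= leNgt uy.
Qed.

End trapezoids.

Section density.
Variables (R : realType) (n : nat).
Let mu := lebesgue_cV R n.+1.
Local Notation T := 'cV[R]_n.+1.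
Local Notation L2 := (@Defs.L2 R n.+1).
Local Notation normc := (@Normc.normc R).
Variable W : set (T -> R[i]).
Hypothesis W2 : W `<=` L2.
Hypothesis WD : forall f g, W f -> W g -> W (f + g).
Hypothesis WZ : forall (c : R[i]) f, W f -> W (cst c * f).
Hypothesis Wclosed : forall f, L2 f ->
  (forall eps : R, 0 < eps -> exists2 g, W g & sqnorm (f - g) < eps) -> W f.
Hypothesis Wtest : forall (f : T -> R) (C M Lip : R),
  0 <= C -> 0 <= M -> 0 <= Lip -> measurable_fun setT f ->
  (forall x, `|f x| <= M) -> (forall x, C < `|x| -> f x = 0) ->
  (forall x y, `|f x - f y| <= Lip * `|x - y|) ->
  W (fun x => (f x)%:C%C).

Let indC (S : set T) : T -> R[i] := fun x => (\1_S x)%:C%C.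

Let normcR (r : R) : normc r%:C%C = `|r|.
Proof. by rewrite /Normc.normc /= expr0n addr0 sqrtr_sqr. Qed.

Let W_limit f (g : nat -> T -> R[i]) : L2 f -> (forall k, W (g k)) ->
  vanishes (fun k => sqnorm (f - g k)) -> W f.
Proof.
move=> f2 Wg fg; apply: Wclosed => // eps e0.
have e2 : 0 < eps / 2 by rewrite divr_gt0.
have [K HK] := fg _ e2; exists (g K) => //.
by apply: le_lt_trans (HK K (leqnn _)) _; lra.
Qed.

Let L2_indC (S : set T) C : measurable S -> (forall x, S x -> `|x| <= C) -> L2 (indC S).
Proof.
move=> mS SC; apply: (@L2_le _ _ _ (\1_S : T -> R)).
- exact: cmeasurable_indic.
- apply: integrable_indic_fin => //; exact: lebesgue_bounded_fin SC.
- by move=> x; rewrite normcR indicE; case: (_ \in _); rewrite ?normr1 ?normr0 ?expr1n// expr0n.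
Qed.

(** Products of trapezoids are test functions, and converge to the indicator. *)
Lemma W_box (l u : 'I_n.+1 -> R) :
  W (indC (rectangle (fun i => `]l i, u i]%classic))).
Proof.
set S := rectangle _.
pose t k (x : T) : R := \prod_i trapezoid k.+1%:R (l i) (u i) (x i ord0).
pose C : R := \sum_i (`|l i| + `|u i|) + 1.
have Ci i : `|l i| + `|u i| + 1 <= C.
  rewrite /C (bigD1 i)//= lerD2r lerDl; apply: sumr_ge0 => j _.
  by rewrite addr_ge0.
have C0 : 0 <= C by apply: le_trans (Ci ord0); rewrite !addr_ge0.
have mS : measurable S by apply: measurable_rectangle => i; exact: measurable_itv.
have SC x : S x -> `|x| <= C.
  move=> Sx; apply/mx_norm_le => // i; apply: le_trans (Ci i).
  have := Sx i; rewrite /= in_itv/= => /andP[h1 h2].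
  have h3 := ler_norm (u i); have := ler_norm (- l i); rewrite normrN => h4.
  have := normr_ge0 (u i); have := normr_ge0 (l i) => h5 h6.
  by rewrite ler_norml; apply/andP; split; lra.
have t01 k x : 0 <= t k x <= 1 by apply: prodr_itv => i; exact: trapezoid_itv.
have tC k x : C < `|x| -> t k x = 0.
  move=> xC; have [i xi] : exists i, C < `|x i ord0|.
    apply: contrapT => /forallNP nx; move: xC; apply/negP; rewrite -leNgt.
    by apply/mx_norm_le => // i; rewrite leNgt; apply/negP; exact: nx.
  rewrite /t (bigD1 i)//=; apply/eqP; rewrite mulf_eq0; apply/orP; left.
  apply: contraTT xi => ti; rewrite -leNgt; apply: le_trans (Ci i).
  by apply: trapezoid_support ti; rewrite ler1n.
have mt k : measurable_fun setT (t k).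
  apply: measurable_prod => i _.
  apply: measurable_funM; [|apply: measurable_funB => //];
    apply: measurable_clamp; apply: measurable_funM => //;
    apply: measurable_funB => //; exact: measurable_coord.
apply: (@W_limit _ (fun k x => (t k x)%:C%C)).
- exact: L2_indC SC.
- move=> k; apply: (Wtest (C := C) (M := 1) (Lip := n.+1%:R * (2 * k.+1%:R))) => //.
  + by move=> x; have /andP[t0 t1] := t01 k x; rewrite ger0_norm.
  + exact: tC.
  + move=> x y; apply: le_trans (prodr_itv_lipschitz _ _ _) _.
    * by move=> i; exact: trapezoid_itv.
    * by move=> i; exact: trapezoid_itv.
    apply: (@le_trans _ _ (\sum_(i < n.+1) 2 * k.+1%:R * `|x - y|)).
      apply: ler_sum => i _; apply: le_trans (trapezoid_lipschitz _ _ _ _ _) _ => //.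
      by apply: ler_wpM2l => //; have := norm_coord (x - y) i; rewrite !mxE.
    by rewrite sumr_const card_ord -[leLHS]mulr_natl mulrA.
apply: (@vanishes_sqnorm _ _ _ (\1_(cube C) : T -> R)).
- move=> k; apply: cmeasurableD; first exact: cmeasurable_indic.
  by split => /=; [apply: measurable_funN|exact: measurable_cst].
- apply: integrable_indic_fin; first exact: measurable_cube.
  by rewrite [X in X \is a fin_num](lebesgue_cube _ C0).
- move=> k x; rewrite !fctE /indC -rmorphB normcR real_normK ?num_real//.
  have [xC|xC] := leP `|x| C.
    rewrite [leRHS]indicE mem_set//=; have := t01 k x.
    by rewrite indicE; case: (_ \in _) => /= t1; nra.
  have S0 : \1_S x = 0 :> R.
    by rewrite indicE memNset// => /SC; rewrite leNgt xC.
  by rewrite tC// S0 subr0 expr0n indicE; case: (_ \in _).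
apply: aeW => x; apply: cvg_near_cst.
have /choice[K HK] := fun i => trapezoid_eventually (l i) (u i) (x i ord0).
exists (\max_i K i) => // k /= kK.
rewrite !fctE /indC -rmorphB normcR.
suff -> : t k x = \1_S x by rewrite subrr normr0 expr0n.
rewrite /t (eq_bigr (fun i => \1_(`]l i, u i]%classic) (x i ord0))); last first.
  by move=> i _; apply: HK; exact: leq_trans (leq_bigmax _) kK.
rewrite indicE; case: (boolP (x \in S)) => [/set_mem Sx|/negP xS].
  by rewrite big1// => i _; rewrite indicE mem_set//; exact: Sx.
have [i xi] : exists i, ~ `]l i, u i]%classic (x i ord0).
  apply: contrapT => /forallNP nx; apply: xS; apply/mem_set => i.
  exact: contrapT (nx i).
by rewrite (bigD1 i)//= indicE memNset// mul0r.
Qed.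

Let Q (m : nat) : set T := rectangle (fun=> `](- m%:R : R), m%:R]%classic).

Let Q_cube m x : Q m x -> `|x| <= m%:R.
Proof.
move=> Qx; apply/mx_norm_le => // i; have := Qx i.
rewrite /= in_itv/= => /andP[h1 h2].
by rewrite ler_norml h2 andbT ltW.
Qed.

Let Q_eventually (x : T) m : (Num.bound `|x| <= m)%N -> Q m x.
Proof.
move=> xm i; rewrite /= in_itv/=.
have xi : `|x i ord0| < m%:R.
  apply: le_lt_trans (norm_coord x i) _.
  by apply: lt_le_trans (archi_boundP (normr_ge0 _)) _; rewrite ler_nat.
by move: xi; rewrite ltr_norml => /andP[-> /ltW ->].
Qed.

Let mQ m : measurable (Q m).
Proof. by apply: measurable_rectangle => i; exact: measurable_itv. Qed.

Let L2_indCQ (S : set T) m : measurable S -> L2 (indC (S `&` Q m)).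
Proof.
move=> mS; apply: (@L2_indC _ m%:R); first exact: measurableI.
by move=> x [_]; exact: Q_cube.
Qed.

(** The sets with indicator in [W], after intersection with a fixed bounded box,
    form a Dynkin class; it contains the half-open boxes, which generate the
    sigma-algebra. *)
Lemma W_indic (S : set T) m : measurable S -> W (indC (S `&` Q m)).
Proof.
pose H : set (set T) := [set S | measurable S /\ W (indC (S `&` Q m))].
suff main : <<s rectangles (@ocitv R) >> `<=` H.
  rewrite (_ : measurable S = (<<s @rectangles R n.+1 (@ocitv R) >> S)).
    by move=> /main[].
  congr (_ S); apply: (@measurable_rectangles _ _ _
    (fun k => `](- k%:R : R), k%:R]%classic)) => //.
  - by move=> k; exact: is_ocitv.
  - move=> k l kl x; rewrite /= !in_itv/= => /andP[h1 h2].
    have : k%:R <= l%:R :> R by rewrite ler_nat.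
    by move=> h3; apply/andP; split; lra.
  - apply/seteqP; split => x // _; exists (Num.bound `|x|) => //=.
    have := archi_boundP (normr_ge0 x); rewrite ltr_norml in_itv/=.
    by move=> /andP[-> /ltW].
apply: lambda_system_subset => //; first by apply: rectangles_setI; exact: ocitvI.
- split => //.
  + by split=> //; rewrite setTI; exact: W_box.
  + move=> A B BA [mA WA] [mB WB]; split; first exact: measurableD.
    have -> : indC ((A `\` B) `&` Q m) =
        indC (A `&` Q m) + cst (-1) * indC (B `&` Q m).
      apply/funext => x; rewrite !fctE /indC !indicE mulN1r.
      have [Qx|Qx] := pselect (Q m x); last first.
        by rewrite !memNset ?subrr//= => -[].
      have [Bx|Bx] := pselect (B x).
        have Ax := BA _ Bx.
        by rewrite memNset ?mem_set ?subrr//=; move=> [[_]].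
      have [Ax|Ax] := pselect (A x).
        by rewrite mem_set// mem_set// memNset//= ?subr0// => -[].
      by rewrite !memNset ?subrr//= => -[] // [].
    by apply: WD => //; exact: WZ.
  + move=> F ndF FH; have mF k : measurable (F k) by exact: (FH k).1.
    have mU : measurable (\bigcup_k F k) by exact: bigcup_measurable.
    split=> //; apply: (@W_limit _ (fun k => indC (F k `&` Q m))).
    * exact: L2_indCQ.
    * by move=> k; exact: (FH k).2.
    pose S' k := (\bigcup_i F i) `\` F k.
    have -> : (fun k => sqnorm (indC (\bigcup_i F i `&` Q m) - indC (F k `&` Q m))) =
        (fun k => sqnorm (trunc (S' k) (indC (\bigcup_i F i `&` Q m)))).
      apply/funext => k; congr sqnorm; apply/funext => x.
      rewrite truncE !fctE /indC !indicE /S'.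
      have [Qx|Qx] := pselect (Q m x); last first.
        rewrite (memNset (A := \bigcup_i F i `&` Q m)); last by move=> [].
        rewrite (memNset (A := F k `&` Q m)); last by move=> [].
        by rewrite subrr if_same.
      have [Fx|Fx] := pselect (F k x).
        rewrite (mem_set (A := F k `&` Q m))// mem_set; last by split=> //; exists k.
        by rewrite subrr memNset// => -[].
      rewrite (memNset (A := F k `&` Q m)); last by move=> [].
      have [Ux|Ux] := pselect ((\bigcup_i F i) x).
        by rewrite mem_set// mem_set// subr0.
      by rewrite memNset ?subrr ?if_same// => -[].
    apply: vanishes_trunc; [by move=> k; exact: measurableD|exact: L2_indCQ|].
    apply: aeW => x; have [[k _ Fkx]|nF] := pselect ((\bigcup_k F k) x).
      exists k => l kl [_]; apply; move: Fkx; apply/subsetPset; exact: ndF.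
    by exists 0%N => k _ [].
- move=> A [B HB ->]; split.
    apply: measurable_rectangle => i; have [ab _ <-] := HB i.
    exact: measurable_itv.
  have /choice[ab abE] : forall i, exists ab : R * R, B i = `]ab.1, ab.2]%classic.
    by move=> i; have [ab _ <-] := HB i; exists ab.
  have [C CE] : exists C : 'I_n.+1 -> R * R, rectangle B `&` Q m =
      rectangle (fun i => `](C i).1, (C i).2]%classic).
    exists (fun i => (Num.max (ab i).1 (- m%:R), Num.min (ab i).2 m%:R)).
    apply/seteqP; split => x /=.
      move=> [Bx Qx] i; have := Bx i; have := Qx i.
      by rewrite abE /= !in_itv/= gt_max le_min => /andP[-> ->] /andP[-> ->].
    move=> Cx; split=> i; have := Cx i; rewrite ?abE /= !in_itv/= gt_max le_min;
      by move=> /andP[/andP[h1 h2] /andP[h3 h4]]; apply/andP.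
  by rewrite CE; exact: W_box.
Qed.

Import HBNNSimple.

(** Simple functions increase to [f]; cutting them off on growing boxes keeps
    them in [W]. *)
Lemma W_nonneg (f : T -> R) : measurable_fun setT f -> (forall x, 0 <= f x) ->
  L2 (fun x => (f x)%:C%C) -> W (fun x => (f x)%:C%C).
Proof.
move=> mf f0 f2.
have mfE : measurable_fun [set: T] (EFin \o f) by exact/measurable_EFinP.
pose g := nnsfun_approx measurableT mfE.
have g_le k x : g k x <= f x.
  rewrite -lee_fin /g nnsfun_approxE; apply: (@le_approx _ _ _ setT (EFin \o f)) => // y _.
  by rewrite /= lee_fin.
have g_ge0 k x : 0 <= g k x by exact: fun_ge0.
have g_cvg x : (fun k => g k x) @ \oo --> f x.
  have := @cvg_nnsfun_approx _ _ _ setT measurableT _ mfE (fun y _ => f0 y) x I.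
  by move=> /fine_cvgP[_].
pose F k (x : T) := (g k x * \1_(Q k) x)%:C%C.
have [_ f2i] := (L2P _).1 f2.
apply: (@W_limit _ F) => //.
  move=> k; pose s := fset_set (g k @` setT).
  have -> : F k = \sum_(i < #|`s|) cst (s`_i)%:C%C * indC (g k @^-1` [set s`_i] `&` Q k).
    apply/funext => x; rewrite fct_sumE /F fimfunEord mulr_suml rmorph_sum.
    apply: eq_bigr => i _; rewrite !fctE /indC -rmorphM -mulrA; congr (_ * _)%:C%C.
    by rewrite indicI.
  apply: (big_ind W) => //.
  - have := WZ 0 (W_box (fun=> 0) (fun=> 0)); congr W.
    by apply/funext => x; rewrite fctE mul0r.
  - by move=> i _; apply: WZ; apply: W_indic; exact: measurable_sfunP.
apply: (@vanishes_sqnorm _ _ _ (fun x => normc (f x)%:C%C ^+ 2)) => //.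
- move=> k; apply: cmeasurableD; first exact: L2_cmeasurable.
  split => /=; last exact: measurable_cst.
  apply: measurable_funN; apply: measurable_funM.
    exact: measurable_funP.
  exact: measurable_indic.
- move=> k x; rewrite !fctE /F -rmorphB !normcR.
  have Fk : 0 <= g k x * \1_(Q k) x <= f x.
    rewrite indicE; have := g_le k x; have := g_ge0 k x.
    by case: (_ \in _) => /=; rewrite ?mulr1 ?mulr0 ?f0 ?lexx// => -> ->.
  apply: lerXn2r; rewrite ?nnegrE// ger0_norm ?ger0_norm//; have := f0 x; lra.
apply: aeW => x.
have : (fun k => (f x - g k x) ^+ 2) @ \oo --> (0 : R).
  have H : (fun k => f x - g k x) @ \oo --> f x - f x.
    by apply: cvgB => //; exact: cvg_cst.
  have -> : (fun k => (f x - g k x) ^+ 2) =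
      (fun k => f x - g k x) * (fun k => f x - g k x).
    by apply/funext => k; rewrite expr2.
  by rewrite -[X in _ --> X](mul0r (f x - f x)) -{1}(subrr (f x)); exact: cvgM.
apply: cvg_trans; apply: near_eq_cvg; near=> k.
rewrite !fctE /F -rmorphB normcR real_normK ?num_real// indicE mem_set ?mulr1//.
apply: Q_eventually; near: k; exact: nbhs_infty_ge.
Unshelve. all: by end_near. Qed.

(** Splitting into positive and negative, real and imaginary parts. *)
Theorem W_L2 f : L2 f -> W f.
Proof.
move=> f2; have [mf fi] := (L2P f).1 f2.
have pos (u : T -> R) : measurable_fun setT u ->
    (forall x, `|u x| <= normc (f x)) -> W (fun x => (Num.max (u x) 0)%:C%C).
  move=> mu_u uf.
  have mmax : measurable_fun setT (fun x => Num.max (u x) 0).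
    by apply: measurable_maxr => //; exact: measurable_cst.
  apply: W_nonneg => //; first by move=> x; rewrite le_max lexx orbT.
  apply: (L2_le _ fi); first by split=> //=; exact: measurable_cst.
  move=> x; rewrite normcR; apply: lerXn2r; rewrite ?nnegrE ?normc_ge0//.
  apply: le_trans (uf x); have := ler_norm (u x); have := normr_ge0 (u x).
  by case: (leP (u x) 0) => u0; rewrite ?normr0// ger0_norm// ltW.
have part (u : T -> R) : measurable_fun setT u ->
    (forall x, `|u x| <= normc (f x)) -> W (fun x => (u x)%:C%C).
  move=> mu_u uf.
  have -> : (fun x => (u x)%:C%C) = (fun x => (Num.max (u x) 0)%:C%C) +
      cst (-1) * (fun x => (Num.max (- u x) 0)%:C%C).
    apply/funext => x; rewrite !fctE mulN1r -rmorphB; congr (_%:C%C).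
    by case: (leP (u x) 0) => u0; case: (leP (- u x) 0) => u1; lra.
  apply: WD; first exact: pos.
  apply: WZ; apply: (pos (fun x => - u x)); first exact: measurable_funN.
  by move=> x; rewrite normrN.
have -> : f = (fun x => (complex.Re (f x))%:C%C) +
    cst 'i%C * (fun x => (complex.Im (f x))%:C%C).
  by apply/funext => x; exact: complexE.
apply: WD; last apply: WZ; apply: part.
- exact: mf.1.
- by move=> x; exact: le_Re_normc.
- exact: mf.2.
- by move=> x; exact: le_Im_normc.
Qed.

End density.

(** * Density of the scales *)

Section density_of_scales.
Variables (R : realType) (n : nat) (Gamma : set (affine R n.+1))
  (G : set 'M[R]_n.+1) (Lambda : set 'cV[R]_n.+1)
  (a : 'M[R]_n.+1) (phi : 'cV[R]_n.+1 -> R[i]).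
Let mu := lebesgue_cV R n.+1.
Local Notation T := 'cV[R]_n.+1.
Local Notation L2 := (@Defs.L2 R n.+1).
Local Notation normc := (@Normc.normc R).
Hypothesis hGamma : crystal_triple Gamma G Lambda.
Hypothesis hsplit : splitting Gamma G Lambda.
Hypothesis finG : finite_set G.
Hypothesis ha : admissible Gamma a.
Hypothesis hphi : L2 phi.
Hypothesis hsupp : compactly_supported phi.
Hypothesis horth : orthonormal_on Gamma (fun s => dil s phi).
Implicit Types (s t : affine R n.+1) (x v : T) (f g h : T -> R[i]).

Local Notation e := (fun s => dil s phi).
Local Notation V := (V0 Gamma phi).

Variables (P : set T) (rho : R).
Hypotheses (rho0 : 0 < rho) (Prho : forall x, P x -> `|x| <= rho).
Hypothesis fdP : fundamental_domain Gamma P.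

Let p := fine (mu P).

Let p0 : 0 < p. Proof. exact: (domain_volume_gt0 hGamma hsplit finG Prho fdP). Qed.

Local Notation Vj := (Vj Gamma a phi).
Local Notation ratio := (normc (cintegral phi) ^+ 2 / p).

Lemma expzN_invmx (k : nat) : a ^ (- k%:Z) = invmx a ^+ k.
Proof. by rewrite -invr_expz -[LHS]/(invmx (a ^+ k)) invmx_expn. Qed.

Lemma det_invmx_expn (k : nat) : `|\det (invmx a ^+ k)| = (`|\det a| ^+ k)^-1.
Proof.
rewrite -invmx_expn det_inv normfV; congr (_^-1).
elim: k => [|k IH]; first by rewrite !expr0 det1 normr1.
by rewrite !exprS -IH -normrM -det_mulmx.
Qed.

Lemma VjE (k : nat) f : Vj k f <-> V (pull (invmx a ^+ k) f).
Proof. by rewrite Vj_pull// expzN_invmx. Qed.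

Lemma Vj_L2 j f : Vj j f -> L2 f.
Proof.
rewrite Vj_pull// => /V_L2 Vf.
have -> : f = pull (a ^ j) (pull (a ^ (- j)) f) by rewrite pullM (expzVK ha) pull1.
by apply: L2_pull => //; exact: (det_expz_neq0 ha).
Qed.

Lemma union_L2 : \bigcup_(j in [set: int]) Vj j `<=` L2.
Proof. by move=> f [j _]; exact: Vj_L2. Qed.

(** The approximation [g] is the orthogonal projection of the test function on
    the [k]-th space, computed at scale 0 as a finite Fourier sum. *)
Lemma test_projection (f : T -> R) (C M Lip : R) :
  0 <= C -> 0 <= M -> 0 <= Lip -> measurable_fun setT f ->
  (forall x, `|f x| <= M) -> (forall x, C < `|x| -> f x = 0) ->
  (forall x y, `|f x - f y| <= Lip * `|x - y|) ->
  forall eps : R, 0 < eps -> exists K, forall k, (K <= k)%N -> exists g,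
    [/\ Vj k g,
        `|(1 - ratio) * sqnorm (fun x => (f x)%:C%C) -
          sqnorm ((fun x => (f x)%:C%C) - g)| <= eps &
        forall g', Vj k g' ->
          sqnorm ((fun x => (f x)%:C%C) - g) <= sqnorm ((fun x => (f x)%:C%C) - g')].
Proof.
move=> C0 M0 Lip0 mf fM fC fL eps e0; set fc := fun x => (f x)%:C%C.
have f2 : L2 fc by exact: (L2_bounded_support C0 mf fM fC).
have [K HK] := fourier_energy hGamma hsplit finG ha hphi hsupp rho0 Prho fdP
  C0 M0 Lip0 mf fM fC fL e0.
exists K => k /HK; rewrite -/fc; set h := pull _ fc => -[F [FG far energy]].
have dk : \det (invmx a ^+ k) != 0.
  by rewrite -normr_gt0 det_invmx_expn invr_gt0 exprn_gt0// normr_gt0 (det_neq0 ha).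
set q := `|\det a| ^+ k in energy.
have q0 : 0 < q by rewrite exprn_gt0// normr_gt0 (det_neq0 ha).
have h2 : L2 h by exact: L2_pull.
have scale u : L2 u -> sqnorm (pull (invmx a ^+ k) u) = q * sqnorm u.
  by move=> u2; rewrite (sqnorm_pull dk u2) det_invmx_expn mulrA divff ?mul1r// gt_eqF.
have e2 := L2_dil hGamma hphi.
have uF : uniq F by exact: fset_uniq.
have p2 : L2 (proj e F h) by apply: L2_proj FG.
pose g := pull (a ^+ k) (proj e F h).
have gE : pull (invmx a ^+ k) g = proj e F h.
  by rewrite pullM -invmx_expn mulmxV ?pull1//; exact: (expz_unit ha k).
have Vg : Vj k g by rewrite VjE gE; exact: proj_closed_span FG.
have g2 := Vj_L2 Vg.
have hg : q * sqnorm (fc - g) = sqnorm (h - proj e F h).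
  by rewrite -scale; [rewrite -gE|exact: L2B].
exists g; split=> //.
  have := sqnorm_sub_proj e2 horth uF FG h2; rewrite -hg => S.
  rewrite -(ler_pM2l q0) -[X in X * `|_|](gtr0_norm q0) -normrM.
  have -> : q * ((1 - ratio) * sqnorm fc - sqnorm (fc - g)) =
      \sum_(s <- F) normc (inner h (e s)) ^+ 2 - ratio * sqnorm h.
    by rewrite mulrBr S (scale _ f2); ring.
  by rewrite [q * eps]mulrC.
move=> g' Vg'; have g'2 := Vj_L2 Vg'; move: Vg'; rewrite VjE => Vg'.
rewrite -(ler_pM2l q0) hg -scale; last exact: L2B.
apply: (sqnorm_sub_proj_le e2 FG h2 (V_L2 Vg')).
have far' t : Gamma t -> t \notin F -> inner h (e t) = 0 by exact: far.
apply: (sub_proj_orthogonal e2 horth uF FG h2 far').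
apply: closed_spanD; first exact: (generators_L2 hGamma hphi).
  exact: proj_closed_span FG.
by rewrite -cstN1E; apply: (VZ hGamma hphi).
Qed.

Lemma VjD j f g : Vj j f -> Vj j g -> Vj j (f + g).
Proof.
rewrite !Vj_pull// => Vf Vg.
exact: (closed_spanD (generators_L2 hGamma hphi) Vf Vg).
Qed.

Lemma VjZ j (c : R[i]) f : Vj j f -> Vj j (cst c * f).
Proof. by rewrite !Vj_pull// => Vf; exact: (VZ hGamma hphi c Vf). Qed.

(** The functions that the scales eventually approximate form a closed
    subspace; when the ratio is 1 it contains all test functions. *)
Lemma ratio1_dense : ratio = 1 ->
  L2closure (\bigcup_(j in [set: int]) Vj j) = L2.
Proof.
move=> ratio1.
pose W := [set f : T -> R[i] | L2 f /\ forall eps : R, 0 < eps ->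
  exists K, forall k : nat, (K <= k)%N -> exists2 g, Vj k g & sqnorm (f - g) < eps].
apply/seteqP; split=> f; first by case.
move=> f2; suff [_ Wf] : W f.
  apply/L2closureP; first exact: union_L2.
  split=> // eps /Wf[K HK]; have [g Vg fg] := HK K (leqnn _).
  by exists g => //; exists K%:Z.
apply: W_L2 f2 => {f}.
- move=> f g [f2 Wf] [g2 Wg]; split; first exact: L2D.
  move=> eps e0; have e4 : 0 < eps / 4 by rewrite divr_gt0.
  have [K1 H1] := Wf _ e4; have [K2 H2] := Wg _ e4.
  exists (maxn K1 K2) => k; rewrite geq_max => /andP[/H1[f' Vf' ff'] /H2[g' Vg' gg']].
  exists (f' + g'); first exact: VjD.
  rewrite opprD addrACA; apply: le_lt_trans (sqnormD_le _ _) _.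
  + exact: L2B f2 (Vj_L2 Vf').
  + exact: L2B g2 (Vj_L2 Vg').
  + lra.
- move=> c f [f2 Wf]; split; first exact: L2Z.
  move=> eps e0; have c0 : 0 < normc c ^+ 2 + 1 by rewrite ltr_wpDl// sqr_ge0.
  have [K HK] := Wf _ (divr_gt0 e0 c0); exists K => k /HK[g Vg fg].
  exists (cst c * g); first exact: VjZ.
  have fg2 := L2B f2 (Vj_L2 Vg); rewrite -mulrBr sqnormZ//.
  move: fg; rewrite ltr_pdivlMr// => fg; have := sqnorm_ge0 (f - g); nra.
- move=> f f2 Wf; split=> // eps e0; have e4 : 0 < eps / 4 by rewrite divr_gt0.
  have [g [g2 Wg] fg] := Wf _ e4; have [K HK] := Wg _ e4.
  exists K => k /HK[h Vh gh]; exists h => //.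
  apply: le_lt_trans (sqnormB_le f2 g2 (Vj_L2 Vh)) _; lra.
move=> f C M Lip C0 M0 Lip0 mf fM fC fL; split.
  exact: (L2_bounded_support C0 mf fM fC).
move=> eps e0; have e2 : 0 < eps / 2 by rewrite divr_gt0.
have [K HK] := test_projection C0 M0 Lip0 mf fM fC fL e2.
exists K => k /HK[g [Vg fg _]]; exists g => //.
move: fg; rewrite ratio1 subrr mul0r sub0r normrN ger0_norm ?sqnorm_ge0//; lra.
Qed.

Lemma Vj_nested (j : int) (m : nat) f :
  (forall i : int, Vj i `<=` Vj (i + 1)) -> Vj j f -> Vj (j + m%:Z) f.
Proof.
move=> nest; elim: m => [|m IH] Vf; first by rewrite addr0.
by rewrite -addn1 PoszD addrA; apply: nest; exact: IH.
Qed.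

(** In a nested family approximation at one scale persists at all later ones,
    which forces the ratio to be 1 on every test function of nonzero norm;
    and not all test functions are null, since they are dense. *)
Lemma nested_dense_ratio1 : (forall i : int, Vj i `<=` Vj (i + 1)) ->
  L2closure (\bigcup_(j in [set: int]) Vj j) = L2 -> ratio = 1.
Proof.
move=> nest dense; apply: contrapT => ratio1.
pose W := [set f : T -> R[i] | L2 f /\ sqnorm f = 0].
have phi1 : sqnorm phi = 1.
  rewrite -(sqnorm_dil hGamma hphi horth (Gamma_id hGamma)).
  rewrite (dilE phi hGamma); last exact: (Gamma_id hGamma).
  by congr sqnorm; apply/funext => x; rewrite /aff_apply /= invmx1 !mul1mx oppr0 addr0.
suff /(_ _ hphi)[_ /eqP] : L2 `<=` W by rewrite phi1 oner_eq0.
apply: W_L2.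
- move=> f g [f2 f0] [g2 g0]; split; first exact: L2D.
  by apply/eqP; rewrite eq_le sqnorm_ge0 andbT (le_trans (sqnormD_le f2 g2))// f0 g0; lra.
- by move=> c f [f2 f0]; split; [exact: L2Z|rewrite sqnormZ// f0 mulr0].
- move=> f f2 Wf; split=> //; apply/eqP; rewrite eq_le sqnorm_ge0 andbT.
  apply/ler_addgt0Pr => eps e0; rewrite add0r.
  have e2 : 0 < eps / 2 by rewrite divr_gt0.
  have [g [g2 g0] fg] := Wf _ e2; rewrite -[f](subrK g).
  apply: le_trans (sqnormD_le (L2B f2 g2) g2) _; rewrite g0; lra.
move=> f C M Lip C0 M0 Lip0 mf fM fC fL; set fc := fun x => (f x)%:C%C.
have f2 : L2 fc by exact: (L2_bounded_support C0 mf fM fC).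
split=> //.
suff : (1 - ratio) * sqnorm fc = 0.
  move=> /eqP; rewrite mulf_eq0 subr_eq0 => /orP[/eqP r1|/eqP//].
  by exfalso; apply: ratio1.
apply/eqP; rewrite -normr_eq0 eq_le normr_ge0 andbT.
apply/ler_addgt0Pr => eps e0; rewrite add0r.
have e2 : 0 < eps / 2 by rewrite divr_gt0.
have : L2closure (\bigcup_(j in [set: int]) Vj j) fc by rewrite dense.
move=> /(L2closureP _ union_L2)[_ /(_ _ e2)[g' [j _ Vg'] fg']].
have [K HK] := test_projection C0 M0 Lip0 mf fM fC fL e2.
pose k := maxn K (absz j); have [|g [Vg fg best]] := HK k; first exact: leq_maxl.
have Vkg' : Vj k g'.
  have kj : j <= k%:Z.
    apply: (le_trans (lez_abs j)); rewrite lez_nat; exact: leq_maxr.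
  have -> : k%:Z = j + (absz (k%:Z - j))%:Z by rewrite gez0_abs ?subr_ge0// addrCA subrr addr0.
  exact: Vj_nested.
have := best _ Vkg'; rewrite -/fc => bg.
rewrite -/fc in fg.
have := sqnorm_ge0 (fc - g).
set u := (1 - ratio) * sqnorm fc in fg *; set v := sqnorm (fc - g) in fg bg *.
move=> v0; have -> : u = (u - v) + v by ring.
apply: le_trans (ler_normD _ _) _; rewrite (ger0_norm v0); lra.
Qed.

End density_of_scales.

Lemma fourier0 (R : realType) n (f : 'cV[R]_n -> R[i]) :
  fourier f 0 = cintegral f.
Proof.
congr cintegral; apply/funext => x.
have -> : dotv x 0 = 0 by rewrite /dotv big1// => i _; rewrite mxE mulr0.
by rewrite mulr0 cos0 sin0 oppr0 -[Complex 1 0]/(1 : R[i]) mulr1.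
Qed.

Theorem theorem3p13 (R : realType) (n : nat)
    (Gamma : set (affine R n.+1)) (G : set 'M[R]_n.+1)
    (Lambda : set 'cV[R]_n.+1) (r : nat) (a : 'M[R]_n.+1)
    (phi : 'cV[R]_n.+1 -> R[i])
    (hGamma : crystal_triple Gamma G Lambda)
    (hsplit : splitting Gamma G Lambda)
    (hr : (G #= `I_r)%card)
    (ha : admissible Gamma a)
    (hdigits : has_tiling_digits Lambda a)
    (hphi : L2 phi)
    (hsupp : compactly_supported phi)
    (horth : orthonormal_on Gamma (fun s => dil s phi)) :
  let V := Vj Gamma a phi in
  let dense := L2closure (\bigcup_(j in [set: int]) V j) = @L2 R n.+1 in
  [/\ [/\ forall j : int, V (j + 1) = dil (aff_lin a) @^-1` V j,
         orthonormal_basis Gamma (fun s => dil s phi) (V0 Gamma phi) &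
         \bigcap_(j in [set: int]) V j =
           [set f | L2 f /\ {ae lebesgue_cV R n.+1, forall x, f x = 0}]],
      (forall j : int, V j `<=` V (j + 1)) <-> refinable Gamma a phi &
      forall L : set 'cV[R]_n.+1,
        fundamental_domain [set aff_trans v | v in Lambda] L ->
        let star := Normc.normc (fourier phi 0) ^+ 2 =
                      fine (lebesgue_cV R n.+1 L) / r%:R in
        (star -> dense) /\ (refinable Gamma a phi -> (dense <-> star))].
Proof.
move=> V dense.
have finG : finite_set G by apply/finite_setP; exists r.
have nested := nested_refinable hGamma hsplit finG ha hphi hsupp horth.
split=> //.
  split.
  - by move=> j; exact: (Vj_succ hGamma ha hphi).
  - exact: (V_basis hGamma hphi horth).
  - exact: (bigcap_Vj hGamma hsplit finG ha hphi hsupp horth).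
move=> L fdL star.
have [P [rho [rho0 Prho fdP]]] := bounded_fundamental_domain hGamma.
have p0 := domain_volume_gt0 hGamma hsplit finG Prho fdP.
have Lvol := lattice_domain_volume hGamma hsplit finG Prho fdP hr fdL.
have r0 : r%:R != 0 :> R.
  rewrite pnatr_eq0; apply/eqP => r0; move: hr; rewrite r0 II0 card_eq0 => /eqP G0.
  have : G 1%:M by rewrite (G_E hGamma); exists (aff_id R n.+1) => //; exact: (Gamma_id hGamma).
  by rewrite G0.
have starE : star <->
    Normc.normc (cintegral phi) ^+ 2 / fine (lebesgue_cV R n.+1 P) = 1.
  rewrite /star fourier0 Lvol /= mulrC mulKf//.
  split=> [->|H]; first by rewrite divff// gt_eqF.
  by rewrite -[LHS](divfK (lt0r_neq0 p0)) H mul1r.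
split=> [/starE ratio1|ref].
  exact: (ratio1_dense hGamma hsplit finG ha hphi hsupp horth rho0 Prho fdP ratio1).
split=> [dns|/starE ratio1].
  apply/starE.
  by apply: (nested_dense_ratio1 hGamma hsplit finG ha hphi hsupp horth rho0 Prho fdP) => //;
    exact/nested.
exact: (ratio1_dense hGamma hsplit finG ha hphi hsupp horth rho0 Prho fdP ratio1).
Qed.
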